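(* Let $n\in\{4,5,6,7,8\}$, let $\mathcal{B}_n$ be the $R_n$-basis of the generic Hecke algebra $\mathcal{H}(G_n)$ listed in the context, and let $\tau:\mathcal{H}(G_n)\to R_n$ be the $R_n$-linear map defined by $\tau(b)=\delta_{1b}$ for all $b\in\mathcal{B}_n$. Then $\tau$ is the canonical symmetrising trace on $\mathcal{H}(G_n)$. In particular, the BMM symmetrising trace conjecture (existence of a canonical symmetrising trace on $\mathcal{H}(G_n)$) holds for $G_n$.
   Context: For a commutative integral domain $R$ and an $R$-algebra $H$ that is free and finitely generated as an $R$-module, a symmetrising trace is an $R$-linear map $\tau:H\to R$ such that, for an $R$-basis $\mathcal{B}$ of $H$, the matrix $(\tau(bb'))_{b,b'\in\mathcal{B}}$ is symmetric with determinant a unit of $R$. Canonical symmetrising trace. For $n\in\{4,\dots,8\}$ let $B(G_n)$ be the braid group of the exceptional complex reflection group $G_n$, presented by the generators and braid relations listed below, $\mathbf z$ the listed generator of the centre of $B(G_n)$, $\boldsymbol\pi:=\mathbf z^{|Z(G_n)|}$, $\beta\mapsto T_\beta$ the natural map $B(G_n)\to\mathcal{H}(G_n)$ sending generators to generators, and $x\mapsto x^*$ the ring automorphism of $R_n$ inverting every indeterminate. $G_n$ is the quotient of $B(G_n)$ obtained by adding $x^{e_x}=1$ for each generator $x$, where $e_x$ is the degree of the polynomial relation of $x$ in $\mathcal{H}(G_n)$. A canonical symmetrising trace on $\mathcal{H}(G_n)$ is a symmetrising trace $\tau$ such that (1) $\tau$ specialises to the canonical symmetrising trace $w\mapsto\delta_{1w}$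 of the group algebra of $G_n$ when the indeterminate with index $j$ attached to a generator $x$ is sent to $\zeta_{e_x}^{j}$, $\zeta_e=\exp(2\pi i/e)$ (i.e. the specialisation of $\tau(T_\beta)$ is $1$ if $\beta\in B(G_n)$ has trivial image in $G_n$, and $0$ otherwise); (2) $\tau(T_{\beta^{-1}})^*=\tau(T_{\beta\boldsymbol\pi})/\tau(T_{\boldsymbol\pi})$ for all $\beta\in B(G_n)$. It is known that there is at most one such trace. The algebras. $R_n=\mathbb{Z}[\mathbf{u},\mathbf{u}^{-1}]$ is the ring of integer Laurent polynomials in the indeterminates listed; $\mathcal{H}(G_n)$ is the associative unital $R_n$-algebra given by the listed generators, braid relations and polynomial relations. Below $z=T_{\mathbf z}$, and $\mathcal{B}_n$ is an $R_n$-basis of $\mathcal{H}(G_n)$ with $|G_n|$ elements ($|G_4|,\dots,|G_8|=24,72,48,144,96$). - $G_4$: generators $s,t$; braid relation $sts=tst$; $\prod_{i=0}^2(s-u_i)=\prod_{i=0}^2(t-u_i)=0$; $\mathbf z=ststst$; $|Z(G_4)|=2$. $\mathcal{B}_4=\{1,s,s^2,z,zs,zs^2\}\cup\{s^it^js^k : i,k\in\{0,1,2\},\ j\in\{1,2\}\}$. - $G_5$: generators $s,t$; $stst=tsts$; $\prod_{i=0}^2(s-u_{s,i})=\prod_{j=0}^2(t-u_{t,j})=0$; $\mathbf z=stst$; $|Z(G_5)|=6$. $\mathcal{B}_5=\{z^kx : 0\le k\le 5,\ x\in\{1,s,s^2,t,t^2,st,s^2t,st^2,s^2t^2,t^{-1}s,t^{-1}st,t^{-1}st^2\}\}$.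 - $G_6$: generators $s,t$; $ststst=tststs$; $\prod_{i=0}^1(s-u_{s,i})=\prod_{j=0}^2(t-u_{t,j})=0$; $\mathbf z=ststst$; $|Z(G_6)|=4$. $\mathcal{B}_6=\{z^kx : 0\le k\le 3,\ x\in\{1,t,t^2,s,st,st^2,ts,t^2s,tst,tst^2,t^2st,t^2st^2\}\}$. - $G_7$: generators $s,t,u$; $stu=tus=ust$; $\prod_{i=0}^1(s-u_{s,i})=\prod_{j=0}^2(t-u_{t,j})=\prod_{k=0}^2(u-u_{u,k})=0$; $\mathbf z=stu$; $|Z(G_7)|=12$. $\mathcal{B}_7=\big(\widetilde{\mathcal{B}}_7\setminus\{tu^{-1},tu^{-1}t,tu^{-1}t^2\}\big)\cup\{tu^2,tu^2t,tu^2t^2\}$, where $\widetilde{\mathcal{B}}_7=\{z^kx : 0\le k\le 11,\ x\in\{1,u,u^2,t,t^2,ut,u^2t,ut^2,u^2t^2,tu^{-1},tu^{-1}t,tu^{-1}t^2\}\}$. - $G_8$: generators $s,t$; $sts=tst$; $\prod_{i=0}^3(s-u_i)=\prod_{i=0}^3(t-u_i)=0$; $\mathbf z=ststst$; $|Z(G_8)|=4$. $\mathcal{B}_8=\{z^kx : 0\le k\le 3,\ x\in\{s^i : 0\le i\le 3\}\cup\{s^its^j : 0\le i,j\le 3\}\cup\{s^it^2 : 0\le i\le 3\}\}$. *)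

(* Defs.v *)
From HB Require Import structures.
From mathcomp Require Import all_boot all_order all_algebra all_field.
From mathcomp Require Import boolp.
From mathcomp Require Import mpoly.
From mathcomp Require monalg.
Set Implicit Arguments.
Unset Strict Implicit.
Unset Printing Implicit Defensive.
Import GRing.Theory.
Local Open Scope quotient_scope.
Local Open Scope ring_scope.

Module LaurentRing.

(* The Laurent polynomial ring Z[u_i, u_i^-1 : i in I], as the subring of
   the field of fractions of Z[u_i : i in I] formed by the p / (monomial). *)
Section Laurent.
Variable I : finType.

Definition laurent_frac := {fraction {mpoly int[#|I|]}}.

Definition laurent_pred : {pred laurent_frac} := fun x =>
  `[< exists (p : {mpoly int[#|I|]}) (m : 'X_{1..#|I|}),
        x = tofrac p / tofrac 'X_[m] >].

Lemma mpolyX_neq0 m : ('X_[m] : {mpoly int[#|I|]}) != 0.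
Proof. by rewrite -msize_poly_eq0 msizeX. Qed.

Lemma fracX_neq0 m : tofrac ('X_[m] : {mpoly int[#|I|]}) != 0.
Proof. by rewrite tofrac_eq0 mpolyX_neq0. Qed.

Lemma laurent_subB (p q : {mpoly int[#|I|]}) m k :
  tofrac p / tofrac 'X_[m] - tofrac q / tofrac 'X_[k]
  = tofrac (p * 'X_[k] - q * 'X_[m]) / tofrac 'X_[(m + k)%MM].
Proof.
rewrite mpolyXD rmorphB /= !tofracM -mulNr addf_div ?fracX_neq0 //.
by rewrite mulNr.
Qed.

Lemma laurent_subring : subring_closed laurent_pred.
Proof.
split=> [|x y /asboolP[p [m ->]] /asboolP[q [k ->]]
         |x y /asboolP[p [m ->]] /asboolP[q [k ->]]]; apply/asboolP.
- by exists 1, 0%MM; rewrite mpolyX0 tofrac1 divr1.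
- by rewrite laurent_subB; do 2!eexists.
- by exists (p * q), (m + k)%MM; rewrite mpolyXD !tofracM mulf_div.
Qed.

HB.instance Definition _ :=
  GRing.isSubringClosed.Build laurent_frac laurent_pred laurent_subring.

Record laurent := Laurent { lval : laurent_frac; _ : lval \in laurent_pred }.

HB.instance Definition _ := [isSub for lval].
HB.instance Definition _ := [Choice of laurent by <:].
HB.instance Definition _ := [SubChoice_isSubComNzRing of laurent by <:].

Definition laurent_unit : {pred laurent} :=
  fun x => (x != 0) && ((lval x)^-1 \in laurent_pred).
Definition laurent_inv (x : laurent) : laurent := insubd x (lval x)^-1.

Lemma lval_eq0 x : (lval x == 0) = (x == 0).
Proof. exact: (inj_eq val_inj x 0). Qed.

Lemma laurent_mulVx : {in laurent_unit, left_inverse 1 laurent_inv *%R}.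
Proof.
move=> x /andP[x0 xV]; apply: val_inj; rewrite rmorphM rmorph1 /= val_insubd.
by rewrite xV; apply: mulVf; rewrite lval_eq0.
Qed.

Lemma laurent_unitP (x y : laurent) : y * x = 1 -> laurent_unit x.
Proof.
move=> yx1; have : lval y * lval x = 1 by rewrite -[RHS]/(lval 1) -yx1.
move=> vyx1; apply/andP; split.
  by apply: contra_eq_neq yx1 => ->; rewrite mulr0 eq_sym oner_neq0.
rewrite mulrC in vyx1; rewrite (mulr1_eq vyx1); exact: (valP y).
Qed.

Lemma laurent_inv_out : {in [predC laurent_unit], laurent_inv =1 id}.
Proof.
move=> x /negP xN; apply: val_inj; rewrite /laurent_inv val_insubd.
case: ifP => // xV; have [->|x0] := eqVneq x 0; first by rewrite /= invr0.
by case: xN; apply/andP.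
Qed.

HB.instance Definition _ := GRing.ComNzRing_hasMulInverse.Build laurent
  laurent_mulVx laurent_unitP laurent_inv_out.

Lemma laurent_integral (x y : laurent) : x * y = 0 -> (x == 0) || (y == 0).
Proof.
move=> xy0; have /eqP : lval x * lval y = 0 by rewrite -[RHS]/(lval 0) -xy0.
by rewrite mulf_eq0.
Qed.

HB.instance Definition _ :=
  GRing.ComUnitRing_isIntegral.Build laurent laurent_integral.

Lemma laurent_numdenP (x : laurent) :
  exists pm : {mpoly int[#|I|]} * 'X_{1..#|I|},
    lval x == tofrac pm.1 / tofrac 'X_[pm.2].
Proof. by case: x => x /= /asboolP[p [m ->]]; exists (p, m). Qed.

Definition laurent_numden (x : laurent) := xchoose (laurent_numdenP x).

Lemma lX_subproof (i : I) :
  tofrac ('X_(enum_rank i) : {mpoly int[#|I|]}) \in laurent_pred.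
Proof. by apply/asboolP; exists 'X_(enum_rank i), 0%MM; rewrite mpolyX0 tofrac1 divr1. Qed.

Definition lX (i : I) : laurent := Laurent (lX_subproof i).

Lemma lX_unit i : lX i \is a GRing.unit.
Proof.
apply/andP; split.
  by apply/eqP => /(congr1 lval) /eqP; rewrite /= (negPf (fracX_neq0 _)).
by apply/asboolP; exists 1, U_(enum_rank i)%MM; rewrite tofrac1 div1r.
Qed.

(* leval v is u_i |-> v_i; it is only meaningful when all the v_i are units. *)
Section Eval.
Variables (S : comUnitRingType) (v : I -> S).

Local Notation ev := (mmap (intr : int -> S) (fun k : 'I_#|I| => v (enum_val k))).
Local Notation ev1 := (mmap1 (fun k : 'I_#|I| => v (enum_val k))).

Definition leval (x : laurent) : S :=
  let pm := laurent_numden x in ev pm.1 / ev1 pm.2.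

Hypothesis v_unit : forall i, v i \is a GRing.unit.

Lemma ev1_unit m : ev1 m \is a GRing.unit.
Proof. by apply: rpred_prod => i _; rewrite rpredX // v_unit. Qed.

Lemma evX m : ev 'X_[m] = ev1 m.
Proof. exact: mmapX. Qed.

Lemma leval_frac x p m :
  lval x = tofrac p / tofrac 'X_[m] -> leval x = ev p / ev1 m.
Proof.
rewrite /leval; have /eqP -> := xchooseP (laurent_numdenP x).
rewrite -/(laurent_numden x); case: (laurent_numden x) => q k /= /eqP.
rewrite eqr_div ?fracX_neq0 // -!tofracM tofrac_eq => /eqP eq_qp.
apply/eqP; rewrite -(inj_eq (mulIr (ev1_unit k))) divrK ?ev1_unit //.
rewrite -(inj_eq (mulIr (ev1_unit m))) mulrAC divrK ?ev1_unit //.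
by rewrite -!evX -!rmorphM eq_qp.
Qed.

Lemma leval_is_zmod_morphism : zmod_morphism leval.
Proof.
move=> x y.
have /asboolP[p [m xE]] := valP x; have /asboolP[q [k yE]] := valP y.
rewrite (leval_frac xE) (leval_frac yE).
have /leval_frac-> : lval (x - y)
    = tofrac (p * 'X_[k] - q * 'X_[m]) / tofrac 'X_[(m + k)%MM].
  by rewrite -laurent_subB -xE -yE.
rewrite -!evX mpolyXD rmorphB !rmorphM /= !evX mulrBl invrM ?ev1_unit //.
by rewrite !mulrA mulrK ?ev1_unit // [X in _ - X]mulrAC mulrK ?ev1_unit.
Qed.

Lemma leval_is_monoid_morphism : monoid_morphism leval.
Proof.
split=> [|x y].
  rewrite (@leval_frac _ 1 0%MM) ?mpolyX0 ?tofrac1 ?divr1 //.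
  by rewrite rmorph1 mmap11 divr1.
have /asboolP[p [m xE]] := valP x; have /asboolP[q [k yE]] := valP y.
rewrite (leval_frac xE) (leval_frac yE).
have /leval_frac-> : lval (x * y) = tofrac (p * q) / tofrac 'X_[(m + k)%MM].
  by rewrite mpolyXD !tofracM -mulf_div -xE -yE.
by rewrite -!evX mpolyXD !rmorphM /= !evX mulrACA invrM ?ev1_unit // [_^-1 / _]mulrC.
Qed.

Lemma leval_lX i : leval (lX i) = v i.
Proof.
rewrite (@leval_frac _ 'X_(enum_rank i) 0%MM) ?mpolyX0 ?tofrac1 ?divr1 //.
by rewrite mmap11 divr1 mmapX mmap1U enum_rankK.
Qed.

End Eval.

Definition lstar : laurent -> laurent := leval (fun i => (lX i)^-1).

Lemma lXV_unit i : (lX i)^-1 \is a GRing.unit.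
Proof. by rewrite unitrV lX_unit. Qed.

HB.instance Definition _ := GRing.isZmodMorphism.Build laurent laurent lstar
  (leval_is_zmod_morphism lXV_unit).
HB.instance Definition _ := GRing.isMonoidMorphism.Build laurent laurent lstar
  (leval_is_monoid_morphism lXV_unit).

Lemma lstar_lX i : lstar (lX i) = (lX i)^-1.
Proof. exact: leval_lX lXV_unit i. Qed.

End Laurent.

End LaurentRing.
Export LaurentRing.

Module GroupPresentation.

(* Group presented by generators X and relations l = r for (l, r) in rels;
   the letter (x, true) stands for the inverse of the generator x. *)
Section PresentedGroup.
Variables (X : choiceType) (rels : seq (seq (X * bool) * seq (X * bool))).

Local Notation word := (seq (X * bool)).
Definition inv_letter (a : X * bool) := (a.1, ~~ a.2).
Definition inv_word (w : word) : word := rev (map inv_letter w).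

Inductive word_eq : word -> word -> Prop :=
| word_eq_rel lr : lr \in rels -> word_eq lr.1 lr.2
| word_eq_inv a : word_eq [:: a; inv_letter a] [::]
| word_eq_refl w : word_eq w w
| word_eq_sym w1 w2 : word_eq w1 w2 -> word_eq w2 w1
| word_eq_trans w1 w2 w3 : word_eq w1 w2 -> word_eq w2 w3 -> word_eq w1 w3
| word_eq_cat w1 w2 w3 w4 :
    word_eq w1 w2 -> word_eq w3 w4 -> word_eq (w1 ++ w3) (w2 ++ w4).

Definition word_eqb (w1 w2 : word) := `[< word_eq w1 w2 >].

Lemma word_eqb_refl : reflexive word_eqb.
Proof. by move=> w; apply/asboolP; apply: word_eq_refl. Qed.

Lemma word_eqb_sym : ssrbool.symmetric word_eqb.
Proof. by move=> w1 w2; apply/asboolP/asboolP; apply: word_eq_sym. Qed.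

Lemma word_eqb_trans : transitive word_eqb.
Proof.
move=> w2 w1 w3 /asboolP w12 /asboolP w23; apply/asboolP.
exact: word_eq_trans w23.
Qed.

Canonical word_equiv :=
  EquivRel word_eqb word_eqb_refl word_eqb_sym word_eqb_trans.

Definition pgroup := {eq_quot word_equiv}.
HB.instance Definition _ : EqQuotient _ word_equiv pgroup :=
  EqQuotient.on pgroup.
HB.instance Definition _ := Choice.on pgroup.

Definition pgroup_of (w : word) : pgroup := \pi w.
Definition pgroup_gen (x : X) : pgroup := pgroup_of [:: (x, false)].

Lemma pgroup_eqP w1 w2 : pgroup_of w1 = pgroup_of w2 <-> word_eq w1 w2.
Proof. by split=> [/eqmodP/asboolP //|w12]; apply/eqmodP/asboolP. Qed.

Lemma pgroup_ofK (g : pgroup) : pgroup_of (repr g) = g.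
Proof. exact: reprK. Qed.

Lemma pgroupW (P : pgroup -> Prop) : (forall w, P (pgroup_of w)) -> forall g, P g.
Proof. by move=> Pw g; rewrite -(pgroup_ofK g). Qed.

Lemma inv_letterK : involutive inv_letter.
Proof. by case=> x b; rewrite /inv_letter /= negbK. Qed.

Lemma word_eq_invr w : word_eq (w ++ inv_word w) [::].
Proof.
elim: w => [|a w IHw]; first exact: word_eq_refl.
rewrite /inv_word /= rev_cons -rcons_cat -cats1 -cat_cons -(cat1s a).
apply: word_eq_trans (word_eq_inv a).
rewrite -[[:: a; _]]/([:: a] ++ [:: _]); apply: word_eq_cat (word_eq_refl _).
by rewrite -[X in word_eq _ X]cats0; apply: word_eq_cat IHw; apply: word_eq_refl.
Qed.

Lemma inv_wordK : involutive inv_word.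
Proof. by move=> w; rewrite /inv_word map_rev revK mapK //; apply: inv_letterK. Qed.

Lemma word_eq_invl w : word_eq (inv_word w ++ w) [::].
Proof. by rewrite -{2}[w]inv_wordK; apply: word_eq_invr. Qed.

Lemma word_eq_inv_word w1 w2 :
  word_eq w1 w2 -> word_eq (inv_word w1) (inv_word w2).
Proof.
move=> w12; apply: (@word_eq_trans _ (inv_word w1 ++ (w2 ++ inv_word w2))).
  rewrite -[X in word_eq X _]cats0.
  apply: word_eq_cat (word_eq_refl _) _.
  exact/word_eq_sym/word_eq_invr.
rewrite catA -[X in word_eq _ X]cat0s; apply: word_eq_cat (word_eq_refl _).
apply: word_eq_trans (word_eq_invl w1).
exact: word_eq_cat (word_eq_refl _) (word_eq_sym w12).
Qed.

Definition pgroup_mul (g h : pgroup) := pgroup_of (repr g ++ repr h).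
Definition pgroup_inv (g : pgroup) := pgroup_of (inv_word (repr g)).

Lemma repr_word_eq w : word_eq (repr (pgroup_of w)) w.
Proof. by apply/pgroup_eqP; rewrite pgroup_ofK. Qed.

Lemma pgroup_mulE w1 w2 :
  pgroup_mul (pgroup_of w1) (pgroup_of w2) = pgroup_of (w1 ++ w2).
Proof. by apply/pgroup_eqP/word_eq_cat; apply: repr_word_eq. Qed.

Lemma pgroup_invE w : pgroup_inv (pgroup_of w) = pgroup_of (inv_word w).
Proof. exact/pgroup_eqP/word_eq_inv_word/repr_word_eq. Qed.

Lemma pgroup_mulA : associative pgroup_mul.
Proof.
elim/pgroupW=> w1; elim/pgroupW=> w2; elim/pgroupW=> w3.
by rewrite !pgroup_mulE catA.
Qed.

Lemma pgroup_mul1g : left_id (pgroup_of [::]) pgroup_mul.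
Proof. by elim/pgroupW=> w; rewrite pgroup_mulE. Qed.

Lemma pgroup_mulg1 : right_id (pgroup_of [::]) pgroup_mul.
Proof. by elim/pgroupW=> w; rewrite pgroup_mulE cats0. Qed.

Lemma pgroup_mulVg : left_inverse (pgroup_of [::]) pgroup_inv pgroup_mul.
Proof.
elim/pgroupW=> w; rewrite pgroup_invE pgroup_mulE.
exact/pgroup_eqP/word_eq_invl.
Qed.

Lemma pgroup_mulgV : right_inverse (pgroup_of [::]) pgroup_inv pgroup_mul.
Proof.
elim/pgroupW=> w; rewrite pgroup_invE pgroup_mulE.
exact/pgroup_eqP/word_eq_invr.
Qed.

HB.instance Definition _ := isGroup.Build pgroup
  pgroup_mulA pgroup_mul1g pgroup_mulg1 pgroup_mulVg pgroup_mulgV.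

Lemma pgroup_ofM w1 w2 :
  (pgroup_of (w1 ++ w2) = pgroup_of w1 * pgroup_of w2)%g.
Proof. by rewrite -pgroup_mulE. Qed.

Lemma pgroup_ofV w : (pgroup_of (inv_word w) = (pgroup_of w)^-1)%g.
Proof. by rewrite -pgroup_invE. Qed.

(* The multiplicative extension to the presented group of a map f from letters
   to a monoid; it is well defined under the two hypotheses below. *)
Section Lift.
Variables (M : Type) (idx : M) (op : Monoid.law idx) (f : X * bool -> M).

Definition pgroup_lift (g : pgroup) : M := \big[op/idx]_(a <- repr g) f a.

Hypothesis f_rel : forall lr, lr \in rels ->
  \big[op/idx]_(a <- lr.1) f a = \big[op/idx]_(a <- lr.2) f a.
Hypothesis f_inv : forall a, op (f a) (f (inv_letter a)) = idx.

Lemma word_eq_lift w1 w2 : word_eq w1 w2 ->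
  \big[op/idx]_(a <- w1) f a = \big[op/idx]_(a <- w2) f a.
Proof.
elim=> [lr /f_rel //|a|w|w3 w4 _ ->|w3 w4 w5 _ -> _ ->|w3 w4 w5 w6 _ E1 _ E2] //.
  by rewrite !big_cons big_nil Monoid.mulm1 f_inv.
by rewrite !big_cat E1 E2.
Qed.

Lemma pgroup_liftE w : pgroup_lift (pgroup_of w) = \big[op/idx]_(a <- w) f a.
Proof. exact: word_eq_lift (repr_word_eq w). Qed.

Lemma pgroup_liftM g h :
  pgroup_lift (g * h)%g = op (pgroup_lift g) (pgroup_lift h).
Proof.
elim/pgroupW: g => w1; elim/pgroupW: h => w2.
by rewrite -pgroup_ofM !pgroup_liftE big_cat.
Qed.

Lemma pgroup_lift1 : pgroup_lift 1%g = idx.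
Proof. by rewrite -[1%g]/(pgroup_of [::]) pgroup_liftE big_nil. Qed.

Lemma pgroup_lift_gen x : pgroup_lift (pgroup_gen x) = f (x, false).
Proof. by rewrite pgroup_liftE big_cons big_nil Monoid.mulm1. Qed.

End Lift.
End PresentedGroup.

End GroupPresentation.
Export GroupPresentation.

(* Imported only here: its {mpoly _[_]} notations would shadow those of mpoly. *)
Import monalg.

Module AlgebraPresentation.

Lemma malg_scaleAr (K : monomType) (R : comNzRingType) a (f g : {malg R[K]}) :
  a *: (f * g) = f * (a *: g).
Proof.
have scaleU c k : a *: mkmalgU k c = mkmalgU k (a * c) :> {malg R[K]}.
  by apply/malgP=> w; rewrite mcoeffZ !mcoeffU mulrnAr.
rewrite (malgMEw (finmap.fsubset_refl _) (msuppZ_le a g)) malgME scaler_sumr.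
apply: eq_bigr => v _; rewrite scaler_sumr; apply: eq_bigr => w _.
by rewrite scaleU mcoeffZ mulrCA.
Qed.

Section FreeAlgebra.
Variables (R : comNzRingType) (X : choiceType).

Definition free_alg := {malg R[{fmonom X}]}.
HB.instance Definition _ := GRing.Lalgebra.on free_alg.

Definition free_gen (x : X) : free_alg := mkmalgU (fmu x) 1.

Variable chi : X -> R.
Definition char_word (w : {fmonom X}) : R := \prod_(x <- fmonom_val w) chi x.

Lemma char_word_morph : mmorphism char_word.
Proof.
split=> [v w|]; first by rewrite /char_word fmM big_cat.
by rewrite /char_word fm1 big_nil.
Qed.

HB.instance Definition _ := monalg.isMultiplicative.Build
  {fmonom X} R char_word char_word_morph.

Definition free_char (f : free_alg) : R := monalg.mmap idfun char_word f.

Lemma free_char_is_monoid_morphism : monoid_morphism free_char.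
Proof.
have := @commr_mmap_is_multiplicative _ R R idfun char_word.
by case=> [g m m'|fM f1]; [exact: mulrC | split].
Qed.
HB.instance Definition _ :=
  GRing.isZmodMorphism.Build free_alg R free_char
    (@monalg.mmap_is_additive _ R R idfun char_word).
HB.instance Definition _ :=
  GRing.isMonoidMorphism.Build free_alg R free_char
    free_char_is_monoid_morphism.

Lemma free_char_gen x : free_char (free_gen x) = chi x.
Proof.
by rewrite /free_char monalg.mmapU /= /char_word fmU big_seq1 mul1r.
Qed.

Lemma free_charA a : free_char a%:A = a.
Proof. by rewrite /free_char monalg.mmapZ -/(free_char 1) rmorph1 mulr1. Qed.

End FreeAlgebra.

(* Algebra presentations: arels is the list of elements that are set to 0.
   The remaining fields, a one-dimensional representation, are only there to
   ensure that the presented algebra is not the zero ring. *)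
Record alg_presentation (R : comNzRingType) (X : choiceType) :=
  AlgPresentation {
    arels : seq (free_alg R X);
    achar : X -> R;
    achar_rels : forall f, f \in arels -> free_char achar f = 0
  }.

Section PresentedAlgebra.
Variables (R : comNzRingType) (X : choiceType) (P : alg_presentation R X).
Local Notation free_alg := (free_alg R X).

Inductive palg_ideal : free_alg -> Prop :=
| palg_ideal_rel f : f \in arels P -> palg_ideal f
| palg_ideal0 : palg_ideal 0
| palg_idealD f g : palg_ideal f -> palg_ideal g -> palg_ideal (f + g)
| palg_idealMl a f : palg_ideal f -> palg_ideal (a * f)
| palg_idealMr a f : palg_ideal f -> palg_ideal (f * a).

Lemma palg_idealN f : palg_ideal f -> palg_ideal (- f).
Proof. by rewrite -mulN1r; apply: palg_idealMl. Qed.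

Lemma palg_idealB f g : palg_ideal f -> palg_ideal g -> palg_ideal (f - g).
Proof. by move=> If Ig; apply: palg_idealD => //; apply: palg_idealN. Qed.

Definition palg_eqb (f g : free_alg) := `[< palg_ideal (f - g) >].

Lemma palg_eqb_refl : reflexive palg_eqb.
Proof. by move=> f; apply/asboolP; rewrite subrr; apply: palg_ideal0. Qed.

Lemma palg_eqb_sym : ssrbool.symmetric palg_eqb.
Proof.
by move=> f g; apply/asboolP/asboolP => /palg_idealN; rewrite opprB.
Qed.

Lemma palg_eqb_trans : transitive palg_eqb.
Proof.
move=> g f h /asboolP Ifg /asboolP Igh; apply/asboolP.
by rewrite -(subrKA g); apply: palg_idealD.
Qed.

Canonical palg_equiv :=
  EquivRel palg_eqb palg_eqb_refl palg_eqb_sym palg_eqb_trans.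

Definition palg := {eq_quot palg_equiv}.
HB.instance Definition _ : EqQuotient _ palg_equiv palg :=
  EqQuotient.on palg.
HB.instance Definition _ := Choice.on palg.

Definition palg_of (f : free_alg) : palg := \pi f.

Lemma palg_eqP f g : palg_of f = palg_of g <-> palg_ideal (f - g).
Proof. by split=> [/eqmodP/asboolP //|fg]; apply/eqmodP/asboolP. Qed.

Lemma palg_ofK (h : palg) : palg_of (repr h) = h.
Proof. exact: reprK. Qed.

Lemma palgW (Q : palg -> Prop) : (forall f, Q (palg_of f)) -> forall h, Q h.
Proof. by move=> Qf h; rewrite -(palg_ofK h). Qed.

Lemma repr_hecke_of f : palg_ideal (repr (palg_of f) - f).
Proof. by apply/palg_eqP; rewrite palg_ofK. Qed.

Definition palg_add (g h : palg) := palg_of (repr g + repr h).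
Definition palg_opp (h : palg) := palg_of (- repr h).
Definition palg_mul (g h : palg) := palg_of (repr g * repr h).
Definition palg_scale (a : R) (h : palg) := palg_of (a *: repr h).

Lemma palg_addE f g : palg_add (palg_of f) (palg_of g) = palg_of (f + g).
Proof.
apply/palg_eqP; rewrite opprD addrACA.
by apply: palg_idealD; apply: repr_hecke_of.
Qed.

Lemma palg_oppE f : palg_opp (palg_of f) = palg_of (- f).
Proof.
apply/palg_eqP; rewrite -opprD.
exact/palg_idealN/repr_hecke_of.
Qed.

Lemma palg_mulE f g : palg_mul (palg_of f) (palg_of g) = palg_of (f * g).
Proof.
apply/palg_eqP; set f' := repr _; set g' := repr _.
have -> : f' * g' - f * g = (f' - f) * g' + f * (g' - g).
  by rewrite mulrBl mulrBr subrKA.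
apply: palg_idealD.
  exact/palg_idealMr/repr_hecke_of.
exact/palg_idealMl/repr_hecke_of.
Qed.

Lemma palg_scaleE a f : palg_scale a (palg_of f) = palg_of (a *: f).
Proof.
apply/palg_eqP; rewrite -scalerBr -[X in _ *: X]mul1r scalerAl.
exact/palg_idealMl/repr_hecke_of.
Qed.

Lemma palg_addA : associative palg_add.
Proof.
by elim/palgW=> f; elim/palgW=> g; elim/palgW=> h; rewrite !palg_addE addrA.
Qed.

Lemma palg_addC : commutative palg_add.
Proof. by elim/palgW=> f; elim/palgW=> g; rewrite !palg_addE addrC. Qed.

Lemma palg_add0 : left_id (palg_of 0) palg_add.
Proof. by elim/palgW=> f; rewrite palg_addE add0r. Qed.

Lemma palg_addN : left_inverse (palg_of 0) palg_opp palg_add.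
Proof. by elim/palgW=> f; rewrite palg_oppE palg_addE addNr. Qed.

HB.instance Definition _ :=
  GRing.isZmodule.Build palg palg_addA palg_addC palg_add0 palg_addN.

Lemma palg_mulA : associative palg_mul.
Proof.
by elim/palgW=> f; elim/palgW=> g; elim/palgW=> h; rewrite !palg_mulE mulrA.
Qed.

Lemma palg_mul1h : left_id (palg_of 1) palg_mul.
Proof. by elim/palgW=> f; rewrite palg_mulE mul1r. Qed.

Lemma palg_mulh1 : right_id (palg_of 1) palg_mul.
Proof. by elim/palgW=> f; rewrite palg_mulE mulr1. Qed.

Lemma palg_mulDl : left_distributive palg_mul +%R.
Proof.
elim/palgW=> f; elim/palgW=> g; elim/palgW=> h.
by rewrite -[_ + _]/(palg_add _ _) -[RHS]/(palg_add _ _)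
  !(palg_addE, palg_mulE) mulrDl.
Qed.

Lemma palg_mulDr : right_distributive palg_mul +%R.
Proof.
elim/palgW=> f; elim/palgW=> g; elim/palgW=> h.
by rewrite -[_ + _]/(palg_add _ _) -[RHS]/(palg_add _ _)
  !(palg_addE, palg_mulE) mulrDr.
Qed.

Lemma free_char_ideal f : palg_ideal f -> free_char (achar P) f = 0.
Proof.
elim=> {f} [f /achar_rels //||f g _ f0 _ g0|a f _ f0|a f _ f0].
- exact: rmorph0.
- by rewrite rmorphD /= f0 g0 addr0.
- by rewrite rmorphM /= f0 mulr0.
- by rewrite rmorphM /= f0 mul0r.
Qed.

Lemma palg_one_neq0 : palg_of 1 != 0.
Proof.
apply/eqP => /palg_eqP; rewrite subr0 => /free_char_ideal/eqP.
by rewrite rmorph1 oner_eq0.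
Qed.

HB.instance Definition _ := GRing.Zmodule_isNzRing.Build palg palg_mulA
  palg_mul1h palg_mulh1 palg_mulDl palg_mulDr palg_one_neq0.

Lemma palg_ofD f g : palg_of (f + g) = palg_of f + palg_of g.
Proof. by rewrite -palg_addE. Qed.
Lemma palg_ofN f : palg_of (- f) = - palg_of f.
Proof. by rewrite -palg_oppE. Qed.
Lemma palg_ofM f g : palg_of (f * g) = palg_of f * palg_of g.
Proof. by rewrite -palg_mulE. Qed.
Lemma palg_of1 : palg_of 1 = 1. Proof. by []. Qed.
Lemma palg_of0 : palg_of 0 = 0. Proof. by []. Qed.

Lemma palg_scaleA a b h :
  palg_scale a (palg_scale b h) = palg_scale (a * b) h.
Proof. by elim/palgW: h => f; rewrite !palg_scaleE scalerA. Qed.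

Lemma palg_scale1 : left_id 1 palg_scale.
Proof. by elim/palgW=> f; rewrite palg_scaleE scale1r. Qed.

Lemma palg_scaleDr : right_distributive palg_scale +%R.
Proof.
move=> a; elim/palgW=> f; elim/palgW=> g.
by rewrite -palg_ofD !palg_scaleE scalerDr palg_ofD.
Qed.

Lemma palg_scaleDl h : {morph palg_scale^~ h : a b / a + b}.
Proof.
by move=> a b; elim/palgW: h => f; rewrite !palg_scaleE scalerDl palg_ofD.
Qed.

HB.instance Definition _ := GRing.Zmodule_isLmodule.Build R palg
  palg_scaleA palg_scale1 palg_scaleDr palg_scaleDl.

Lemma palg_ofZ a f : palg_of (a *: f) = a *: palg_of f.
Proof. by rewrite -palg_scaleE. Qed.

Lemma palg_scaleAl a (g h : palg) : a *: (g * h) = (a *: g) * h.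
Proof.
elim/palgW: g => f; elim/palgW: h => g.
by rewrite -palg_ofM -!palg_ofZ -palg_ofM scalerAl.
Qed.

HB.instance Definition _ :=
  GRing.Lmodule_isLalgebra.Build R palg palg_scaleAl.

Lemma palg_scaleAr a (g h : palg) : a *: (g * h) = g * (a *: h).
Proof.
elim/palgW: g => f; elim/palgW: h => g.
by rewrite -palg_ofM -!palg_ofZ -palg_ofM malg_scaleAr.
Qed.

HB.instance Definition _ :=
  GRing.Lalgebra_isAlgebra.Build R palg palg_scaleAr.

Lemma palg_ofA a : palg_of a%:A = a%:A.
Proof. exact: palg_ofZ. Qed.

Definition palg_gen (x : X) : palg := palg_of (free_gen R x).

Lemma palg_of_prod (w : seq X) :
  palg_of (\prod_(x <- w) free_gen R x) = \prod_(x <- w) palg_gen x.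
Proof. exact: (big_morph _ palg_ofM palg_of1). Qed.

Lemma palg_of_rel f : f \in arels P -> palg_of f = 0.
Proof.
move=> f_in; rewrite -palg_of0; apply/palg_eqP; rewrite subr0.
exact: palg_ideal_rel.
Qed.

Definition palg_invertible (x y : palg) := (y * x == 1) && (x * y == 1).
Definition palg_unit : {pred palg} :=
  fun x => `[< exists y, palg_invertible x y >].
Definition palg_inv (x : palg) : palg :=
  if pselect (exists y, palg_invertible x y) is left ex then xchoose ex else x.

Lemma palg_invP x : x \in palg_unit -> palg_invertible x (palg_inv x).
Proof.
by move=> /asboolP xU; rewrite /palg_inv; case: pselect => // ex; apply: xchooseP.
Qed.

Lemma palg_mulVx : {in palg_unit, left_inverse 1 palg_inv *%R}.
Proof. by move=> x /palg_invP/andP[/eqP]. Qed.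

Lemma palg_mulxV : {in palg_unit, right_inverse 1 palg_inv *%R}.
Proof. by move=> x /palg_invP/andP[_ /eqP]. Qed.

Lemma palg_unitP x y : y * x = 1 /\ x * y = 1 -> palg_unit x.
Proof.
by case=> yx xy; apply/asboolP; exists y; rewrite /palg_invertible yx xy eqxx.
Qed.

Lemma palg_inv_out : {in [predC palg_unit], palg_inv =1 id}.
Proof.
move=> x /asboolP xN; rewrite /palg_inv; case: pselect => // ex.
Qed.

HB.instance Definition _ := GRing.NzRing_hasMulInverse.Build palg
  palg_mulVx palg_mulxV palg_unitP palg_inv_out.

End PresentedAlgebra.

End AlgebraPresentation.
Export AlgebraPresentation.

(* Generators in the same class share their indeterminates; the degree of the
   polynomial relation of a generator is a function of its class.  zord is the
   order of the centre of the reflection group.  The last two fields ensure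
   that there is a one-dimensional representation, whence that the Hecke
   algebra is not the zero ring. *)
Record hecke_datum := HeckeDatum {
  gen : finType;
  par : finType;
  cls : gen -> par;
  deg : par -> nat;
  braid : seq (seq gen * seq gen);
  zword : seq gen;
  zord : nat;
  basis_words : seq (seq (gen * bool));
  deg_gt0 : forall c, (0 < deg c)%N;
  braid_cls : all (fun lr => perm_eq (map cls lr.1) (map cls lr.2)) braid
}.

Definition positive (X : Type) (w : seq X) : seq (X * bool) :=
  [seq (x, false) | x <- w].

Definition braid_rels (D : hecke_datum) :=
  [seq (positive lr.1, positive lr.2) | lr <- braid D].

Definition braid_group (D : hecke_datum) := pgroup (braid_rels D).
HB.instance Definition _ D := Group.on (braid_group D).

Definition gdeg (D : hecke_datum) (x : gen D) := deg (cls x).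

Definition refl_group (D : hecke_datum) :=
  pgroup (braid_rels D ++
    [seq (positive (nseq (gdeg x) x), [::]) | x <- enum (gen D)]).
HB.instance Definition _ D := Group.on (refl_group D).

Definition to_refl (D : hecke_datum) : braid_group D -> refl_group D :=
  fun b => pgroup_of _ (repr b).

Lemma to_refl_of D w : to_refl (pgroup_of (braid_rels D) w) = pgroup_of _ w.
Proof.
have mono v1 v2 : word_eq (braid_rels D) v1 v2 ->
    pgroup_of _ v1 = pgroup_of _ v2 :> refl_group D.
  elim=> [lr lr_in|a|v|v3 v4 _ ->|v3 v4 v5 _ -> _ ->|v3 v4 v5 v6 _ E1 _ E2] //.
  - by apply/pgroup_eqP/word_eq_rel; rewrite mem_cat lr_in.
  - exact/pgroup_eqP/word_eq_inv.
  - by rewrite !pgroup_ofM E1 E2.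
exact: mono (repr_word_eq _ w).
Qed.

Definition indet (D : hecke_datum) : finType := {c : par D & 'I_(deg c)}.
Definition hring (D : hecke_datum) : idomainType := laurent (indet D).

(* The indeterminate u_{x,j}, with 0 <= j < e_x. *)
Definition uvar (D : hecke_datum) (x : gen D) (j : 'I_(gdeg x)) : hring D :=
  lX (Tagged (fun c => 'I_(deg c)) j).

Lemma prod_root_unit (R : comUnitRingType) (A : unitAlgType R) (s : A) r :
    (forall c, c \in r -> c \is a GRing.unit) ->
  \prod_(c <- r) (s - c%:A) = 0 -> s \is a GRing.unit.
Proof.
move=> rU s0.
have [q [a [aU cq E]]] : exists q a,
    [/\ a \is a GRing.unit, s * q = q * s
      & \prod_(c <- r) (s - c%:A) = s * q + a%:A].
  elim: r rU {s0} => [|c r IHr] rU.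
    by exists 0, 1; rewrite big_nil !mulr0 mul0r add0r scale1r unitr1.
  have [|q [a [aU cq E]]] := IHr.
    by move=> d d_r; apply: rU; rewrite inE d_r orbT.
  exists (s * q + a%:A - c *: q), (- (c * a)).
  split; first by rewrite unitrN unitrM aU rU ?mem_head.
    rewrite !(mulrDr, mulrDl) mulrN mulNr -!scalerAr -!scalerAl mulr1 mul1r.
    by rewrite -mulrA -cq.
  rewrite big_cons E mulrBl mulr_algl scalerDr scalerA.
  by rewrite mulrBr -scalerAr scaleNr opprD addrA.
have qE : s * q = - a%:A by apply/eqP; rewrite -addr_eq0 -E s0.
have aq : - (a^-1 *: q) * s = 1.
  by rewrite mulNr -scalerAl -cq qE scalerN opprK scalerA mulVr ?scale1r.
apply/unitrP; exists (- (a^-1 *: q)); split=> //.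
by rewrite mulrN -scalerAr cq scalerAl -mulNr.
Qed.

Section Hecke.
Variable D : hecke_datum.
Local Notation R := (hring D).
Local Notation fgen := (free_gen R).

Definition hecke_rels : seq (free_alg R (gen D)) :=
  [seq \prod_(x <- lr.1) fgen x - \prod_(x <- lr.2) fgen x | lr <- braid D] ++
  [seq \prod_(j < gdeg x) (fgen x - (uvar j)%:A) | x <- enum (gen D)].

Definition hecke_char (x : gen D) : R := uvar (Ordinal (deg_gt0 (cls x))).

Lemma hecke_char_word (w : seq (gen D)) :
  free_char hecke_char (\prod_(x <- w) fgen x)
  = \prod_(c <- map (@cls D) w)
      lX (Tagged (fun c => 'I_(deg c)) (Ordinal (deg_gt0 c))).
Proof.
by rewrite rmorph_prod big_map; apply: eq_bigr => x _; apply: free_char_gen.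
Qed.

Lemma hecke_char_rels f : f \in hecke_rels -> free_char hecke_char f = 0.
Proof.
rewrite mem_cat => /orP[/mapP[lr lr_in ->]|/mapP[x _ ->]].
  rewrite rmorphB /= !hecke_char_word (perm_big (map (@cls D) lr.2)) ?subrr //.
  exact: (allP (braid_cls D)).
rewrite rmorph_prod (bigD1 (Ordinal (deg_gt0 (cls x)))) //.
set y := (X in X * _ = _); suff -> : y = 0 by rewrite mul0r.
rewrite /y rmorphB; apply/eqP; rewrite subr_eq0; apply/eqP.
exact: etrans (free_char_gen _ _) (esym (free_charA _ _)).
Qed.

Definition hecke_presentation := AlgPresentation hecke_char_rels.
Definition hecke : unitAlgType R := palg hecke_presentation.

Definition hgen (x : gen D) : hecke := palg_gen hecke_presentation x.

Lemma hgen_braid lr : lr \in braid D ->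
  \prod_(x <- lr.1) hgen x = \prod_(x <- lr.2) hgen x.
Proof.
move=> lr_in; rewrite -!palg_of_prod; apply/eqP.
rewrite -subr_eq0 -palg_ofN -palg_ofD palg_of_rel //.
by rewrite mem_cat; apply/orP; left; apply: map_f.
Qed.

Lemma hgen_poly x : \prod_(j < gdeg x) (hgen x - (uvar j)%:A) = 0.
Proof.
rewrite -(@palg_of_rel _ _ hecke_presentation
            (\prod_(j < gdeg x) (fgen x - (uvar j)%:A))); last first.
  by rewrite mem_cat; apply/orP; right; apply: map_f; rewrite mem_enum.
rewrite (big_morph _ (@palg_ofM _ _ _) (palg_of1 _)); apply: eq_bigr => j _.
by rewrite palg_ofD palg_ofN palg_ofA.
Qed.

Lemma hgen_unit x : hgen x \is a GRing.unit.
Proof.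
apply: (@prod_root_unit _ _ _ [seq uvar j | j <- index_enum 'I_(gdeg x)]).
  by move=> _ /mapP[j _ ->]; apply: lX_unit.
by rewrite big_map hgen_poly.
Qed.

Definition T_letter (a : gen D * bool) : hecke :=
  if a.2 then (hgen a.1)^-1 else hgen a.1.

Definition T : braid_group D -> hecke := pgroup_lift *%R T_letter.

Lemma T_rel lr : lr \in braid_rels D ->
  \prod_(a <- lr.1) T_letter a = \prod_(a <- lr.2) T_letter a.
Proof. by move=> /mapP[uv uv_in ->]; rewrite /= !big_map; apply: hgen_braid. Qed.

Lemma T_inv_letter a : T_letter a * T_letter (inv_letter a) = 1.
Proof. by case: a => x [] /=; rewrite /T_letter /= ?mulVr ?mulrV ?hgen_unit. Qed.

Lemma T_of w : T (pgroup_of _ w) = \prod_(a <- w) T_letter a.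
Proof. exact: (pgroup_liftE T_rel T_inv_letter). Qed.

Lemma T_gen x : T (pgroup_gen _ x) = hgen x.
Proof. exact: (pgroup_lift_gen T_rel T_inv_letter). Qed.

Lemma T_mul b c : T (b * c)%g = T b * T c.
Proof. exact: (pgroup_liftM T_rel T_inv_letter). Qed.

Lemma T_one : T 1%g = 1.
Proof. exact: (pgroup_lift1 T_rel T_inv_letter). Qed.

Definition hecke_basis : seq hecke :=
  [seq T (pgroup_of _ w) | w <- basis_words D].

End Hecke.

Import Num.Theory.

(* exp(2 i pi / e): for e > 1, e.-root (-1) is by definition the e-th root of
   -1 of least argument, that is exp(i pi / e). *)
Definition zeta (e : nat) : algC := e.-root (-1) ^+ 2.

Lemma zeta_unit e : (0 < e)%N -> zeta e \is a GRing.unit.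
Proof.
move=> e_gt0; rewrite unitfE expf_eq0 /= rootC_eq0 //.
by rewrite oppr_eq0 oner_eq0.
Qed.

Section Trace.
Variable D : hecke_datum.

Definition spec_val (i : indet D) : algC := zeta (deg (tag i)) ^+ tagged i.

Lemma spec_val_unit i : spec_val i \is a GRing.unit.
Proof. by rewrite rpredX // zeta_unit // deg_gt0. Qed.

Definition specialise : hring D -> algC := leval spec_val.

HB.instance Definition _ := GRing.isZmodMorphism.Build (hring D) algC specialise
  (leval_is_zmod_morphism spec_val_unit).
HB.instance Definition _ := GRing.isMonoidMorphism.Build (hring D) algC specialise
  (leval_is_monoid_morphism spec_val_unit).

Lemma specialise_uvar x j : specialise (@uvar D x j) = zeta (gdeg x) ^+ j.
Proof. exact: (leval_lX spec_val_unit). Qed.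

End Trace.

Definition is_basis (R : comUnitRingType) (H : algType R) (b : seq H) : Prop :=
  (forall h : H, exists c : 'rV[R]_(size b), h = \sum_i c 0 i *: b`_i) /\
  (forall c : 'rV[R]_(size b), \sum_i c 0 i *: b`_i = 0 -> c = 0).

Definition gram (R : comUnitRingType) (H : algType R) (tau : {scalar H})
    (b : seq H) : 'M[R]_(size b) :=
  \matrix_(i, j) tau (b`_i * b`_j).

Definition symmetrising (R : comUnitRingType) (H : algType R)
    (tau : {scalar H}) : Prop :=
  exists b : seq H,
    [/\ is_basis b, (gram tau b)^T = gram tau b
      & \det (gram tau b) \is a GRing.unit].

Definition braid_pi (D : hecke_datum) : braid_group D :=
  (pgroup_of (braid_rels D) (positive (zword D)) ^+ zord D)%g.

(* The quotient in the last condition is taken in the fraction field. *)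
Definition canonical_trace (D : hecke_datum) (tau : {scalar hecke D}) : Prop :=
  [/\ symmetrising tau,
      forall beta : braid_group D,
        specialise (tau (T beta)) = (to_refl beta == 1%g)%:R
    & forall beta : braid_group D,
        lval (lstar (tau (T beta^-1%g))) =
        lval (tau (T (beta * braid_pi D)%g)) / lval (tau (T (braid_pi D)))].

Definition wpow (X : Type) (w : seq X) (k : nat) : seq X := flatten (nseq k w).

Section TwoGenerators.
Definition gs2 : 'I_2 := @Ordinal 2 0 isT.
Definition gt2 : 'I_2 := @Ordinal 2 1 isT.
Local Notation s := gs2.
Local Notation t := gt2.
Local Notation ws := [:: (s, false)].
Local Notation wt := [:: (t, false)].
Local Notation wt' := [:: (t, true)].

Definition z48 : seq 'I_2 := [:: s; t; s; t; s; t].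
Local Notation wz48 := (positive z48).

Definition G4_basis : seq (seq ('I_2 * bool)) :=
  [:: [::]; ws; wpow ws 2; wz48; wz48 ++ ws; wz48 ++ wpow ws 2] ++
  [seq wpow ws i ++ w | i <- iota 0 3,
     w <- [seq wpow wt j ++ wpow ws k | j <- iota 1 2, k <- iota 0 3]].

Definition G4 : hecke_datum := @HeckeDatum 'I_2 'I_1 (fun=> ord0) (fun=> 3)
  [:: ([:: s; t; s], [:: t; s; t])] z48 2 G4_basis (fun=> isT) isT.

Definition z5 : seq 'I_2 := [:: s; t; s; t].

Definition G5_basis : seq (seq ('I_2 * bool)) :=
  [seq wpow (positive z5) k ++ x | k <- iota 0 6, x <-
    [:: [::]; ws; wpow ws 2; wt; wpow wt 2; ws ++ wt; wpow ws 2 ++ wt;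
        ws ++ wpow wt 2; wpow ws 2 ++ wpow wt 2;
        wt' ++ ws; wt' ++ ws ++ wt; wt' ++ ws ++ wpow wt 2]].

Definition G5 : hecke_datum := @HeckeDatum 'I_2 'I_2 id (fun=> 3)
  [:: ([:: s; t; s; t], [:: t; s; t; s])] z5 6 G5_basis (fun=> isT) isT.

Definition z6 : seq 'I_2 := [:: s; t; s; t; s; t].

Definition G6_basis : seq (seq ('I_2 * bool)) :=
  [seq wpow (positive z6) k ++ x | k <- iota 0 4, x <-
    [:: [::]; wt; wpow wt 2; ws; ws ++ wt; ws ++ wpow wt 2; wt ++ ws;
        wpow wt 2 ++ ws; wt ++ ws ++ wt; wt ++ ws ++ wpow wt 2;
        wpow wt 2 ++ ws ++ wt; wpow wt 2 ++ ws ++ wpow wt 2]].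

Definition G6_deg (c : 'I_2) : nat := nth 0%N [:: 2; 3] c.
Lemma G6_deg_gt0 c : (0 < G6_deg c)%N.
Proof. by case: c => [[|[|]]]. Qed.

Definition G6 : hecke_datum := @HeckeDatum 'I_2 'I_2 id G6_deg
  [:: ([:: s; t; s; t; s; t], [:: t; s; t; s; t; s])] z6 4 G6_basis
  G6_deg_gt0 isT.

Definition G8_basis : seq (seq ('I_2 * bool)) :=
  [seq wpow wz48 k ++ x | k <- iota 0 4, x <-
    [seq wpow ws i | i <- iota 0 4] ++
    [seq wpow ws i ++ wt ++ wpow ws j | i <- iota 0 4, j <- iota 0 4] ++
    [seq wpow ws i ++ wpow wt 2 | i <- iota 0 4]].

Definition G8 : hecke_datum := @HeckeDatum 'I_2 'I_1 (fun=> ord0) (fun=> 4)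
  [:: ([:: s; t; s], [:: t; s; t])] z48 4 G8_basis (fun=> isT) isT.

End TwoGenerators.

Section ThreeGenerators.
Definition gs3 : 'I_3 := @Ordinal 3 0 isT.
Definition gt3 : 'I_3 := @Ordinal 3 1 isT.
Definition gu3 : 'I_3 := @Ordinal 3 2 isT.
Local Notation s := gs3.
Local Notation t := gt3.
Local Notation u := gu3.
Local Notation wt := [:: (t, false)].
Local Notation wu := [:: (u, false)].
Local Notation wu' := [:: (u, true)].

Definition z7 : seq 'I_3 := [:: s; t; u].

Definition G7_basis_tilde : seq (seq ('I_3 * bool)) :=
  [seq wpow (positive z7) k ++ x | k <- iota 0 12, x <-
    [:: [::]; wu; wpow wu 2; wt; wpow wt 2; wu ++ wt; wpow wu 2 ++ wt;
        wu ++ wpow wt 2; wpow wu 2 ++ wpow wt 2;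
        wt ++ wu'; wt ++ wu' ++ wt; wt ++ wu' ++ wpow wt 2]].

Definition G7_basis : seq (seq ('I_3 * bool)) :=
  [seq w <- G7_basis_tilde
     | w \notin [:: wt ++ wu'; wt ++ wu' ++ wt; wt ++ wu' ++ wpow wt 2]] ++
  [:: wt ++ wpow wu 2; wt ++ wpow wu 2 ++ wt; wt ++ wpow wu 2 ++ wpow wt 2].

Definition G7_deg (c : 'I_3) : nat := nth 0%N [:: 2; 3; 3] c.
Lemma G7_deg_gt0 c : (0 < G7_deg c)%N.
Proof. by case: c => [[|[|[|]]]]. Qed.

Definition G7 : hecke_datum := @HeckeDatum 'I_3 'I_3 id G7_deg
  [:: ([:: s; t; u], [:: t; u; s]); ([:: t; u; s], [:: u; s; t])] z7 12
  G7_basis G7_deg_gt0 isT.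

End ThreeGenerators.

(* Only meant for 4 <= n <= 8. *)
Definition hecke_data (n : nat) : hecke_datum :=
  match n with 4 => G4 | 5 => G5 | 6 => G6 | 7 => G7 | _ => G8 end.

Lemma basis_words_uniq : all (fun n => uniq (basis_words (hecke_data n)))
  [:: 4; 5; 6; 7; 8].
Proof. by vm_compute. Qed.

Lemma size_basis_words : [seq size (basis_words (hecke_data n))
  | n <- [:: 4; 5; 6; 7; 8]] = [:: 24; 72; 48; 144; 96].
Proof. by vm_compute. Qed.

(* Main.v *)
(** Over the Laurent polynomials in the coefficients of the polynomial relations
   and in the central element z, the algebra is spanned by few words w, and the
   braid and polynomial relations, applied to these words, give the action of
   the generators on them together with finitely many linear relations between
   the z^k w.  Those relations and the values tau(b) = delta_{1b} determine
   tau on every z^k w that matters.  What has to be checked on these values is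
   finite:
   - tau(g x) = tau(x g) for g a generator and x = z^k w;
   - after a suitable ordering, the matrix of the tau((z^a v)^-1 z^b w) is
     triangular with units on the diagonal, so that the Gram determinant of the
     basis is a unit;
   - tau(b^-1 pi) = 0 for b <> 1 in the basis.  As T_beta |-> T_(beta^-1)
     extends to a *-semilinear anti-automorphism, this gives condition (2) for
     all beta.
   For condition (1), T_beta |-> delta_{g, image of beta} extends to a
   semilinear form on the Hecke algebra for each g in the reflection group;
   for g = 1 it agrees with the specialisation of tau on the basis, because
   explicit permutations show that the elements of the basis other than 1 have
   nontrivial images. *)

From HB Require Import structures.
From mathcomp Require Import all_boot all_order all_algebra all_field.
From mathcomp Require Import boolp.
From mathcomp Require Import monalg.
Require Import Defs.
Set Implicit Arguments.
Unset Strict Implicit.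
Unset Printing Implicit Defensive.
Import Order.TTheory GRing.Theory Num.Theory.
Local Open Scope ring_scope.

(** * Polynomial arithmetic on coefficient lists *)

(** Soundness asks only that every recorded identity be true, never that the computation be complete
    or confluent: a product not yet known is carried as a formal symbol, an equation that cannot be
    solved records nothing, and a value still unknown makes a final check fail. Linear independence
    comes solely from the given basis.

    Two choices keep the computation small. Coefficients are polynomials in the elementary symmetric
    functions of the indeterminates, because the polynomial relations involve nothing else; the last
    of these functions in each class is a product of indeterminates, hence a unit. Except for G_4, z
    is kept as an exponent, which divides the number of words by the order of the centre. The price
    is that the z^k w with k in Z are dependent over the coefficients, so values of tau away from
    the basis have to be recovered from linear relations. They are recovered one at a time, through
    pivots that are signed unit monomials, so that no other division ever occurs. *)

Section Merge.
Variables (K V : Type) (cmp : K -> K -> comparison) (add : V -> V -> V).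
Variable (null : V -> bool).

(** The inner fixpoint recurses on the second list, as a comparison consumes a head of either list
    or of both. Cancelled terms are dropped through [null], so that vanishing can be tested by
    comparison with the empty list. *)
Fixpoint merge_sum (s : seq (K * V)) : seq (K * V) -> seq (K * V) :=
  if s isn't (k, v) :: s' then id else
  fix merge_aux t := if t isn't (l, w) :: t' then s else
    match cmp k l with
    | Lt => (k, v) :: merge_sum s' t
    | Gt => (l, w) :: merge_aux t'
    | Eq => let x := add v w in
            if null x then merge_sum s' t' else (k, x) :: merge_sum s' t'
    end.

Variables (A : zmodType) (ev : K -> V -> A).
Hypothesis cmp_eq : forall k l, cmp k l = Eq -> k = l.
Hypothesis ev_add : forall k v w, ev k (add v w) = ev k v + ev k w.
Hypothesis ev_null : forall k v, null v -> ev k v = 0.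

(** Sorting only makes like keys meet; each step of the merge preserves the total value whatever the
    order of the lists. *)
Lemma merge_sumE s t : \sum_(x <- merge_sum s t) ev x.1 x.2 =
  \sum_(x <- s) ev x.1 x.2 + \sum_(x <- t) ev x.1 x.2.
Proof.
elim: s t => [|[k v] s IHs] t; first by rewrite big_nil add0r.
elim: t => [|[l w] t IHt]; first by rewrite big_nil addr0.
rewrite [merge_sum _ _]/=; case Ekl: (cmp k l).
- rewrite -(cmp_eq Ekl); case: ifP => [nvw|_]; rewrite ?big_cons IHs /=.
    by rewrite addrACA -ev_add ev_null ?add0r.
  by rewrite ev_add addrACA.
- by rewrite !big_cons IHs big_cons addrA.
- by rewrite big_cons IHt !big_cons /= addrCA.
Qed.

End Merge.

Fixpoint cmp_seq (T : Type) (cmp : T -> T -> comparison) (s t : seq T) :=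
  match s, t with
  | [::], [::] => Eq
  | [::], _ => Lt
  | _, [::] => Gt
  | x :: s', y :: t' => if cmp x y is Eq then cmp_seq cmp s' t' else cmp x y
  end.

Lemma cmp_seq_eq T (cmp : T -> T -> comparison) :
    (forall x y, cmp x y = Eq -> x = y) ->
  forall s t, cmp_seq cmp s t = Eq -> s = t.
Proof.
move=> cmpE; elim=> [|x s IHs] [|y t] //=.
by case E: (cmp x y) => // /IHs ->; rewrite (cmpE _ _ E).
Qed.

Definition cmp_int (m n : int) : comparison :=
  match m, n with
  | Posz a, Posz b => Nat.compare a b
  | Posz _, Negz _ => Gt
  | Negz _, Posz _ => Lt
  | Negz a, Negz b => Nat.compare b a
  end.

Lemma cmp_nat_eq m n : Nat.compare m n = Eq -> m = n.
Proof. by elim: m n => [|m IHm] [|n] //= /IHm ->. Qed.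

Lemma cmp_int_eq m n : cmp_int m n = Eq -> m = n.
Proof. by case: m n => m [] n //= /cmp_nat_eq ->. Qed.

(* Laurent monomials: natural exponents for the parameters that need not be
   invertible, integer exponents for the invertible ones. *)
Definition mono : Type := (seq nat * seq int)%type.
Definition poly_cert := seq (mono * int).

(* Indices of vectors: [B i] stands for the i-th spanning word, and [Y g i] for
   the still unknown product of the letter g with the element of index i. *)
Inductive idx := B of nat | Y of nat & idx.
Definition vec := seq ((int * idx) * poly_cert).

Definition cmp_mono (m n : mono) : comparison :=
  if cmp_seq Nat.compare m.1 n.1 is Eq then cmp_seq cmp_int m.2 n.2
  else cmp_seq Nat.compare m.1 n.1.

Lemma cmp_mono_eq m n : cmp_mono m n = Eq -> m = n.
Proof.
case: m n => a b [c d]; rewrite /cmp_mono /=.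
case E: (cmp_seq _ a c) => // E'.
by rewrite (cmp_seq_eq cmp_nat_eq E) (cmp_seq_eq cmp_int_eq E').
Qed.

Fixpoint cmp_idx (i j : idx) : comparison :=
  match i, j with
  | B a, B b => Nat.compare a b
  | B _, Y _ _ => Lt
  | Y _ _, B _ => Gt
  | Y g i', Y h j' => if Nat.compare g h is Eq then cmp_idx i' j'
                      else Nat.compare g h
  end.

Lemma cmp_idx_eq i j : cmp_idx i j = Eq -> i = j.
Proof.
elim: i j => [a|g i IHi] [b|h j] //= => [/cmp_nat_eq -> //|].
by case E: (Nat.compare g h) => // /IHi ->; rewrite (cmp_nat_eq E).
Qed.

Definition cmp_key (x y : int * idx) : comparison :=
  if cmp_idx x.2 y.2 is Eq then cmp_int x.1 y.1 else cmp_idx x.2 y.2.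

Lemma cmp_key_eq x y : cmp_key x y = Eq -> x = y.
Proof.
case: x y => k i [l j]; rewrite /cmp_key /=.
by case E: (cmp_idx i j) => // /cmp_int_eq ->; rewrite (cmp_idx_eq E).
Qed.

Definition is_eq (c : comparison) := if c is Eq then true else false.

Fixpoint add_seq (T : Type) (add : T -> T -> T) (s t : seq T) :=
  match s, t with
  | [::], _ => t
  | _, [::] => s
  | x :: s', y :: t' => add x y :: add_seq add s' t'
  end.

Definition mono_mul (m n : mono) : mono :=
  (add_seq Nat.add m.1 n.1, add_seq intZmod.addz m.2 n.2).
(** An inverse only under [mono_unit], when the natural exponents, kept here, are all 0. *)
Definition mono_inv (m : mono) : mono := (m.1, map intZmod.oppz m.2).
Definition mono_unit (m : mono) : bool := all (Nat.eqb 0) m.1.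
Definition int_null (c : int) := if c is Posz 0 then true else false.

Definition poly_add := merge_sum cmp_mono intZmod.addz int_null.
Definition poly_scale (m : mono) (c : int) (p : poly_cert) : poly_cert :=
  [seq (mono_mul m x.1, intRing.mulz c x.2) | x <- p].
Definition poly_mul (p q : poly_cert) : poly_cert :=
  if q is [::] then [::] else
  foldr (fun x => poly_add (poly_scale x.1 x.2 q)) [::] p.

Definition vec_add :=
  merge_sum cmp_key poly_add (fun p => if p is [::] then true else false).
Definition vec_scale (k : int) (p : poly_cert) (v : vec) : vec :=
  [seq ((intZmod.addz k x.1.1, x.1.2), poly_mul p x.2) | x <- v].

(** * Values of monomials, polynomials and vectors *)

Section Semantics.
Variables (R : comUnitRingType) (H : unitAlgType R).
Variables (ns us : seq R) (z : H) (L : nat -> H) (X : nat -> H).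
Hypothesis usU : {in us, forall u, u \is a GRing.unit}.
Hypothesis zU : z \is a GRing.unit.
Hypothesis zC : forall h, z * h = h * z.

Fixpoint idx_val (i : idx) : H :=
  match i with B a => X a | Y g j => L g * idx_val j end.

(** As [zip] truncates, a missing exponent counts as 0 and an exponent beyond the parameters is
    ignored; this makes the value multiplicative for exponent lists of any length. *)
Definition nexp_val (a : seq nat) : R := \prod_(x <- zip ns a) x.1 ^+ x.2.
Definition uexp_val (b : seq int) : R := \prod_(x <- zip us b) x.1 ^ x.2.
Definition mono_val (m : mono) : R := nexp_val m.1 * uexp_val m.2.
Definition poly_val (p : poly_cert) : R :=
  \sum_(x <- p) x.2%:~R * mono_val x.1.
Definition vec_val (v : vec) : H :=
  \sum_(x <- v) poly_val x.2 *: (z ^ x.1.1 * idx_val x.1.2).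

Lemma nexp_valD a b :
  nexp_val (add_seq Nat.add a b) = nexp_val a * nexp_val b.
Proof.
rewrite /nexp_val; elim: ns a b => [|c s IHs] [|i a] [|j b] //=;
  rewrite ?big_nil ?mul1r ?mulr1 //.
 rewrite !big_cons IHs /= -[Nat.add _ _]/(i + j)%N.
by rewrite exprD mulrACA.
Qed.

Lemma uexp_valD a b :
  uexp_val (add_seq intZmod.addz a b) = uexp_val a * uexp_val b.
Proof.
rewrite /uexp_val; elim: us usU a b => [|c s IHs] sU [|i a] [|j b] //=;
  rewrite ?big_nil ?mul1r ?mulr1 // !big_cons IHs /=; last first.
  by move=> x xs; apply: sU; rewrite inE xs orbT.
by rewrite -[intZmod.addz i j]/(i + j) exprzDr ?sU ?mem_head // mulrACA.
Qed.

Lemma mono_valM m n : mono_val (mono_mul m n) = mono_val m * mono_val n.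
Proof. by rewrite /mono_val nexp_valD uexp_valD mulrACA. Qed.

Lemma uexp_prod_unit (s : seq R) (a : seq int) :
    {in s, forall u, u \is a GRing.unit} ->
  \prod_(x <- zip s a) x.1 ^ x.2 \is a GRing.unit.
Proof.
elim: s a => [|c s IHs] [|i a] /= sU; rewrite ?big_nil ?unitr1 // big_cons.
rewrite unitrM; apply/andP; split; first by rewrite unitrXz // sU ?mem_head.
by apply: IHs => x xs; apply: sU; rewrite inE xs orbT.
Qed.

Lemma uexp_val_unit a : uexp_val a \is a GRing.unit.
Proof. exact: uexp_prod_unit. Qed.

Lemma mono_val_unit m : mono_unit m -> mono_val m \is a GRing.unit.
Proof.
move=> m0; rewrite unitrM uexp_val_unit andbT.
have -> : nexp_val m.1 = 1; last exact: unitr1.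
move: m0; rewrite /mono_unit /nexp_val.
elim: ns m.1 => [|c s IHs] [|i a] /=; rewrite ?big_nil //.
by case: i => //= /IHs; rewrite big_cons expr0 mul1r.
Qed.

Lemma mono_valV m : mono_unit m -> mono_val (mono_inv m) = (mono_val m)^-1.
Proof.
move=> m0; rewrite /mono_val invrM ?uexp_val_unit //; last first.
  by have := mono_val_unit m0; rewrite unitrM => /andP[].
have -> : nexp_val m.1 = 1.
  move: m0; rewrite /mono_unit /nexp_val.
  elim: ns m.1 => [|c s IHs] [|i a] /=; rewrite ?big_nil //.
  by case: i => //= /IHs; rewrite big_cons expr0 mul1r.
rewrite invr1 mul1r mulr1 /uexp_val /=.
elim: us usU m.2 => [|c s IHs] sU [|i a] /=; rewrite ?big_nil ?invr1 //.
have sU' : {in s, forall u, u \is a GRing.unit}.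
  by move=> x xs; apply: sU; rewrite inE xs orbT.
have cU : c \is a GRing.unit by rewrite sU ?mem_head.
rewrite !big_cons IHs //= invrM ?unitrXz ?uexp_prod_unit //.
by rewrite mulrC -[intZmod.oppz i]/(- i) -invr_expz.
Qed.

Lemma poly_valD p q : poly_val (poly_add p q) = poly_val p + poly_val q.
Proof.
apply: (merge_sumE (ev := fun m c => c%:~R * mono_val m)).
- exact: cmp_mono_eq.
- by move=> m c d; rewrite -mulrDl -intrD.
- by move=> m [[|n]|n] // _; rewrite mul0r.
Qed.

Lemma poly_val_scale m c p :
  poly_val (poly_scale m c p) = c%:~R * mono_val m * poly_val p.
Proof.
rewrite /poly_val big_map mulr_sumr; apply: eq_bigr => x _.
by rewrite mono_valM -[intRing.mulz _ _]/(c * x.2) intrM mulrACA.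
Qed.

Lemma poly_valM p q : poly_val (poly_mul p q) = poly_val p * poly_val q.
Proof.
rewrite /poly_mul; case Eq: q => [|a q']; first by rewrite /poly_val big_nil mulr0.
rewrite -Eq; elim: p => [|x p IHp]; first by rewrite /poly_val big_nil mul0r.
by rewrite /= poly_valD IHp poly_val_scale /poly_val big_cons mulrDl.
Qed.

Lemma poly_val0 : poly_val [::] = 0. Proof. exact: big_nil. Qed.

Lemma vec_val0 : vec_val [::] = 0. Proof. exact: big_nil. Qed.

Lemma vec_valD v w : vec_val (vec_add v w) = vec_val v + vec_val w.
Proof.
apply: (merge_sumE (ev := fun x p => poly_val p *: (z ^ x.1 * idx_val x.2))).
- exact: cmp_key_eq.
- by move=> x p q; rewrite poly_valD scalerDl.
- by move=> x [] // _; rewrite poly_val0 scale0r.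
Qed.

Lemma vec_val_scale k p v :
  vec_val (vec_scale k p v) = poly_val p *: (z ^ k * vec_val v).
Proof.
rewrite /vec_val big_map mulr_sumr scaler_sumr; apply: eq_bigr => x _ /=.
rewrite poly_valM -[intZmod.addz _ _]/(k + x.1.1) exprzDr //.
by rewrite -scalerAr scalerA mulrA.
Qed.

End Semantics.

(** * Certificates *)

(* Letters are coded by naturals, 2 a for the a-th generator and 2 a + 1 for
   its inverse. *)
Definition flip (g : nat) : nat := if odd g then g.-1 else g.+1.
Definition inv_code (w : seq nat) := rev (map flip w).

(** A term [((k, m, c), w)] stands for c m z^k w, and the relator asserts that the sum of its terms
    is 0. In a table, row g and column n hold the product of the letter g with the n-th spanning
    word, once it is known. *)
Definition relator := seq ((int * mono * int) * seq nat).
Definition table := seq (seq (option vec)).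

(** The sources of equations: [Def i] states that the letters of the i-th spanning word multiply to
    that word, and [Rel r y] is the relator [r] times the spanning word [y] on its right. *)
Inductive instance := Def of nat | Rel of nat & nat.

(* A row is a linear relation, that is, a vector of value 0.  Its command lists
   a relator, the element it is applied to, a word by which the result is
   multiplied, the previous rows used to clear it, and the key of its pivot. *)
Record row_cmd := RowCmd {
  row_word : seq nat; row_rel : nat; row_elt : nat;
  row_clear : seq (nat * int); row_piv : int * nat }.

(* [TauBasis l] solves for one value using the combination l of the basis, and
   [TauRow q e] using z^e times the q-th row. *)
Inductive tau_cmd :=
  | TauBasis of seq (mono * int * nat)
  | TauRow of nat & int.

Definition basis_trace (one : mono) (j : nat) := TauBasis [:: (one, Posz 1, j)].

(* [spanning] lists the words w, the first one being empty.  A deduction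
   [(i, (g, n))] computes the product of the letter g with the n-th of them from
   the instance i of a definition or relator.  An entry [(k, w)] of [basis] or
   the pair [pi_exp], [pi_word] stands for z^k w.  [dual] and 0 <= k < [window]
   index the z^k w of the triangular matrix, ordered by k, then by
   [dual_rank]. *)
Record certificate := Certificate {
  spanning : seq (seq nat);
  relators : seq relator;
  deductions : seq (instance * (nat * nat));
  row_cmds : seq row_cmd;
  basis : seq (int * seq nat);
  tau_cmds : seq tau_cmd;
  gens : seq nat;
  window : nat;
  pi_exp : int;
  pi_word : seq nat;
  dual : seq (seq nat);
  dual_rank : seq nat }.

Section Run.
Variables (one : mono) (C : certificate).

(** In the certificates [one] has all exponents 0, one for each parameter. The padding matters:
    exponent lists of different lengths compare as different monomials and would not be merged. *)
Definition vone (i : idx) : vec := [:: ((Posz 0, i), [:: (one, Posz 1)])].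

Definition look (tab : table) g i : vec :=
  match i with
  | B n => if nth None (nth [::] tab g) n is Some v then v else vone (Y g i)
  | Y _ _ => vone (Y g i)
  end.

Definition act tab g (v : vec) : vec :=
  foldr (fun x => vec_add (vec_scale x.1.1 x.2 (look tab g x.1.2))) [::] v.
Definition act_word tab w v : vec := foldr (act tab) v w.

Definition apply_rel tab (r : relator) y : vec :=
  foldr (fun t => vec_add (vec_scale t.1.1.1 [:: (t.1.1.2, t.1.2)]
                             (act_word tab t.2 (vone (B y))))) [::] r.

Definition word_of i := nth [::] (spanning C) i.

Definition instance_vec tab (ins : instance) : vec :=
  match ins with
  | Def i => vec_add (act_word tab (word_of i) (vone (B 0)))
               (vec_scale (Posz 0) [:: (one, Negz 0)] (vone (B i)))
  | Rel r y => apply_rel tab (nth [::] (relators C) r) y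
  end.

Definition sign_int (c : int) :=
  match c with Posz 1 | Negz 0 => true | _ => false end.

(** A pivot is accepted only if it is the single entry selected by [p] and its coefficient is a sign
    times a unit monomial, which can be inverted inside the representation. The returned vector
    solves v = 0 for the element of index [key.2]; when v has another value, [solveP] keeps track of
    the difference. *)
Definition solve (p : int * idx -> bool) (v : vec) : option ((int * idx) * (mono * int) * vec) :=
  match filter (fun x => p x.1) v with
  | [:: (key, [:: (m, c)])] =>
      if mono_unit m && sign_int c then
        Some (key, (m, c), vec_scale (intZmod.oppz key.1)
                     [:: (mono_inv m, intZmod.oppz c)]
                     (filter (fun x => ~~ p x.1) v))
      else None
  | _ => None
  end.

Definition set_entry (tab : table) g i v :=
  set_nth [::] tab g (set_nth None (nth [::] tab g) i (Some v)).

(** An equation that cannot be solved leaves the table as it is, so a defective certificate can make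
    a check fail but cannot create a false entry. *)
Definition deduce (tab : table) (c : instance * (nat * nat)) : table :=
  let: (ins, (g, i)) := c in
  if solve (fun x => is_eq (cmp_idx x.2 (Y g (B i)))) (instance_vec tab ins)
    is Some (_, v) then set_entry tab g i v else tab.

Definition final_table : table := foldl deduce [::] (deductions C).

Definition coef (v : vec) (k : int) (n : nat) : poly_cert :=
  if filter (fun x => is_eq (cmp_key x.1 (k, B n))) v is x :: _ then x.2
  else [::].

(** After multiplication by z^(c.2) the pivot of the chosen row sits at exponent [k + c.2], with a
    coefficient meant to be 1; subtracting the right multiple cancels that entry of [v]. *)
Definition clear (rows : seq ((int * nat) * vec)) (v : vec) (c : nat * int) :=
  let: ((k, n), u) := nth ((Posz 0, 0%N), [::]) rows c.1 in
  vec_add v (vec_scale c.2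
    (poly_scale one (Negz 0) (coef v (intZmod.addz k c.2) n)) u).

(** For a coefficient c m with c a sign and m a unit, the factor c m^-1 turns the pivot into 1. For
    any other coefficient the row remains a relation, since multiples of a vector of value 0 have
    value 0. *)
Definition normalise (v : vec) (k : int) (n : nat) : vec :=
  if coef v k n is [:: (m, c)] then vec_scale (Posz 0) [:: (mono_inv m, c)] v
  else v.

Definition add_row tab rows (c : row_cmd) : seq ((int * nat) * vec) :=
  let: (k, n) := row_piv c in
  let v := act_word tab (row_word c)
             (apply_rel tab (nth [::] (relators C) (row_rel c)) (row_elt c)) in
  rcons rows ((k, n), normalise (foldl (clear rows) v (row_clear c)) k n).

Definition final_rows tab := foldl (add_row tab) [::] (row_cmds C).

Definition tau_table := seq (int * seq (option poly_cert)).

Definition tau_level (tt : tau_table) (k : int) :=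
  if filter (fun x => is_eq (cmp_int x.1 k)) tt is x :: _ then x.2 else [::].
Definition tau_look (tt : tau_table) (k : int) (i : idx) :=
  if i is B n then nth None (tau_level tt k) n else None.
Definition tau_set (tt : tau_table) (k : int) (n : nat) p : tau_table :=
  (k, set_nth None (tau_level tt k) n (Some p)) ::
  filter (fun x => ~~ is_eq (cmp_int x.1 k)) tt.

(** The result is [None] as soon as one value is missing, so that an unknown value is never read as
    0. *)
Fixpoint tau_eval (tt : tau_table) (s : int) (v : vec) : option poly_cert :=
  if v is ((k, i), p) :: v' then
    if tau_look tt (intZmod.addz s k) i is Some q then
      if tau_eval tt s v' is Some r then Some (poly_add (poly_mul p q) r)
      else None
    else None
  else Some [::].

Definition unknown tt (x : int * idx) :=
  if tau_look tt x.1 x.2 is Some _ then false else true.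

Definition tau_solve (tt : tau_table) (v : vec) (b : poly_cert) : tau_table :=
  if solve (unknown tt) v is Some ((k, B n), (m, c), w) then
    if tau_eval tt k w is Some q then
      tau_set tt k n (poly_add (poly_scale (mono_inv m) c b) q)
    else tt
  else tt.

Definition basis_at j := nth (Posz 0, [::]) (basis C) j.

Definition basis_vec tab j : vec :=
  vec_scale (basis_at j).1 [:: (one, Posz 1)]
    (act_word tab (basis_at j).2 (vone (B 0))).

(** The right-hand side collects the coefficients of the basis element 1, the only one with nonzero
    trace. Indices are bounded because an index out of range would read as the default entry [(0,
    [::])], which stands for 1 and has trace 1. *)
Definition tau_step tab (rows : seq ((int * nat) * vec)) tt (c : tau_cmd) :=
  match c with
  | TauBasis l =>
      if all (fun t => t.2 < size (basis C))%N l then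
        tau_solve tt
          (foldr (fun t => vec_add (vec_scale (Posz 0) [:: t.1] (basis_vec tab t.2)))
                 [::] l)
          (foldr (fun t => poly_add (if t.2 is 0 then [:: t.1] else [::])) [::] l)
      else tt
  | TauRow q e =>
      tau_solve tt (vec_scale e [:: (one, Posz 1)]
                      (nth ((Posz 0, 0%N), [::]) rows q).2) [::]
  end.

Definition final_tau tab rows := foldl (tau_step tab rows) [::] (tau_cmds C).

Definition word_vec tab w := act_word tab w (vone (B 0)).

Definition vanishes tt k v := if tau_eval tt k v is Some [::] then true else false.

Definition check_trace tab tt :=
  all (fun w => all (fun g =>
    let d := vec_add (word_vec tab (g :: w))
       (vec_scale (Posz 0) [:: (one, Negz 0)] (word_vec tab (rcons w g))) in
    all (fun k => vanishes tt (Posz k) d) (iota 0 (window C))) (gens C))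
  (spanning C).

Definition in_window (k : int) :=
  if k is Posz n then (n < window C)%N else false.

(** This ties the basis to the z^k w on which [check_trace] makes its test: each basis element must
    be a combination of those with k in the window, with no unresolved product left. *)
Definition check_span tab :=
  all (fun b => all (fun x =>
    if x.1.2 is B n then (n < size (spanning C))%N &&
      in_window (intZmod.addz b.1 x.1.1) else false)
    (word_vec tab b.2)) (basis C).

Definition check_star tab tt :=
  all (fun b => vanishes tt (intZmod.addz (pi_exp C) (intZmod.oppz b.1))
                  (word_vec tab (inv_code b.2 ++ pi_word C)))
    (behead (basis C)).

Definition check_pi tab tt :=
  if tau_eval tt (pi_exp C) (word_vec tab (pi_word C)) is Some [:: (m, c)]
  then mono_unit m && sign_int c else false.

(** As z is central, the entry for z^a v and z^b w depends only on b - a, and the matrix is block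
    Toeplitz. Blocks with b > a must vanish, the diagonal block must be triangular for [dual_rank],
    and the blocks with b < a are arbitrary. Distinct words of equal rank are required to pair to 0
    in both orders. *)
Definition check_dual tab tt :=
  all (fun p => all (fun q =>
    let v := word_vec tab (inv_code (nth [::] (dual C) p) ++ nth [::] (dual C) q) in
    (if (nth 0%N (dual_rank C) p <= nth 0%N (dual_rank C) q)%N
     then (p == q) || vanishes tt (Posz 0) v else true) &&
    (if p == q then
       if tau_eval tt (Posz 0) v is Some [:: (m, c)] then mono_unit m && sign_int c
       else false else true) &&
    all (fun k => vanishes tt (Posz k) v) (iota 1 (window C).-1))
  (iota 0 (size (dual C)))) (iota 0 (size (dual C))).

Definition check_words :=
  if basis_at 0 is (Posz 0, [::]) then
    (if word_of 0 is [::] then true else false) && (0 < size (spanning C))%N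
  else false.

Definition check :=
  let tab := final_table in
  let rows := final_rows tab in
  let tt := final_tau tab rows in
  [&& check_words, check_span tab, check_trace tab tt, check_star tab tt,
      check_pi tab tt & check_dual tab tt].

End Run.

(** * Soundness of the certificates *)

Lemma is_eqE c : is_eq c -> c = Eq. Proof. by case: c. Qed.

Section Soundness.
Variables (R : comUnitRingType) (H : unitAlgType R).
Variables (ns us : seq R) (z : H) (L : nat -> H).
Hypothesis usU : {in us, forall u, u \is a GRing.unit}.
Hypothesis zU : z \is a GRing.unit.
Hypothesis zC : forall h, z * h = h * z.
Variables (one : mono) (C : certificate).
Hypothesis one1 : mono_val ns us one = 1.

Definition word_val (w : seq nat) : H := \prod_(g <- w) L g.
Definition rel_val (r : relator) : H :=
  \sum_(t <- r) (t.1.2%:~R * mono_val ns us t.1.1.2) *: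
                (z ^ t.1.1.1 * word_val t.2).

Hypothesis rels0 : {in relators C, forall r, rel_val r = 0}.

Definition span_val (i : nat) : H := word_val (word_of C i).

Local Notation pval := (poly_val ns us).
Local Notation vval := (vec_val ns us z L span_val).
Local Notation ival := (idx_val L span_val).

Lemma zkC k h : z ^ k * h = h * z ^ k.
Proof. by apply/esym/commrXz; rewrite /GRing.comm zC. Qed.

Lemma poly_val1 m c : pval [:: (m, c)] = c%:~R * mono_val ns us m.
Proof. by rewrite /poly_val big_seq1. Qed.

Lemma vval_cons x v :
  vval (x :: v) = pval x.2 *: (z ^ x.1.1 * ival x.1.2) + vval v.
Proof. by rewrite /vec_val big_cons. Qed.

Lemma vval_vone i : vval (vone one i) = ival i.
Proof.
by rewrite vval_cons vec_val0 addr0 /= poly_val1 one1 mulr1 scale1r expr0z mul1r.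
Qed.

Lemma vval_filter (p : int * idx -> bool) v :
  vval v = vval (filter (fun x => p x.1) v)
           + vval (filter (fun x => ~~ p x.1) v).
Proof.
elim: v => [|x v IHv]; first by rewrite /= vec_val0 addr0.
rewrite /= vval_cons IHv; case: (p x.1); rewrite /= vval_cons.
  by rewrite addrA.
by rewrite addrCA.
Qed.

Lemma filter_head (T : Type) (p : pred T) v x s : filter p v = x :: s -> p x.
Proof. by elim: v => //= y v IHv; case: ifP => // py [<-]. Qed.

(** Being 1 or -1, [c] is its own inverse, which is why [solve] multiplies by [c] where one expects
    a division. *)
Lemma sign_intE (c : int) : sign_int c -> c%:~R * c%:~R = 1 :> R.
Proof. by case: c => [[|[|n]]|[|n]] //= _; rewrite ?mulr1 // mulrNN mulr1. Qed.

Lemma solveP p v key m c w : solve p v = Some (key, (m, c), w) ->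
  [/\ p key, mono_unit m, sign_int c &
      vval v = (c%:~R * mono_val ns us m) *:
               (z ^ key.1 * (ival key.2 - vval w))].
Proof.
rewrite /solve; case E: (filter _ v) => [|[k [|[m' c'] [|??]]] [|??]] //.
case: ifP => // /andP[mU cS] [<- <- <- <-]; split=> //.
  exact: (filter_head E).
rewrite (vval_filter p v) E vval_cons vec_val0 addr0 /= poly_val1.
rewrite mulrBr scalerBr vec_val_scale // poly_val1 mono_valV //; congr (_ + _).
rewrite -scalerAr -[intZmod.oppz k.1]/(- k.1) -invr_expz mulVKr ?unitrXz //.
rewrite scalerA -[intZmod.oppz c']/(- c') intrN mulNr mulrN scaleNr opprK.
by rewrite mulrACA sign_intE // mulrV ?mono_val_unit // mulr1 scale1r.
Qed.

Definition table_ok (tab : table) := forall g n v,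
  nth None (nth [::] tab g) n = Some v -> vval v = L g * span_val n.

Section Table.
Variable tab : table.
Hypothesis tabP : table_ok tab.

Lemma look_val g i : vval (look one tab g i) = L g * ival i.
Proof.
case: i => [n|h j]; last by rewrite vval_vone.
by rewrite /look; case E: (nth _ _ _) => [v|]; rewrite ?(tabP E) ?vval_vone.
Qed.

Lemma act_val g v : vval (act one tab g v) = L g * vval v.
Proof.
elim: v => [|x v IHv]; first by rewrite /= vec_val0 mulr0.
rewrite /= vec_valD vval_cons vec_val_scale // look_val IHv mulrDr.
congr (_ + _); rewrite -scalerAr; congr (_ *: _).
by rewrite (mulrA (z ^ _)) zkC -mulrA.
Qed.

Lemma act_word_val w v : vval (act_word one tab w v) = word_val w * vval v.
Proof.
rewrite /word_val; elim: w => [|g w IHw]; first by rewrite big_nil mul1r.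
by rewrite /= act_val IHw big_cons mulrA.
Qed.

Lemma apply_rel_val r y :
  vval (apply_rel one tab r y) = rel_val r * span_val y.
Proof.
rewrite /rel_val; elim: r => [|t r IHr]; first by rewrite big_nil mul0r vec_val0.
rewrite /= vec_valD IHr big_cons mulrDl vec_val_scale // act_word_val vval_vone.
congr (_ + _); rewrite poly_val1 -scalerAl; congr (_ *: _); exact: mulrA.
Qed.

Lemma apply_relator_val r y :
  vval (apply_rel one tab (nth [::] (relators C) r) y) = 0.
Proof.
rewrite apply_rel_val; have [lt_r|ge_r] := ltnP r (size (relators C)).
  by rewrite (rels0 (mem_nth _ lt_r)) mul0r.
by rewrite nth_default // /rel_val big_nil mul0r.
Qed.

Hypothesis w0 : word_of C 0 = [::].

Lemma span_val0 : span_val 0 = 1.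
Proof. by rewrite /span_val w0 /word_val big_nil. Qed.

Lemma word_vec_val w : vval (word_vec one tab w) = word_val w.
Proof. by rewrite act_word_val vval_vone /= span_val0 mulr1. Qed.

Lemma vval_negscale v :
  vval (vec_scale (Posz 0) [:: (one, Negz 0)] v) = - vval v.
Proof.
by rewrite vec_val_scale // expr0z mul1r poly_val1 one1 mulr1 mulrN1z scaleN1r.
Qed.

Lemma instance_vec_val ins : vval (instance_vec one C tab ins) = 0.
Proof.
case: ins => [i|r y]; last exact: apply_relator_val.
by rewrite vec_valD -/(word_vec _ _ _) word_vec_val vval_negscale vval_vone subrr.
Qed.

Lemma deduce_ok c : table_ok (deduce one C tab c).
Proof.
case: c => ins [g i] /=; case E: (solve _ _) => [[[key [m c]] w]|] //.
have [/is_eqE/cmp_idx_eq keyE mU cS] := solveP E.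
(* The instance has value 0, so cancelling the pivot coefficient and then the power of z equates the
   product sought with the returned vector. *)
rewrite instance_vec_val keyE => /esym/(congr1 ( *:%R (c%:~R * mono_val ns us m)^-1)).
have cU : c%:~R * mono_val ns us m \is a GRing.unit.
  rewrite unitrM mono_val_unit // andbT; apply/unitrP; exists c%:~R.
  by rewrite sign_intE.
rewrite scaler0 scalerA mulVr // scale1r => /(congr1 ( *%R (z ^ key.1)^-1)).
rewrite mulr0 mulKr ?unitrXz // => /subr0_eq wE h n v.
rewrite /set_entry nth_set_nth /=; case: eqP => [->|_]; last exact: tabP.
rewrite nth_set_nth /=; case: eqP => [-> [<-] //|_]; exact: tabP.
Qed.

End Table.

Lemma table_ok0 : table_ok [::].
Proof. by move=> g n v; rewrite !nth_nil. Qed.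

Hypothesis w0 : word_of C 0 = [::].

Lemma final_table_ok : table_ok (final_table one C).
Proof.
rewrite /final_table; elim: (deductions C) [::] table_ok0 => //= c s IHs tab tabP.
exact/IHs/deduce_ok.
Qed.

Let tab := final_table one C.
Let tabP : table_ok tab := final_table_ok.

Definition rows_ok (rows : seq ((int * nat) * vec)) :=
  forall q, vval (nth ((Posz 0, 0%N), [::]) rows q).2 = 0.

Lemma clear_val rows v c : rows_ok rows -> vval v = 0 -> vval (clear one rows v c) = 0.
Proof.
move=> rowsP v0; rewrite /clear; have := rowsP c.1.
case: (nth _ rows c.1) => [[k n] u] /= u0.
by rewrite vec_valD // v0 vec_val_scale // u0 mulr0 scaler0 addr0.
Qed.

Lemma normalise_val v k n : vval v = 0 -> vval (normalise v k n) = 0.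
Proof.
rewrite /normalise; case: (coef v k n) => [|[m c] [|??]] // v0.
by rewrite vec_val_scale // v0 mulr0 scaler0.
Qed.

Lemma final_rows_ok : rows_ok (final_rows one C tab).
Proof.
rewrite /final_rows.
have : rows_ok [::] by move=> q; rewrite nth_nil vec_val0.
elim: (row_cmds C) [::] => //= c s IHs rows rowsP; apply: IHs.
rewrite /add_row; case: (row_piv c) => k n q; rewrite nth_rcons.
case: ltngtP => _ /=; [exact: rowsP | by rewrite vec_val0 |].
apply: normalise_val.
have : vval (act_word one tab (row_word c)
   (apply_rel one tab (nth [::] (relators C) (row_rel c)) (row_elt c))) = 0.
  by rewrite act_word_val // apply_relator_val // mulr0.
by elim: (row_clear c) (act_word _ _ _ _) => //= d ds IHds v v0; apply/IHds/clear_val.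
Qed.

Let rows := final_rows one C tab.

Variable tau : {scalar H}.
Definition basis_val j : H := z ^ (basis_at C j).1 * word_val (basis_at C j).2.
Hypothesis tau_basis : forall j, (j < size (basis C))%N ->
  tau (basis_val j) = (j == 0%N)%:R.

Definition tau_ok (tt : tau_table) := forall k i p,
  tau_look tt k i = Some p -> tau (z ^ k * ival i) = pval p.

Lemma tau_eval_val tt k v p : tau_ok tt -> tau_eval tt k v = Some p ->
  tau (z ^ k * vval v) = pval p.
Proof.
move=> ttP; elim: v p => [|[[l i] q] v IHv] p /=.
  by case=> <-; rewrite vec_val0 mulr0 linear0 poly_val0.
case E: (tau_look _ _ _) => [r|//]; case E': (tau_eval _ _ _) => [r'|//] [<-].
rewrite vval_cons mulrDr linearD /= (IHv _ E') poly_valD poly_valM //.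
rewrite -scalerAr linearZ /= mulrA -exprzDr //.
by rewrite -[k + l]/(intZmod.addz k l) (ttP _ _ _ E).
Qed.

Lemma tau_look_set tt k n p l i q : tau_look (tau_set tt k n p) l i = Some q ->
  (l = k /\ i = B n /\ q = p) \/ tau_look tt l i = Some q.
Proof.
case: i => //= j; rewrite /tau_level /=.
case E: (is_eq (cmp_int k l)) => /=.
  have -> : l = k by rewrite (cmp_int_eq (is_eqE E)).
  rewrite nth_set_nth /=; case: eqP => [->|_]; last by right.
  by case=> <-; left.
move=> tl; right; move: tl; congr (_ = _); congr (nth _ _ _).
have -> // : [seq x <- [seq x <- tt | ~~ is_eq (cmp_int x.1 k)] | is_eq (cmp_int x.1 l)]
  = [seq x <- tt | is_eq (cmp_int x.1 l)].
rewrite -filter_predI; apply: eq_filter => x /=.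
case F: (is_eq (cmp_int x.1 l)) => //=.
rewrite (cmp_int_eq (is_eqE F)); case G: (is_eq _) => //.
by move: (G) E; rewrite (cmp_int_eq (is_eqE G)) => ->.
Qed.

Lemma tau_solve_ok tt v b : tau_ok tt -> tau (vval v) = pval b ->
  tau_ok (tau_solve tt v b).
Proof.
move=> ttP vb; rewrite /tau_solve; case E: (solve _ _) => [[[[k [n|//]] [m c]] w]|//].
case E': (tau_eval _ _ _) => [q|//]; have [_ mU cS eqv] := solveP E.
move=> l i p /tau_look_set[[-> [-> ->]]|/ttP //].
move: vb; rewrite eqv linearZ /= mulrBr linearB /= (tau_eval_val ttP E') => vb.
rewrite poly_valD poly_val_scale // -vb mono_valV // mulrA.
by rewrite mulrACA sign_intE // mul1r mulVr ?mono_val_unit // mul1r subrK.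
Qed.

Lemma basis_vec_val j : vval (basis_vec one C tab j) = basis_val j.
Proof.
rewrite /basis_vec vec_val_scale // poly_val1 one1 mulr1 scale1r.
by rewrite -/(word_vec _ _ _) word_vec_val.
Qed.

Lemma final_tau_ok : tau_ok (final_tau one C tab rows).
Proof.
rewrite /final_tau; have : tau_ok [::] by move=> k [n|g i] p //=; rewrite nth_nil.
elim: (tau_cmds C) [::] => //= c s IHs tt ttP; apply: IHs.
case: c => [l|q e] /=; last first.
  apply: tau_solve_ok => //.
  by rewrite vec_val_scale // final_rows_ok mulr0 scaler0 linear0 poly_val0.
case: ifP => // /allP lC; apply: tau_solve_ok => //.
elim: l lC => [|[[m d] j] l IHl] lC; first by rewrite vec_val0 linear0 poly_val0.
have jC : (j < size (basis C))%N by apply: (lC (m, d, j)); rewrite mem_head.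
rewrite /= vec_valD // linearD poly_valD IHl => [|t tl]; last first.
  by apply: lC; rewrite inE tl orbT.
congr (_ + _); rewrite vec_val_scale // linearZ /= expr0z mul1r basis_vec_val.
by rewrite tau_basis //; case: j {jC lC} => [|j]; rewrite ?poly_val1 ?mulr1 ?mulr0 ?poly_val0.
Qed.

Let tt := final_tau one C tab rows.

Lemma tau_eval_word k w p : tau_eval tt k (word_vec one tab w) = Some p ->
  tau (z ^ k * word_val w) = pval p.
Proof. by move/(tau_eval_val final_tau_ok); rewrite word_vec_val. Qed.

Lemma vanishes_word k w : vanishes tt k (word_vec one tab w) ->
  tau (z ^ k * word_val w) = 0.
Proof.
rewrite /vanishes; case E: (tau_eval _ _ _) => [[|? ?]|] // _.
by rewrite (tau_eval_word E) poly_val0.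
Qed.

Lemma unit_word k w m c : tau_eval tt k (word_vec one tab w) = Some [:: (m, c)] ->
  mono_unit m -> sign_int c -> tau (z ^ k * word_val w) \is a GRing.unit.
Proof.
move=> /tau_eval_word -> mU cS; rewrite poly_val1 unitrM mono_val_unit // andbT.
by apply/unitrP; exists c%:~R; rewrite sign_intE.
Qed.

Hypothesis span_basis : forall h : H, exists c : nat -> R,
  h = \sum_(j < size (basis C)) c j *: basis_val j.

Lemma word_valM v w : word_val (v ++ w) = word_val v * word_val w.
Proof. exact: big_cat. Qed.

(** Both sides are linear in h, so h may be taken in the basis; [check_span] then rewrites it in
    terms of the z^k w for which the identity was computed. *)
Lemma trace_gens : check_span one C tab -> check_trace one C tab tt ->
  {in gens C, forall g h, tau (L g * h) = tau (h * L g)}.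
Proof.
move=> /allP spanC /allP traceC g gC.
have traceF k n : (k < window C)%N -> (n < size (spanning C))%N ->
    tau (L g * (z ^ Posz k * span_val n)) = tau (z ^ Posz k * span_val n * L g).
  move=> kC nC.
  have /traceC/allP/(_ g gC)/allP/(_ k) : word_of C n \in spanning C by rewrite mem_nth.
  rewrite mem_iota kC => /(_ isT); rewrite /vanishes.
  case E: (tau_eval _ _ _) => [[|? ?]|] // _; move: (tau_eval_val final_tau_ok E).
  rewrite poly_val0 vec_valD // vval_negscale !word_vec_val // mulrBr linearB /=.
  move/eqP; rewrite subr_eq0 => /eqP.
  rewrite /word_val big_cons -cats1 big_cat big_seq1 /= !mulrA.
  by rewrite -(zkC k (L g)).
have traceB j : (j < size (basis C))%N -> tau (L g * basis_val j) = tau (basis_val j * L g).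
  move=> jC; rewrite /basis_val -(word_vec_val tabP w0).
  have /spanC/= : basis_at C j \in basis C by rewrite mem_nth.
  elim: (word_vec _ _ _) => [_|[[k [n|//]] p] v IHv /= /andP[/andP[nC kC] vC]].
    by rewrite vec_val0 !(mulr0, mul0r).
  rewrite vval_cons !(mulrDr, mulrDl, linearD) /= IHv //; congr (_ + _).
  rewrite -!scalerAr -!scalerAl !linearZ /=; congr (_ * _).
  move: kC; rewrite (mulrA (z ^ _) (z ^ _)) -exprzDr // -[_ + k]/(intZmod.addz _ k).
  by case: intZmod.addz => // i iC; apply: traceF.
move=> h; have [c ->] := span_basis h; rewrite mulr_sumr mulr_suml !linear_sum.
by apply: eq_bigr => j _; rewrite -scalerAr -scalerAl !linearZ /= traceB.
Qed.

Lemma star_basis j : check_star one C tab tt -> (0 < j < size (basis C))%N ->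
  tau (z ^ (pi_exp C - (basis_at C j).1)
       * (word_val (inv_code (basis_at C j).2) * word_val (pi_word C))) = 0.
Proof.
move=> /allP starC /andP[j_gt0 jC]; rewrite -word_valM; apply: vanishes_word.
apply: (starC (basis_at C j)); rewrite -drop1 /basis_at -(prednK j_gt0) -add1n -nth_drop.
by rewrite mem_nth // size_drop ltn_subRL add1n prednK.
Qed.

Lemma pi_unit : check_pi one C tab tt ->
  tau (z ^ pi_exp C * word_val (pi_word C)) \is a GRing.unit.
Proof.
rewrite /check_pi; case E: (tau_eval _ _ _) => [[|[m c] [|??]]|] // /andP[].
exact: unit_word E.
Qed.

Definition dual_at p := nth [::] (dual C) p.
Definition dual_pair k p q :=
  tau (z ^ k * (word_val (inv_code (dual_at p)) * word_val (dual_at q))).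

Lemma dual_pairP : check_dual one C tab tt ->
  forall p q, (p < size (dual C))%N -> (q < size (dual C))%N ->
  [/\ dual_pair 0 p p \is a GRing.unit,
      p != q -> (nth 0%N (dual_rank C) p <= nth 0%N (dual_rank C) q)%N ->
        dual_pair 0 p q = 0
    & forall k : nat, (0 < k < window C)%N -> dual_pair k p q = 0].
Proof.
rewrite /dual_pair => /allP dualC p q pC qC.
have iotaE r : (r < size (dual C))%N -> r \in iota 0 (size (dual C)).
  by rewrite mem_iota.
have := allP (dualC p (iotaE p pC)) p (iotaE p pC).
have := allP (dualC p (iotaE p pC)) q (iotaE q qC).
cbv beta zeta => /andP[/andP[pq _] pk] /andP[/andP[_ pp] _].
split.
- move: pp; rewrite eqxx -word_valM.
  by case E: (tau_eval _ _ _) => [[|[m c] [|??]]|] // /andP[]; apply: unit_word E.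
- move=> neq_pq le_pq; rewrite -word_valM; apply: vanishes_word.
  by move: pq; rewrite le_pq (negPf neq_pq).
- move=> k /andP[k_gt0 kC]; rewrite -word_valM; apply: vanishes_word.
  apply: (allP pk); rewrite mem_iota k_gt0 /= add1n prednK //.
  by apply: leq_trans kC.
Qed.

End Soundness.

Lemma mono_val_one (R : comUnitRingType) (ns us : seq R) m :
  mono_unit m -> all (pred1 0) m.2 -> mono_val ns us m = 1.
Proof.
case: m => a b /=; rewrite /mono_unit /= => a0 b0.
rewrite /mono_val /nexp_val /uexp_val /=.
have -> : \prod_(x <- zip ns a) x.1 ^+ x.2 = 1.
  elim: a ns a0 => [|i a IHa] [|c s] //=; rewrite ?big_nil //.
  by case: i => //= /IHa a1; rewrite big_cons a1 mulr1.
rewrite mul1r; elim: b us b0 => [|i b IHb] [|c s] //=; rewrite ?big_nil //.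
by case/andP=> /eqP -> /IHb b1; rewrite big_cons b1 mulr1.
Qed.

(** * Relators of the polynomial and braid relations *)

Section Constructors.
Variable one : mono.

Definition word_rel v (k : int) w : relator :=
  [:: (Posz 0, one, Posz 1, v); (k, one, Negz 0, w)].
Definition inverse_rels g : seq relator :=
  [:: word_rel [:: g; flip g] (Posz 0) [::]; word_rel [:: flip g; g] (Posz 0) [::]].
(** Polynomial relations are divided by a power of the element, so that exponents range over -1..1,
    -1..2 and -2..2 in degrees 2, 3 and 4, and the words stay short. The quadratic one concerns an
    element z^k v rather than a letter, because in G_7 the generator of order 2 is not a letter of
    the certificate. *)
Definition quadratic_rel a1 a2 k v : relator :=
  [:: (k, one, Posz 1, v); (Posz 0, a1, Negz 0, [::]);
      (intZmod.oppz k, a2, Posz 1, inv_code v)].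
Definition cubic_rel a1 a2 a3 g : relator :=
  [:: (Posz 0, one, Posz 1, [:: g; g]); (Posz 0, a1, Negz 0, [:: g]);
      (Posz 0, a2, Posz 1, [::]); (Posz 0, a3, Negz 0, [:: flip g])].
Definition quartic_rel a1 a2 a3 a4 g : relator :=
  [:: (Posz 0, one, Posz 1, [:: g; g]); (Posz 0, a1, Negz 0, [:: g]);
      (Posz 0, a2, Posz 1, [::]); (Posz 0, a3, Negz 0, [:: flip g]);
      (Posz 0, a4, Posz 1, [:: flip g; flip g])].
End Constructors.

Section Letters.
Variables (R : comUnitRingType) (H : unitAlgType R) (gs : seq H).
Definition letter (g : nat) : H :=
  if odd g then (nth 1 gs g./2)^-1 else nth 1 gs g./2.
Hypothesis gsU : {in gs, forall x, x \is a GRing.unit}.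
Lemma letter_unit g : letter g \is a GRing.unit.
Proof.
have xU : nth 1 gs g./2 \is a GRing.unit.
  have [lt_g|ge_g] := ltnP g./2 (size gs); first exact/gsU/mem_nth.
  by rewrite nth_default ?unitr1.
by rewrite /letter; case: ifP; rewrite ?unitrV.
Qed.

Lemma letter_flip g : letter (flip g) = (letter g)^-1.
Proof.
rewrite /letter /flip; case: g => [|g] //=; case: (boolP (odd g)) => odd_g /=.
  by rewrite odd_g uphalf_half odd_g.
by rewrite (negPf odd_g) invrK uphalf_half (negPf odd_g).
Qed.

Lemma word_val_unit w : word_val letter w \is a GRing.unit.
Proof. by apply: rpred_prod => g _; apply: letter_unit. Qed.

Lemma word_val_inv w : word_val letter (inv_code w) = (word_val letter w)^-1.
Proof.
rewrite /word_val /inv_code; elim: w => [|g w IHw]; first by rewrite !big_nil invr1.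
rewrite /= rev_cons -cats1 big_cat big_seq1 IHw big_cons letter_flip.
by rewrite invrM ?letter_unit ?word_val_unit.
Qed.

End Letters.

Section Values.
Variables (R : comUnitRingType) (H : unitAlgType R).
Variables (ns us : seq R) (z : H) (gs : seq H) (one : mono).
Hypothesis gsU : {in gs, forall x, x \is a GRing.unit}.
Hypothesis one1 : mono_val ns us one = 1.
Local Notation L := (letter gs).
Local Notation wval := (word_val L).
Local Notation rval := (rel_val ns us z L).

Lemma word_rel_val v k w : wval v = z ^ k * wval w -> rval (word_rel one v k w) = 0.
Proof.
move=> vw; rewrite /rel_val /word_rel !big_cons big_nil /= one1 !mulr1 addr0.
by rewrite mulr1z scale1r expr0z mul1r vw scaleN1r subrr.
Qed.

Lemma inverse_rels_val g : {in inverse_rels one g, forall r, rval r = 0}.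
Proof.
move=> r; rewrite !inE => /orP[] /eqP ->; apply: word_rel_val;
  rewrite /word_val !big_cons !big_nil expr0z !mulr1 letter_flip.
  exact/mulrV/letter_unit.
exact/mulVr/letter_unit.
Qed.

Lemma quadratic_rel_val a1 a2 k v (x : H) : z \is a GRing.unit ->
    (forall h, z * h = h * z) -> x = z ^ k * wval v ->
    x - (mono_val ns us a1)%:A + mono_val ns us a2 *: x^-1 = 0 ->
  rval (quadratic_rel one a1 a2 k v) = 0.
Proof.
move=> zU zC xE rel_x; rewrite /rel_val !big_cons big_nil /= one1 addr0 mulr1.
rewrite ?mulr1z ?scale1r ?mul1r ?mulN1r ?scaleNr addrA -xE.
rewrite [wval [::]]/(word_val _ _) big_nil.
rewrite word_val_inv // -[intZmod.oppz k]/(- k) -invr_expz.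
by rewrite -[_^-1 * _^-1]invrM ?unitrXz ?word_val_unit // -(zkC zC) -xE.
Qed.

Lemma cubic_rel_val a1 a2 a3 g (x := L g) :
    x ^+ 2 - mono_val ns us a1 *: x + (mono_val ns us a2)%:A
      - mono_val ns us a3 *: x^-1 = 0 ->
  rval (cubic_rel one a1 a2 a3 g) = 0.
Proof.
move=> rel_x; rewrite /rel_val !big_cons big_nil /= one1 addr0 mulr1.
rewrite ?mulr1z ?scale1r ?mul1r ?mulN1r ?scaleNr !addrA.
by rewrite /word_val !big_cons !big_nil !mulr1 letter_flip.
Qed.

Lemma quartic_rel_val a1 a2 a3 a4 g (x := L g) :
    x ^+ 2 - mono_val ns us a1 *: x + (mono_val ns us a2)%:A
      - mono_val ns us a3 *: x^-1 + mono_val ns us a4 *: x ^- 2 = 0 ->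
  rval (quartic_rel one a1 a2 a3 a4 g) = 0.
Proof.
move=> rel_x; rewrite /rel_val !big_cons big_nil /= one1 addr0 mulr1.
rewrite ?mulr1z ?scale1r ?mul1r ?mulN1r ?scaleNr !addrA.
rewrite /word_val !big_cons !big_nil !mulr1 letter_flip.
by rewrite -invrM ?letter_unit.
Qed.

End Values.

(** * Bases and Gram matrices *)

(** Sorting the indices is avoided by building a left inverse row by row: if A j i is nonzero with i
    different from j, then i has smaller rank than j. Hence row j of the inverse is obtained from
    the unit vector e_j by subtracting the A j i V i already constructed and dividing by A j j. *)
Lemma det_unit_ranked (R : comUnitRingType) N (A : 'M[R]_N) (r : 'I_N -> nat) :
    (forall i, A i i \is a GRing.unit) ->
    (forall i j, i != j -> (r i <= r j)%N -> A i j = 0) ->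
  \det A \is a GRing.unit.
Proof.
move=> Aii Aij.
have rowS j : row j A = \sum_i A j i *: delta_mx 0 i.
  by rewrite [LHS]row_sum_delta; apply: eq_bigr => i _; rewrite mxE.
have key n : exists V : 'I_N -> 'rV[R]_N,
    forall j, (r j < n)%N -> V j *m A = delta_mx 0 j.
  elim: n => [|n [V VA]]; first by exists (fun=> 0).
  exists (fun j => if (r j < n)%N then V j else
    (A j j)^-1 *: (delta_mx 0 j - \sum_(i | i != j) A j i *: V i)) => j.
  rewrite ltnS => rj; case: ltnP => [/VA //|nr].
  rewrite -scalemxAl mulmxBl -rowE rowS (bigD1 j) //= mulmx_suml.
  rewrite [X in _ + X - _](_ : _ = \sum_(i | i != j) A j i *: V i *m A).
    by rewrite addrK scalerA mulVr ?Aii // scale1r.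
  apply: eq_bigr => i neq_ij; rewrite -scalemxAl.
  (* If n <= r i, then r j <= r i and A j i = 0, so the value of V i, not yet under control, is
     multiplied by 0. *)
  have [/VA -> //|ni] := ltnP (r i) n.
  by rewrite Aij 1?eq_sym // ?scale0r // (leq_trans rj).
have [V VA] := key (\max_j r j).+1.
have: (\matrix_j V j) *m A = 1%:M.
  apply/row_matrixP => j; rewrite row_mul rowK VA ?row1 //.
  by rewrite ltnS leq_bigmax.
by case/mulmx1_unit => _; rewrite unitmxE.
Qed.

(** Expanding [g] and [f] in [b] writes the matrix as G times the Gram matrix times the transpose of
    F. A unit determinant forces each factor to have one, so the invertibility of both changes of
    family comes for free. *)
Lemma gram_unit (R : comUnitRingType) (H : algType R) (tau : {scalar H})
    (b : seq H) (f g : 'I_(size b) -> H) :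
    (forall h : H, exists c : 'rV[R]_(size b), h = \sum_i c 0 i *: b`_i) ->
    \det (\matrix_(i, j) tau (g i * f j)) \is a GRing.unit ->
  \det (gram tau b) \is a GRing.unit.
Proof.
move=> span_b.
have [F fE] : exists F : 'I_(size b) -> 'rV[R]_(size b),
    forall j, f j = \sum_i F j 0 i *: b`_i.
  by have [F FE] := choice (fun j => span_b (f j)); exists F.
have [G gE] : exists G : 'I_(size b) -> 'rV[R]_(size b),
    forall j, g j = \sum_i G j 0 i *: b`_i.
  by have [G GE] := choice (fun j => span_b (g j)); exists G.
have -> : \matrix_(i, j) tau (g i * f j) =
    (\matrix_i G i) *m gram tau b *m (\matrix_i F i)^T.
  apply/matrixP => i j; rewrite !mxE gE fE mulr_suml linear_sum.
  under [RHS]eq_bigr do rewrite !mxE mulr_suml.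
  rewrite exchange_big; apply: eq_bigr => k _ /=.
  rewrite mulr_sumr linear_sum; apply: eq_bigr => l _ /=.
  by rewrite !mxE -scalerAl -scalerAr !linearZ /= mulrA mulrAC.
by rewrite !det_mulmx !unitrM => /andP[/andP[]].
Qed.

Lemma basis_inj (R : comUnitRingType) (H : algType R) (b : seq H) :
  is_basis b -> forall c d : 'rV[R]_(size b),
  \sum_i c 0 i *: b`_i = \sum_i d 0 i *: b`_i -> c = d.
Proof.
move=> [_ free_b] c d eq_cd; apply/eqP; rewrite -subr_eq0; apply/eqP/free_b.
under eq_bigr do rewrite !mxE scalerBl.
by rewrite big_split /= sumrN eq_cd subrr.
Qed.

Lemma basis_neq (R : comUnitRingType) (H : algType R) (b : seq H) (i j : nat) :
  is_basis b -> (i < size b)%N -> (j < size b)%N -> i != j -> b`_i != b`_j.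
Proof.
move=> hb ib jb neq_ij; apply/eqP => bij.
have := @basis_inj _ _ _ hb (delta_mx 0 (Ordinal ib)) (delta_mx 0 (Ordinal jb)).
have delta (k : 'I_(size b)) : \sum_i (delta_mx 0 k : 'rV[R]__) 0 i *: b`_i = b`_k.
  rewrite (bigD1 k) //= mxE !eqxx scale1r big1 ?addr0 // => l /negPf lk.
  by rewrite mxE lk andbF scale0r.
rewrite !delta /= => /(_ bij) /matrixP/(_ 0 (Ordinal ib)).
rewrite !mxE !eqxx -val_eqE /= (negPf neq_ij) => /eqP; exact/negP/oner_neq0.
Qed.

Lemma basis_scalar (R : comUnitRingType) (H : algType R) (b : seq H)
    (v : 'rV[R]_(size b)) :
  is_basis b -> exists tau : {scalar H}, forall i : 'I_(size b), tau b`_i = v 0 i.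
Proof.
move=> hb; have [span_b _] := hb.
have [c cE] : exists c : H -> 'rV[R]_(size b),
    forall h, h = \sum_i c h 0 i *: b`_i by have [c cE] := choice span_b; exists c.
have cP h (d : 'rV[R]_(size b)) : h = \sum_i d 0 i *: b`_i -> c h = d.
  by move=> hE; apply: (basis_inj hb); rewrite -cE.
pose f h : R := \sum_i c h 0 i * v 0 i.
have lin_f : scalar f.
  move=> a g h; rewrite /f (cP (a *: g + h) (a *: c g + c h)).
    rewrite mulr_sumr -big_split; apply: eq_bigr => i _ /=.
    by rewrite !mxE mulrDl mulrA.
  rewrite {1}[g]cE {1}[h]cE scaler_sumr -big_split; apply: eq_bigr => i _ /=.
  by rewrite !mxE scalerDl scalerA.
pose t : {scalar H} := HB.pack f (GRing.isLinear.Build R H R *%R f lin_f).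
exists t => i; rewrite -[t _]/(f _).
rewrite /f (cP b`_i (delta_mx 0 i)).
  rewrite (bigD1 i) //= mxE !eqxx mul1r big1 ?addr0 // => j /negPf ji.
  by rewrite mxE ji andbF mul0r.
rewrite (bigD1 i) //= mxE !eqxx scale1r big1 ?addr0 // => j /negPf ji.
by rewrite mxE ji andbF scale0r.
Qed.

(** * The semilinear anti-automorphism inverting the generators *)

Section FreeAlgebraWords.
Variables (R : comNzRingType) (X : choiceType).
Local Notation free_alg := (free_alg R X).

Definition free_word (w : seq X) : free_alg := \prod_(x <- w) free_gen R x.

Lemma free_word_cat v w : free_word (v ++ w) = free_word v * free_word w.
Proof. exact: big_cat. Qed.

Lemma mkmalgU_word (w : seq X) c :
  mkmalgU (FMonom w) c = c *: free_word w :> free_alg.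
Proof.
have scaleU k a : a *: mkmalgU k 1 = mkmalgU k a :> free_alg.
  by apply/malgP => l; rewrite mcoeffZ !mcoeffU mulrnAr mulr1.
rewrite -scaleU; congr (_ *: _); elim: w => [|x w IHw].
  by rewrite /free_word big_nil -fmoneE.
rewrite /free_word big_cons -/(free_word w) -IHw /free_gen.
rewrite malgM_def fgmulUU mulr1; congr (mkmalgU _ _).
by apply/eqP; rewrite fmP fmM fmU.
Qed.

Lemma free_alg_ind (P : free_alg -> Prop) :
    P 0 -> (forall f g, P f -> P g -> P (f + g)) ->
    (forall c w, P (c *: free_word w)) ->
  forall f, P f.
Proof.
move=> P0 PD PU f; rewrite [f]monalgE.
elim/big_ind: _ => // k _; rewrite -[k]fmK.
rewrite mkmalgU_word; exact: PU.
Qed.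

Section WordMap.
Variables (S : nzRingType) (phi : {additive R -> S}) (h : seq X -> S).

(** Only additivity is built in, with [h] arbitrary on words: the same construction then yields an
    anti-homomorphism and the coefficient functionals of a group algebra. *)
Definition word_map (f : free_alg) : S :=
  mmap phi (fun k : {fmonom X} => h (fmonom_val k)) f.

Lemma word_map_is_zmod_morphism : zmod_morphism word_map.
Proof. exact: mmap_is_additive. Qed.

HB.instance Definition _ :=
  GRing.isZmodMorphism.Build free_alg S word_map word_map_is_zmod_morphism.

Lemma word_mapE c w : word_map (c *: free_word w) = phi c * h w.
Proof. by rewrite -mkmalgU_word /word_map mmapU. Qed.

End WordMap.

End FreeAlgebraWords.

Lemma scaler_mul (R : comNzRingType) (A : algType R) (a b : R) (x y : A) :
  (a *: x) * (b *: y) = (a * b) *: (x * y).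
Proof. by rewrite -scalerAl -scalerAr scalerA. Qed.

(** Since x^-1 - a^-1 = - a^-1 x^-1 (x - a), inverting x and the roots changes a product of the x -
    a only by a unit scalar and a power of x. This is why the inverted polynomial relation still
    holds. *)
Lemma inv_root_step (R : comUnitRingType) (A : unitAlgType R) (x p : A) (a b : R) n :
    x \is a GRing.unit -> a \is a GRing.unit -> GRing.comm p x ->
  (b *: (x ^- n * p)) * (x^-1 - a^-1%:A)
  = (- a^-1 * b) *: (x ^- n.+1 * ((x - a%:A) * p)).
Proof.
move=> xU aU px; have -> : x^-1 - a^-1%:A = (- a^-1) *: (x^-1 * (x - a%:A)).
  rewrite mulrBr mulVr // mulr_algr scalerBr scalerA mulNr mulVr //.
  by rewrite !scaleNr scale1r opprK addrC.
rewrite scaler_mul mulrC exprS invrM ?unitrX // -!mulrA; congr (_ *: (_ * _)).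
rewrite mulrA (commrV px) -mulrA; congr (_ * _).
by rewrite mulrBr mulrBl px; congr (_ - _); rewrite mulr_algl mulr_algr.
Qed.

Lemma comm_prod_root (R : comNzRingType) (A : algType R) (I : Type) (s : seq I)
    (c : I -> R) (x : A) : GRing.comm (\prod_(i <- s) (x - (c i)%:A)) x.
Proof.
apply/commr_sym/commr_prod => i _; apply: commrB => //.
by rewrite /GRing.comm mulr_algl mulr_algr.
Qed.

Section Iota.
Variable D : hecke_datum.
Local Notation H := (hecke D).
Local Notation R := (hring D).
Local Notation falg := (free_alg R (gen D)).

Definition star_scalar (a : R) : H := (lstar a)%:A.

Lemma star_scalar_is_zmod_morphism : zmod_morphism star_scalar.
Proof. by move=> a b; rewrite /star_scalar rmorphB scalerBl. Qed.

HB.instance Definition _ :=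
  GRing.isZmodMorphism.Build R H star_scalar star_scalar_is_zmod_morphism.

Definition inv_word_val (w : seq (gen D)) : H := \prod_(x <- rev w) (hgen x)^-1.

(* The R-semilinear anti-automorphism T_b |-> T_(b^-1), first on the free
   algebra. *)
Definition free_anti : falg -> H := word_map star_scalar inv_word_val.
HB.instance Definition _ := GRing.Additive.on free_anti.

Lemma free_antiE c w :
  free_anti (c *: free_word _ w) = lstar c *: inv_word_val w.
Proof. by rewrite /free_anti word_mapE /star_scalar mulr_algl. Qed.

Lemma free_antiD f g : free_anti (f + g) = free_anti f + free_anti g.
Proof. exact: raddfD. Qed.

Lemma free_antiB f g : free_anti (f - g) = free_anti f - free_anti g.
Proof. exact: raddfB. Qed.

Lemma free_antiM f g : free_anti (f * g) = free_anti g * free_anti f.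
Proof.
elim/free_alg_ind: f => [|f1 f2 IH1 IH2|c v]; first by rewrite mul0r raddf0 mulr0.
  rewrite [X in free_anti X]mulrDl !free_antiD [RHS]mulrDr.
  by congr (_ + _); [exact: IH1 | exact: IH2].
elim/free_alg_ind: g => [|g1 g2 IH1 IH2|d w]; first by rewrite mulr0 raddf0 mul0r.
  rewrite [X in free_anti X]mulrDr !free_antiD [RHS]mulrDl.
  by congr (_ + _); [exact: IH1 | exact: IH2].
rewrite [X in free_anti X](_ : _ = (c * d) *: free_word R (v ++ w)); last first.
  by rewrite -malg_scaleAr -scalerAl scalerA -free_word_cat (mulrC d).
rewrite [LHS]free_antiE.
rewrite [X in _ = X * _]free_antiE.
rewrite [X in _ = _ * X]free_antiE.
rewrite [RHS]scaler_mul.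
rewrite [X in X *: _ = _]rmorphM.
rewrite [X in X *: _ = _]mulrC.
congr (_ *: _).
rewrite /inv_word_val rev_cat.
exact: big_cat.
Qed.

Lemma free_anti1 : free_anti 1 = 1.
Proof.
have -> : 1 = 1 *: free_word R [::] :> falg by rewrite scale1r /free_word big_nil.
by rewrite free_antiE rmorph1 scale1r /inv_word_val big_nil.
Qed.

Lemma free_anti_word w : free_anti (free_word R w) = inv_word_val w.
Proof. by rewrite -[free_word R w]scale1r free_antiE rmorph1 scale1r. Qed.

Lemma free_anti_gen x : free_anti (free_gen R x) = (hgen x)^-1.
Proof.
have -> : free_gen R x = 1 *: free_word R [:: x].
  by rewrite scale1r /free_word big_seq1.
by rewrite free_antiE rmorph1 scale1r /inv_word_val big_seq1.
Qed.

Lemma inv_word_valE w : inv_word_val w = (\prod_(x <- w) hgen x)^-1.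
Proof.
rewrite /inv_word_val; elim: w => [|x w IHw]; first by rewrite !big_nil invr1.
rewrite rev_cons -cats1 big_cat big_seq1 IHw big_cons invrM ?hgen_unit //.
by apply: rpred_prod => y _; apply: hgen_unit.
Qed.

Lemma free_anti_root x a :
  free_anti (free_gen R x - a%:A) = (hgen x)^-1 - (lstar a)%:A.
Proof.
rewrite free_antiB free_anti_gen; congr (_ - _).
have -> : a%:A = a *: free_word R [::] :> falg by rewrite /free_word big_nil.
by rewrite free_antiE /inv_word_val big_nil.
Qed.

Lemma lstar_uvar x (j : 'I_(gdeg x)) : lstar (@uvar D x j) = (@uvar D x j)^-1.
Proof. exact: lstar_lX. Qed.

Lemma free_anti_rel f : f \in hecke_rels D -> free_anti f = 0.
Proof.
rewrite mem_cat => /orP[/mapP[lr lr_in ->]|/mapP[x _ ->]].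
  rewrite free_antiB -/(free_word R lr.1) -/(free_word R lr.2).
  by rewrite !free_anti_word !inv_word_valE (hgen_braid lr_in) subrr.
have anti_prod (s : seq 'I_(gdeg x)) :
    free_anti (\prod_(j <- s) (free_gen R x - (uvar j)%:A))
    = (\prod_(j <- s) (- (uvar j)^-1)) *:
      ((hgen x) ^- (size s) * \prod_(j <- s) (hgen x - (uvar j)%:A)).
  elim: s => [|j s IHs]; first by rewrite !big_nil free_anti1 expr0 invr1 mul1r scale1r.
  rewrite !big_cons [LHS]free_antiM [X in _ * X]free_anti_root [X in X * _]IHs.
  rewrite [lstar _](lstar_uvar j).
  apply: inv_root_step (hgen_unit x) (lX_unit _) _.
  exact: comm_prod_root.
rewrite -[LHS]/(free_anti (\prod_(j <- index_enum _) _)) anti_prod.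
by rewrite -[X in _ * X]/(\prod_(j < gdeg x) _) hgen_poly mulr0 scaler0.
Qed.

Lemma free_anti_ideal f : palg_ideal (hecke_presentation D) f -> free_anti f = 0.
Proof.
elim=> {f} [f /free_anti_rel //||f g _ f0 _ g0|a f _ f0|a f _ f0].
- exact: raddf0.
- by rewrite free_antiD f0 g0 addr0.
- by rewrite free_antiM f0 mul0r.
- by rewrite free_antiM f0 mulr0.
Qed.

Definition anti (h : H) : H := free_anti (repr h).

Lemma anti_of f : anti (palg_of _ f) = free_anti f.
Proof.
by apply/eqP; rewrite -subr_eq0 -free_antiB free_anti_ideal //; apply: repr_hecke_of.
Qed.

Lemma antiD g h : anti (g + h) = anti g + anti h.
Proof.
by elim/palgW: g => f; elim/palgW: h => k; rewrite -palg_ofD !anti_of free_antiD.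
Qed.

Lemma antiM g h : anti (g * h) = anti h * anti g.
Proof.
by elim/palgW: g => f; elim/palgW: h => k; rewrite -palg_ofM !anti_of free_antiM.
Qed.

Lemma anti1 : anti 1 = 1.
Proof. by rewrite -palg_of1 anti_of free_anti1. Qed.

Lemma antiZ a h : anti (a *: h) = lstar a *: anti h.
Proof.
have -> : a *: h = a%:A * h by rewrite mulr_algl.
rewrite antiM -palg_ofA anti_of.
have -> : a%:A = a *: free_word R [::] :> falg by rewrite /free_word big_nil.
by rewrite free_antiE /inv_word_val big_nil mulr_algr.
Qed.

Lemma anti_gen x : anti (hgen x) = (hgen x)^-1.
Proof. by rewrite /hgen /palg_gen anti_of free_anti_gen. Qed.

Lemma anti_letter a : anti (T_letter a) = T_letter (inv_letter a).
Proof.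
case: a => x [] /=; rewrite /T_letter /= ?anti_gen //.
have: anti ((hgen x)^-1 * hgen x) = 1 by rewrite mulVr ?hgen_unit ?anti1.
rewrite antiM anti_gen => /(congr1 ( *%R (hgen x))).
by rewrite (mulVKr (hgen_unit x)) mulr1.
Qed.

Lemma T_inv (b : braid_group D) : T b^-1%g = (T b)^-1.
Proof.
have bU : T b \is a GRing.unit.
  by apply/unitrP; exists (T b^-1%g); rewrite -!T_mul mulVg mulgV T_one.
by apply: (mulrI bU); rewrite -T_mul mulgV T_one mulrV.
Qed.

Lemma anti_T (b : braid_group D) : anti (T b) = T b^-1%g.
Proof.
elim/pgroupW: b => w; rewrite T_inv T_of.
elim: w => [|a w IHw]; first by rewrite big_nil anti1 invr1.
have lU c : @T_letter D c \is a GRing.unit.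
  by case: c => x []; rewrite /T_letter /= ?unitrV hgen_unit.
have wU : \prod_(c <- w) @T_letter D c \is a GRing.unit.
  by apply: rpred_prod => c _; apply: lU.
rewrite big_cons [LHS]antiM [X in X * _]IHw (invrM (lU a) wU); congr (_ * _).
rewrite anti_letter; apply: (mulrI (lU a)).
by rewrite T_inv_letter (mulrV (lU a)).
Qed.

End Iota.

(** * Specialisation to the group algebra *)

Lemma zeta_prim e : e \in [:: 2; 3; 4]%N -> e.-primitive_root (zeta e).
Proof.
have n1 : (-1 : algC) != 1.
  by rewrite -subr_eq0 -opprD oppr_eq0 (_ : 1 + 1 = 2%:R) // pnatr_eq0.
have rootE n : (0 < n)%N -> (n.-root (-1) : algC) ^+ n = -1 by move=> n_gt0; rewrite rootCK.
have primI n (z : algC) : (0 < n)%N -> z ^+ n = 1 ->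
    (forall m, (0 < m < n)%N -> (m %| n)%N -> z ^+ m != 1) -> n.-primitive_root z.
  move=> n_gt0 zn zm; have [m prim_m m_dvd] := prim_order_exists n_gt0 zn.
  have m_gt0 := prim_order_gt0 prim_m.
  have [m_lt|n_le] := ltnP m n.
    by have := zm m; rewrite m_gt0 m_lt m_dvd prim_expr_order ?eqxx // => /(_ isT isT).
  by rewrite (_ : n = m) //; apply/eqP; rewrite eqn_leq n_le dvdn_leq.
rewrite !inE => /or3P[] /eqP ->; rewrite /zeta; apply: primI => //.
- by rewrite rootE // sqrrN expr1n.
- by case=> [|[|m]] //= _ _; rewrite expr1 rootE.
- by rewrite -exprM mulnC exprM rootE // sqrrN expr1n.
- case=> [|[|[|m]]] //= _ _; rewrite expr1.
  (* If the chosen cube root of -1 had square 1, it would be -1 itself, but the root of least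
     argument is never a negative real. *)
  apply/eqP => w2; have := rootE 3 isT; rewrite exprS w2 mulr1 => w1.
  by have := @rootC_lt0 algC 3 (-1) isT; rewrite w1 ltrN10.
- by rewrite -exprM mulnC exprM rootE // sqrrN expr1n.
- case=> [|[|[|[|m]]]] //= _ _.
    rewrite expr1; apply/eqP => w2; have := rootE 4 isT.
    by rewrite (exprM _ 2 2) w2 expr1n => /esym/eqP; apply/negP.
  by rewrite -exprM rootE.
Qed.

Lemma sum_coef_Xn_sub1 (R : nzRingType) d (F : nat -> R) : (0 < d)%N ->
  \sum_(i < d.+1) ('X^d - 1 : {poly R})`_i * F i = F d - F 0%N.
Proof.
case: d => // d _; rewrite big_ord_recr big_ord_recl big1 => [|i _] /=.
  rewrite !coefB !coefXn !coef1 !eqxx /= sub0r subr0 mul1r addr0.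
  by rewrite mulN1r addrC.
by rewrite coefB coefXn coef1 /= eqSS ltn_eqF ?subrr ?mul0r.
Qed.

Section Specialisation.
Variable D : hecke_datum.
Local Notation H := (hecke D).
Local Notation R := (hring D).
Local Notation falg := (free_alg R (gen D)).
Local Notation G := (refl_group D).

(* Abstracting the specialisation keeps unification from unfolding it. *)
Variable sp : {rmorphism R -> algC}.
Hypothesis sp_uvar : forall x (j : 'I_(gdeg x)), sp (uvar j) = zeta (gdeg x) ^+ j.

Definition refl_word (w : seq (gen D)) : G := pgroup_of _ (positive w).

(** The coefficient of g after specialisation. One such functional is not multiplicative, but
    multiplication by a word translates g, so vanishing on the ideal of relations is proved for all
    g at once. *)
Definition free_spec (g : G) : falg -> algC :=
  word_map sp (fun w => (refl_word w == g)%:R).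
HB.instance Definition _ g := GRing.Additive.on (free_spec g).

Lemma free_spec0 g : free_spec g 0 = 0. Proof. exact: raddf0. Qed.

Lemma free_specD g e f : free_spec g (e + f) = free_spec g e + free_spec g f.
Proof. exact: raddfD. Qed.

Lemma free_specB g e f : free_spec g (e - f) = free_spec g e - free_spec g f.
Proof. exact: raddfB. Qed.

Lemma free_specE g c w :
  free_spec g (c *: free_word _ w) = sp c * (refl_word w == g)%:R.
Proof. exact: word_mapE. Qed.

Lemma free_spec_word g w : free_spec g (free_word R w) = (refl_word w == g)%:R.
Proof. by rewrite -[free_word R w]scale1r free_specE rmorph1 mul1r. Qed.

Lemma refl_word_cat v w : refl_word (v ++ w) = (refl_word v * refl_word w)%g.
Proof. by rewrite /refl_word /positive map_cat pgroup_ofM. Qed.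

Lemma free_specMl g c w f :
  free_spec g ((c *: free_word _ w) * f)
  = sp c * free_spec ((refl_word w)^-1 * g)%g f.
Proof.
elim/free_alg_ind: f => [|f1 f2 IH1 IH2|d v].
- by rewrite [X in free_spec g X]mulr0 (free_spec0 g) (free_spec0 _) mulr0.
- rewrite [X in free_spec g X]mulrDr !free_specD [RHS]mulrDr.
  by congr (_ + _); [exact: IH1 | exact: IH2].
rewrite -malg_scaleAr -scalerAl scalerA -free_word_cat !free_specE.
have -> : (refl_word (w ++ v) == g) = (refl_word v == (refl_word w)^-1 * g)%g.
  by rewrite refl_word_cat -(inj_eq (mulgI (refl_word w)^-1%g)) mulKg.
by rewrite rmorphM (mulrC (sp d)) mulrA.
Qed.

Lemma free_specMr g c w f :
  free_spec g (f * (c *: free_word _ w))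
  = sp c * free_spec (g * (refl_word w)^-1)%g f.
Proof.
elim/free_alg_ind: f => [|f1 f2 IH1 IH2|d v].
- by rewrite [X in free_spec g X]mul0r (free_spec0 g) (free_spec0 _) mulr0.
- rewrite [X in free_spec g X]mulrDl !free_specD [RHS]mulrDr.
  by congr (_ + _); [exact: IH1 | exact: IH2].
rewrite -malg_scaleAr -scalerAl scalerA -free_word_cat !free_specE.
have -> : (refl_word (v ++ w) == g) = (refl_word v == g * (refl_word w)^-1)%g.
  by rewrite refl_word_cat -(inj_eq (mulIg (refl_word w)^-1%g)) mulgK.
by rewrite rmorphM mulrA.
Qed.

Lemma free_spec1 g : free_spec g 1 = (1%g == g)%:R.
Proof. by rewrite -[1](_ : free_word R [::] = 1) ?free_spec_word // /free_word big_nil. Qed.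

Lemma free_spec_genl g x f :
  free_spec g (free_gen R x * f) = free_spec ((refl_word [:: x])^-1 * g)%g f.
Proof.
have -> : free_gen R x = 1 *: free_word R [:: x].
  by rewrite scale1r /free_word big_seq1.
by rewrite free_specMl rmorph1 mul1r.
Qed.

Lemma free_spec_scalarl g a f : free_spec g (a%:A * f) = sp a * free_spec g f.
Proof.
have -> : a%:A = a *: free_word R [::] :> falg by rewrite /free_word big_nil.
by rewrite free_specMl invg1 mul1g.
Qed.

Lemma free_spec_subl g x a f : free_spec g ((free_gen R x - a%:A) * f) =
  free_spec ((refl_word [:: x])^-1 * g)%g f - sp a * free_spec g f.
Proof.
rewrite [X in free_spec g X]mulrBl free_specB.
by congr (_ - _); [exact: free_spec_genl | exact: free_spec_scalarl].
Qed.

Hypothesis degP : forall c : par D, deg c \in [:: 2; 3; 4]%N.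

Lemma refl_word_pow x n : refl_word (nseq n x) = (refl_word [:: x] ^+ n)%g.
Proof.
by elim: n => // n IHn; rewrite -[nseq n.+1 x]/([:: x] ++ _) refl_word_cat IHn expgS.
Qed.

(** The product of the x - u_j expands with the coefficients of a polynomial that specialises to the
    product of the X - zeta^j, which is X^e - 1 because zeta is primitive. Its two terms have the
    same image in the reflection group, where x^e = 1, and cancel. *)
Lemma free_spec_rel g f : f \in hecke_rels D -> free_spec g f = 0.
Proof.
rewrite mem_cat => /orP[/mapP[lr lr_in ->]|/mapP[x _ ->]].
  rewrite free_specB -/(free_word R lr.1) -/(free_word R lr.2) !free_spec_word.
  rewrite (_ : refl_word lr.1 = refl_word lr.2) ?subrr //.
  apply/pgroup_eqP.
  apply: (@word_eq_rel _ _ (positive lr.1, positive lr.2)).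
  by rewrite mem_cat map_f.
pose q (s : seq 'I_(gdeg x)) : {poly algC} :=
  \prod_(j <- s) ('X - (sp (uvar j))%:P).
have sz_q s : size (q s) = (size s).+1 by rewrite size_prod_XsubC.
have specE s h : free_spec h (\prod_(j <- s) (free_gen R x - (uvar j)%:A))
    = \sum_(i < (size s).+1) (q s)`_i * (refl_word [:: x] ^+ i == h)%g%:R.
  elim: s h => [|j s IHs] h.
    rewrite big_nil big_ord1 /q big_nil coef1 eqxx mul1r.
    exact: free_spec1.
  rewrite big_cons free_spec_subl [X in X - _]IHs [X in _ - _ * X]IHs.
  rewrite /q big_cons -/(q s).
  under [RHS]eq_bigr do rewrite mulrBl coefB coefXM coefCM mulrBl.
  rewrite big_split sumrN /=; congr (_ - _).
    rewrite [RHS]big_ord_recl /= mul0r add0r; apply: eq_bigr => i _ /=.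
    rewrite /bump /= add1n expgS; congr (_ * (nat_of_bool _)%:R).
    by rewrite -[LHS](inj_eq (mulgI (refl_word [:: x]))) mulgA mulgV mul1g.
  rewrite [RHS]big_ord_recr /= nth_default ?sz_q // mulr0 mul0r addr0 mulr_sumr.
  by apply: eq_bigr => i _; rewrite mulrA.
rewrite -[\prod_(j < _) _]/(\prod_(j <- index_enum _) _) specE.
have -> : q (index_enum 'I_(gdeg x)) = 'X^(gdeg x) - 1.
  rewrite /q -(factor_Xn_sub_1 (zeta_prim (degP (cls x)))) big_mkord.
  by apply: eq_bigr => j _; rewrite sp_uvar.
have -> : size (index_enum 'I_(gdeg x)) = gdeg x.
  by rewrite [index_enum _]unlock -enumT size_enum_ord.
rewrite (sum_coef_Xn_sub1 (fun i => (refl_word [:: x] ^+ i == g)%g%:R)) ?deg_gt0 //.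
suff -> : (refl_word [:: x] ^+ gdeg x = 1)%g by rewrite expg0 subrr.
rewrite -refl_word_pow; apply/pgroup_eqP.
apply: (@word_eq_rel _ _ (positive (nseq (gdeg x) x), [::])).
rewrite mem_cat; apply/orP; right; apply/mapP; exists x => //.
by rewrite mem_enum.
Qed.

Lemma free_spec_ideal g f :
  palg_ideal (hecke_presentation D) f -> free_spec g f = 0.
Proof.
move=> If; elim: If g => {f} [f f_rel|||a f _ IHf|a f _ IHf] g.
- exact: free_spec_rel.
- exact: free_spec0.
- by move=> g1 _ IH1 _ IH2 k; rewrite free_specD IH1 IH2 addr0.
- elim/free_alg_ind: a => [|a1 a2 IH1 IH2|c w].
  + by rewrite [X in free_spec g X]mul0r free_spec0.
  + by rewrite [X in free_spec g X]mulrDl free_specD [X in X + _]IH1 IH2 addr0.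
  + by rewrite [LHS]free_specMl IHf mulr0.
- elim/free_alg_ind: a => [|a1 a2 IH1 IH2|c w].
  + by rewrite [X in free_spec g X]mulr0 free_spec0.
  + by rewrite [X in free_spec g X]mulrDr free_specD [X in X + _]IH1 IH2 addr0.
  + by rewrite [LHS]free_specMr IHf mulr0.
Qed.

Definition spec_at (g : G) (h : H) : algC := free_spec g (repr h).

Lemma spec_at_of g f : spec_at g (palg_of _ f) = free_spec g f.
Proof.
by apply/eqP; rewrite -subr_eq0 -free_specB free_spec_ideal //; apply: repr_hecke_of.
Qed.

Lemma spec_atD g h k : spec_at g (h + k) = spec_at g h + spec_at g k.
Proof.
by elim/palgW: h => f; elim/palgW: k => k; rewrite -palg_ofD !spec_at_of free_specD.
Qed.

Lemma spec_atZ g a h : spec_at g (a *: h) = sp a * spec_at g h.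
Proof.
elim/palgW: h => f; rewrite -palg_ofZ !spec_at_of.
by rewrite -free_spec_scalarl -scalerAl mul1r.
Qed.

Lemma spec_at_gen g x h :
  spec_at g (hgen x * h) = spec_at ((refl_word [:: x])^-1 * g)%g h.
Proof.
elim/palgW: h => f; rewrite /hgen /palg_gen -palg_ofM !spec_at_of.
exact: free_spec_genl.
Qed.

Lemma spec_at_T g (b : braid_group D) : spec_at g (T b) = (to_refl b == g)%:R.
Proof.
elim/pgroupW: b => w; rewrite T_of to_refl_of.
elim: w g => [|[x b] w IHw] g.
  by rewrite big_nil -palg_of1 spec_at_of free_spec1.
rewrite big_cons -cat1s pgroup_ofM; case: b; rewrite /T_letter /=.
  (* The translation rule is known for generators only; for an inverse generator it is applied
     backwards, writing g as x^-1 (x g). *)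
  rewrite -{1}[g](mulKg (refl_word [:: x])) -spec_at_gen mulrA mulrV ?hgen_unit //.
  rewrite mul1r IHw; congr (nat_of_bool _)%:R.
  rewrite -[[:: (x, true)]]/(inv_word [:: (x, false)]) pgroup_ofV.
  by rewrite -[LHS](inj_eq (mulgI (refl_word [:: x])^-1%g)) mulKg.
rewrite spec_at_gen IHw; congr (nat_of_bool _)%:R.
by rewrite -[LHS](inj_eq (mulgI (refl_word [:: x]))) mulgA mulgV mul1g.
Qed.

End Specialisation.

(** * From certificates to canonical traces *)

Lemma mulM_central (R : comUnitRingType) (H : unitAlgType R) (z v w : H) k p :
    z \is a GRing.unit -> (forall h, z * h = h * z) ->
  (z ^ k * v) * (z ^ p * w) = z ^ (p + k) * (v * w).
Proof.
by move=> zU zC; rewrite addrC exprzDr // -!mulrA (mulrA v) -(zkC zC p v) -mulrA.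
Qed.

Lemma invM_central (R : comUnitRingType) (H : unitAlgType R) (z v w : H) k p :
    z \is a GRing.unit -> (forall h, z * h = h * z) -> v \is a GRing.unit ->
  (z ^ k * v)^-1 * (z ^ p * w) = z ^ (p - k) * (v^-1 * w).
Proof.
move=> zU zC vU; rewrite invrM ?unitrXz // invr_expz -(zkC zC).
exact: mulM_central.
Qed.

Lemma scalar_coord (R : comUnitRingType) (H : lmodType R) (tau : {scalar H}) n
    (c : 'rV[R]_n) (F : 'I_n -> H) i0 :
  (forall i, tau (F i) = (i == i0)%:R) -> tau (\sum_i c 0 i *: F i) = c 0 i0.
Proof.
move=> tauE; rewrite linear_sum (bigD1 i0) //= linearZ /= tauE eqxx mulr1.
by rewrite big1 ?addr0 // => i ni; rewrite linearZ /= tauE (negPf ni) mulr0.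
Qed.

(** Condition (2) in coordinates: with [f] the anti-automorphism and [p] the image of pi, the terms
    of all basis elements but 1 are killed by [tau]. *)
Lemma semilinear_coord (R : comUnitRingType) (H : algType R) (tau : {scalar H})
    (phi : R -> R) (f : H -> H) p n (c : 'rV[R]_n) (F : 'I_n -> H) i0 :
    phi 0 = 0 ->
    (forall x y, f (x + y) = f x + f y) -> (forall a x, f (a *: x) = phi a *: f x) ->
    f (F i0) = 1 -> (forall i, i != i0 -> tau (f (F i) * p) = 0) ->
  tau (f (\sum_i c 0 i *: F i) * p) = phi (c 0 i0) * tau p.
Proof.
move=> phi0 fD fZ fi0 tau0; have f0 : f 0 = 0 by have := fZ 0 0; rewrite phi0 !scale0r.
rewrite (big_morph f fD f0) mulr_suml linear_sum (bigD1 i0) //= fZ fi0 -scalerAl.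
rewrite mul1r linearZ /= big1 ?addr0 // => i ni.
by rewrite fZ -scalerAl linearZ /= tau0 ?mulr0.
Qed.

Lemma spec_coord (R S : comUnitRingType) (H : lmodType R) (phi : {rmorphism R -> S})
    (f : H -> S) n (c : 'rV[R]_n) (F : 'I_n -> H) i0 :
    (forall x y, f (x + y) = f x + f y) ->
    (forall a x, f (a *: x) = phi a * f x) -> (forall i, f (F i) = (i == i0)%:R) ->
  f (\sum_i c 0 i *: F i) = phi (c 0 i0).
Proof.
move=> fD fZ fE.
have f0 : f 0 = 0 by have := fZ 0 0; rewrite rmorph0 scale0r mul0r.
rewrite (big_morph f fD f0) (bigD1 i0) //= fZ fE eqxx mulr1.
by rewrite big1 ?addr0 // => i ni; rewrite fZ fE (negPf ni) mulr0.
Qed.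

Section Tracial.
Variables (R : comUnitRingType) (H : unitAlgType R) (tau : {scalar H}).
(** This property passes to products and inverses, so commutation under [tau] spreads from a few
    elements to every T_beta. *)
Definition tracial c := forall h, tau (c * h) = tau (h * c).
Lemma tracialM c d : tracial c -> tracial d -> tracial (c * d).
Proof. by move=> Pc Pd h; rewrite -mulrA Pc -mulrA Pd mulrA. Qed.

Lemma tracialV c : c \is a GRing.unit -> tracial c -> tracial c^-1.
Proof. by move=> cU Pc h; rewrite -{1}[h](mulrVK cU) mulrA -Pc mulrA mulrV // mul1r. Qed.

Lemma tracial_prod (I : Type) (s : seq I) (F : I -> H) :
  (forall i, tracial (F i)) -> tracial (\prod_(i <- s) F i).
Proof.
move=> PF; elim/big_ind: _ => // [h|]; first by rewrite mulr1 mul1r.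
exact: tracialM.
Qed.

Lemma tracial_span (n : nat) (c : 'I_n -> R) (F : 'I_n -> H) y :
  (forall i, tracial (F i)) ->
  tau ((\sum_i c i *: F i) * y) = tau (y * (\sum_i c i *: F i)).
Proof.
move=> PF; rewrite mulr_suml mulr_sumr !linear_sum; apply: eq_bigr => i _.
by rewrite -scalerAl -scalerAr !linearZ /= PF.
Qed.

End Tracial.

Section Canonical.
Variable D : hecke_datum.
Local Notation H := (hecke D).
Local Notation R := (hring D).
Local Notation b := (hecke_basis D).
Hypothesis hB : is_basis b.
Hypothesis degP : forall c : par D, deg c \in [:: 2; 3; 4]%N.
Variables (gs : seq (gen D)) (ns us : seq R) (z : H) (one : mono) (C : certificate).
Local Notation L := (letter (map (@hgen D) gs)).
Local Notation wval := (word_val L).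
Hypothesis usU : {in us, forall u, u \is a GRing.unit}.
Hypothesis zU : z \is a GRing.unit.
Hypothesis zC : forall h, z * h = h * z.
Hypothesis one1 : mono_val ns us one = 1.
Hypothesis rels0 : {in relators C, forall r, rel_val ns us z L r = 0}.
(** Every generator has to be reached from z and the letters tested by the certificate. Quantifying
    over closed predicates covers G_7, where s is only available as z u^-1 t^-1. *)
Hypothesis gen_closed : forall P : H -> Prop,
  (forall x y, P x -> P y -> P (x * y)) ->
  (forall x, x \is a GRing.unit -> P x -> P x^-1) -> P z ->
  {in gens C, forall g, P (L g)} -> forall x, P (hgen x).
Hypothesis size_basis : size (basis C) = size (basis_words D).
Hypothesis head_words : nth [::] (basis_words D) 0 = [::].
Hypothesis basisE : forall j, (j < size (basis_words D))%N ->
  T (pgroup_of (braid_rels D) (nth [::] (basis_words D) j)) = basis_val z L C j.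
Hypothesis piE : T (braid_pi D) = z ^ pi_exp C * wval (pi_word C).
Hypothesis refl_neq1 : {in behead (basis_words D), forall w,
  pgroup_of _ w != 1%g :> refl_group D}.
Hypothesis size_dual : size (basis C) = (window C * size (dual C))%N.
Hypothesis checkC : check one C.
Variable tau : {scalar H}.
Hypothesis tauP : forall x, x \in b -> tau x = (x == 1)%:R.

Let size_b : size b = size (basis C).
Proof. by rewrite size_map size_basis. Qed.

Lemma nth_basis j : (j < size (basis C))%N -> b`_j = basis_val z L C j.
Proof.
rewrite size_basis => jC.
rewrite /hecke_basis.
rewrite (nth_map [::]).
exact: basisE.
exact: jC.
Qed.

Let w0 : word_of C 0 = [::].
Proof.
have /and5P[] := checkC; rewrite /check_words.
by case: (basis_at C 0) => [[[|?]|?] [|??]] //; case: (word_of C 0).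
Qed.

Let basis0 : basis_at C 0 = (Posz 0, [::]).
Proof.
by have /and5P[] := checkC; rewrite /check_words; case: (basis_at C 0) => [[[|?]|?] [|??]].
Qed.

Lemma basis_val0 : basis_val z L C 0 = 1.
Proof. by rewrite /basis_val basis0 expr0z /word_val big_nil mulr1. Qed.

Let size_gt0 : (0 < size (basis C))%N.
Proof.
rewrite lt0n; apply: contraTneq (oner_neq0 H) => sz0.
have [span_b _] := hB; have [c ->] := span_b 1.
by rewrite negbK big1 // => i; have := ltn_ord i; rewrite [X in (_ < X)%N]size_b sz0.
Qed.

Lemma tau_basis_val j : (j < size (basis C))%N ->
  tau (basis_val z L C j) = (j == 0%N)%:R.
Proof.
move=> jC; rewrite -nth_basis // tauP; last by rewrite mem_nth // size_b.
have [->|j0] := eqVneq j 0%N; first by rewrite nth_basis // basis_val0 eqxx.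
by rewrite -basis_val0 -nth_basis // (negPf (basis_neq hB _ _ j0)) // size_b.
Qed.

Lemma span_basis_val h : exists c : nat -> R,
  h = \sum_(j < size (basis C)) c j *: basis_val z L C j.
Proof.
have [span_b _] := hB; have [c hE] := span_b h.
pose F (j : nat) : R := if insub j is Some i then c 0 i else 0; exists F.
have sumE n : n = size (basis C) -> \sum_(j < n) F j *: basis_val z L C j
    = \sum_(j < size (basis C)) F j *: basis_val z L C j by move->.
rewrite [LHS]hE -(sumE _ size_b); apply: eq_bigr => i _.
by rewrite /F valK -nth_basis // -size_b.
Qed.

Let tab := final_table one C.
Let tt := final_tau one C tab (final_rows one C tab).
Let chk : [/\ check_span one C tab, check_trace one C tab tt,
  check_star one C tab tt, check_pi one C tab tt & check_dual one C tab tt].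
Proof. by have /and5P[_ ? ? ? /andP[? ?]] := checkC. Qed.

Let gsU : {in map (@hgen D) gs, forall x, x \is a GRing.unit}.
Proof. by move=> _ /mapP[x _ ->]; apply: hgen_unit. Qed.

Lemma tau_mulC x y : tau (x * y) = tau (y * x).
Proof.
have [spanC traceC _ _ _] := chk.
have Pgen : forall g, tracial tau (hgen g).
  apply: gen_closed => [c d|c||g gC h]; [exact: tracialM|exact: tracialV| |].
    by move=> h; rewrite zC.
  exact: (trace_gens usU zU zC one1 rels0 w0 tau_basis_val span_basis_val spanC traceC).
have [span_b _] := hB; have [c ->] := span_b x.
apply: tracial_span => i; rewrite /hecke_basis (nth_map [::]); last first.
  by have := ltn_ord i; rewrite [X in (_ < X)%N]size_map.
rewrite T_of; apply: tracial_prod => -[g []].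
  exact: tracialV (hgen_unit g) (Pgen g).
exact: Pgen.
Qed.

Lemma tau_star j : (0 < j < size (basis C))%N -> tau (anti b`_j * T (braid_pi D)) = 0.
Proof.
move=> jC; have [_ _ starC _ _] := chk; have /andP[j_gt0 j_lt] := jC.
rewrite -(star_basis usU zU zC one1 rels0 w0 tau_basis_val starC jC).
have jB : (j < size (basis_words D))%N by rewrite -size_basis.
have -> : anti b`_j = (basis_val z L C j)^-1.
  by rewrite /hecke_basis (nth_map [::] _ _ jB) anti_T T_inv (basisE jB).
rewrite piE (invM_central _ _ _ zU zC); last exact: word_val_unit.
by rewrite word_val_inv.
Qed.

Lemma tau_pi_unit : tau (T (braid_pi D)) \is a GRing.unit.
Proof.
have [_ _ _ piC _] := chk; rewrite piE.
exact: (pi_unit usU zU zC one1 rels0 w0 tau_basis_val piC).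
Qed.

Lemma nth_basis0 : b`_0 = 1.
Proof. by rewrite (nth_basis size_gt0) basis_val0. Qed.

Lemma tau_coord (c : 'rV[R]_(size b)) (i0 : 'I_(size b)) : i0 = 0%N :> nat ->
  tau (\sum_i c 0 i *: b`_i) = c 0 i0.
Proof.
move=> i00.
have tauE (i : 'I_(size b)) : tau b`_i = (i == i0)%:R.
  have iC : (i < size (basis C))%N by have := ltn_ord i; rewrite [X in (_ < X)%N]size_b.
  by rewrite (nth_basis iC) (tau_basis_val iC) -val_eqE /= i00.
exact: scalar_coord tauE.
Qed.

Lemma tau_star_trace (beta : braid_group D) :
  lval (lstar (tau (T beta^-1%g))) =
  lval (tau (T (beta * braid_pi D)%g)) / lval (tau (T (braid_pi D))).
Proof.
have [span_b _] := hB; have [c cE] := span_b (T beta^-1%g).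
have b_gt0 : (0 < size b)%N by rewrite size_b.
pose i0 := Ordinal b_gt0.
(* T_(beta pi) is the image of T_(beta^-1) under the anti-automorphism, times T_pi. Expanding
   T_(beta^-1) in the basis leaves only the starred coordinate of 1, because the trace of b^-1 pi
   vanishes for the other b. *)
have -> : tau (T (beta * braid_pi D)%g) = lstar (c 0 i0) * tau (T (braid_pi D)).
  rewrite T_mul -[beta in LHS]invgK -[X in tau (X * _)]anti_T cE.
  apply: (semilinear_coord _ (rmorph0 _) (@antiD D) (@antiZ D)) => [|i ni].
    by rewrite nth_basis0 anti1.
  apply: tau_star; rewrite lt0n; apply/andP; split.
    by apply: contra ni => /eqP i_0; apply/eqP/val_inj.
  by have := ltn_ord i; rewrite [X in (_ < X)%N]size_b.
rewrite [T beta^-1%g]cE.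
rewrite [X in lstar X](@tau_coord c i0 erefl).
rewrite -[lval (_ * _)]/(lval _ * lval _) mulfK //.
by rewrite lval_eq0; apply: contraTneq tau_pi_unit => ->; rewrite unitr0.
Qed.

Lemma tau_sp (sp : {rmorphism R -> algC}) (beta : braid_group D) :
    (forall x (j : 'I_(gdeg x)), sp (uvar j) = zeta (gdeg x) ^+ j) ->
  sp (tau (T beta)) = (to_refl beta == 1%g)%:R.
Proof.
move=> spE; have [span_b _] := hB; have [c cE] := span_b (T beta).
have b_gt0 : (0 < size b)%N by rewrite size_b.
pose i0 := Ordinal b_gt0.
rewrite -(spec_at_T spE degP 1%g beta) cE [X in sp X](@tau_coord c i0 erefl).
apply/esym; apply: (@spec_coord _ _ _ sp (spec_at sp 1%g) _ c _ i0
  (spec_atD spE degP 1%g) (spec_atZ spE degP 1%g)) => i.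
 rewrite /hecke_basis (nth_map [::]); last first.
  by have := ltn_ord i; rewrite [X in (_ < X)%N]size_map.
rewrite (spec_at_T spE degP) to_refl_of.
have [->|ni] := eqVneq i i0.
  by rewrite -[X in (X == _)%:R]/(pgroup_of _ (nth [::] (basis_words D) 0)) head_words !eqxx.
rewrite (negPf (refl_neq1 _)) //.
have i_gt0 : (0 < i)%N by rewrite lt0n; apply: contra ni => /eqP i_0; apply/eqP/val_inj.
have iC : (i < size (basis_words D))%N by have := ltn_ord i; rewrite [X in (_ < X)%N]size_map.
rewrite -drop1 -(prednK i_gt0) -add1n -nth_drop mem_nth // size_drop.
by rewrite ltn_subRL add1n prednK.
Qed.

Lemma tau_specialise (beta : braid_group D) :
  specialise (tau (T beta)) = (to_refl beta == 1%g)%:R.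
Proof. exact/tau_sp/specialise_uvar. Qed.

Lemma tau_gram_unit : \det (gram tau b) \is a GRing.unit.
Proof.
have [span_b _] := hB; set n := size (dual C).
have bn : size b = (window C * n)%N by rewrite size_b.
(* An index is read as the pair of its quotient and remainder by n; it merely numbers the z^a v and
   has no link with the i-th element of the basis. *)
pose f (i : 'I_(size b)) : H := z ^ (i %/ n)%N%:Z * wval (dual_at C (i %% n)).
pose g (i : 'I_(size b)) : H :=
  z ^ (- (i %/ n)%N%:Z) * wval (inv_code (dual_at C (i %% n))).
apply: (@gram_unit _ _ _ _ f g) => //.
have n_gt0 : (0 < n)%N.
  by rewrite lt0n; apply: contraTneq size_gt0 => n0; rewrite -size_b bn n0 muln0.
have modP (i : 'I_(size b)) : (i %% n < n)%N by rewrite ltn_mod.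
have divP (i : 'I_(size b)) : (i %/ n < window C)%N.
  by rewrite ltn_divLR // -bn.
have gfE (i j : 'I_(size b)) : tau (g i * f j) =
    dual_pair z L C tau ((j %/ n)%N%:Z - (i %/ n)%N%:Z) (i %% n) (j %% n).
  by rewrite /dual_pair /g /f (mulM_central _ _ _ _ zU zC).
have [_ _ _ _ dualC] := chk.
have pairP := dual_pairP usU zU zC one1 rels0 w0 tau_basis_val dualC.
(* Lexicographic rank: the multiplier exceeds every entry of [dual_rank], so the exponent of z
   dominates. *)
pose r (i : 'I_(size b)) := ((i %/ n) * (sumn (dual_rank C)).+1
                             + nth 0%N (dual_rank C) (i %% n))%N.
have rankP p : (nth 0%N (dual_rank C) p <= sumn (dual_rank C))%N.
  elim: (dual_rank C) p => [|k s IHs] [|p] //=; first exact: leq_addr.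
  exact: leq_trans (IHs p) (leq_addl _ _).
apply: (det_unit_ranked (r := r)) => [i|i j neq_ij]; rewrite mxE gfE.
  by rewrite subrr; have [] := pairP _ _ (modP i) (modP i).
have [_ pair0 pairk] := pairP _ _ (modP i) (modP j).
have [lt_ij _|gt_ij|eq_ij] := ltngtP (i %/ n) (j %/ n).
- rewrite subzn 1?ltnW // pairk // subn_gt0 lt_ij.
  exact: leq_ltn_trans (leq_subr _ _) (divP j).
- rewrite leqNgt /r; case/negP.
  apply: (@leq_trans ((j %/ n).+1 * (sumn (dual_rank C)).+1)).
    by rewrite mulSn addnC addSn ltnS leq_add2r.
  by apply: leq_trans (leq_addr _ _); rewrite leq_mul2r gt_ij orbT.
- rewrite /r eq_ij leq_add2l subrr; apply: pair0.
  apply: contraNneq neq_ij => eq_mod; apply/eqP/val_inj.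
  by rewrite /= (divn_eq i n) (divn_eq j n) eq_ij eq_mod.
Qed.

Lemma canonical_of_certificate : canonical_trace tau.
Proof.
split; [|exact: tau_specialise|exact: tau_star_trace].
exists b; split; [exact: hB| |exact: tau_gram_unit].
apply/matrixP => i j; rewrite [LHS]mxE [LHS]mxE [RHS]mxE; exact: tau_mulC.
Qed.

End Canonical.

(** * Certificate data *)

Local Open Scope nat_scope.

(** The natural exponents belong to e_1 and e_2 of the indeterminates, the integer one to the unit
    e_3. The other groups follow the same scheme, class after class: all elementary symmetric
    functions but the last come with natural exponents, the last one with an integer exponent. *)
Definition c4_one : mono := ([:: 0; 0], [:: 0]%Z).

(** A deduction uses a single relator, so the consequences of the braid relation for inverse letters
    are listed next to it. *)
Definition c4_rels : seq relator :=
  inverse_rels c4_one 0 ++ inverse_rels c4_one 2 ++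
  [:: cubic_rel c4_one ([:: 1; 0], [:: 0]%Z) ([:: 0; 1], [:: 0]%Z) ([:: 0; 0], [::
        1]%Z) 0;
      cubic_rel c4_one ([:: 1; 0], [:: 0]%Z) ([:: 0; 1], [:: 0]%Z) ([:: 0; 0], [::
        1]%Z) 2;
      word_rel c4_one [:: 0; 2; 0] 0%Z [:: 2; 0; 2];
      word_rel c4_one [:: 2; 0; 3] 0%Z [:: 1; 2; 0];
      word_rel c4_one [:: 2; 1; 3] 0%Z [:: 1; 3; 0];
      word_rel c4_one [:: 3; 0; 2] 0%Z [:: 0; 2; 1];
      word_rel c4_one [:: 3; 1; 2] 0%Z [:: 0; 3; 1];
      word_rel c4_one [:: 1; 3; 1] 0%Z [:: 3; 1; 3]].

(** As [solve] accepts a single unknown, one command of [tau_cmds] takes the combination z s^2 - e_1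
    z s, which is e_3 z s^-1 - e_2 z by the cubic relation. The second half of [dual] is the first
    half preceded by [s t s s t s], that is by z, with ranks raised by 8. *)
Definition c4_cert := {|
  spanning :=
    [:: [::]; [:: 0]; [:: 0; 0]; [:: 2]; [:: 2; 0]; [:: 2; 0; 0]; [:: 2; 2];
    [:: 2; 2; 0]; [:: 2; 2; 0; 0]; [:: 0; 2]; [:: 0; 2; 0]; [:: 0; 2; 0; 0];
    [:: 0; 2; 2]; [:: 0; 2; 2; 0]; [:: 0; 2; 2; 0; 0]; [:: 0; 0; 2];
    [:: 0; 0; 2; 0]; [:: 0; 0; 2; 0; 0]; [:: 0; 0; 2; 2]; [:: 0; 0; 2; 2; 0];
    [:: 0; 0; 2; 2; 0; 0]; [:: 2; 0; 0; 2]; [:: 2; 0; 0; 2; 0];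
    [:: 2; 0; 0; 2; 0; 0]];
  relators := c4_rels;
  deductions :=
    [:: (Def 1, (0, 0)); (Def 2, (0, 1)); (Def 3, (2, 0)); (Def 4, (2, 1)); (Def 5,
    (2, 2)); (Def 6, (2, 3)); (Def 7, (2, 4)); (Def 8, (2, 5)); (Def 9, (0, 3));
    (Def 10, (0, 4)); (Def 11, (0, 5)); (Def 12, (0, 6)); (Def 13, (0, 7)); (Def 14,
    (0, 8)); (Def 15, (0, 9)); (Def 16, (0, 10)); (Def 17, (0, 11)); (Def 18,
    (0, 12)); (Def 19, (0, 13)); (Def 20, (0, 14)); (Def 21, (2, 15)); (Def 22,
    (2, 16)); (Def 23, (2, 17)); (Rel 1 0, (1, 1)); (Rel 3 0, (3, 3)); (Rel 4 0,
    (1, 0)); (Rel 5 0, (3, 0)); (Rel 6 0, (2, 9)); (Rel 9 0, (3, 9)); (Rel 1 1,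
    (1, 2)); (Rel 3 1, (3, 4)); (Rel 4 1, (0, 2)); (Rel 5 1, (3, 1)); (Rel 6 1,
    (2, 10)); (Rel 9 1, (3, 10)); (Rel 3 2, (3, 5)); (Rel 5 2, (3, 2)); (Rel 6 2,
    (2, 11)); (Rel 9 2, (3, 11)); (Rel 1 3, (1, 9)); (Rel 3 3, (3, 6)); (Rel 4 3,
    (1, 3)); (Rel 5 3, (2, 6)); (Rel 6 3, (2, 12)); (Rel 7 3, (1, 10)); (Rel 8 3,
    (1, 11)); (Rel 3 4, (3, 7)); (Rel 4 4, (1, 4)); (Rel 5 4, (2, 7)); (Rel 6 4,
    (2, 13)); (Rel 3 5, (3, 8)); (Rel 4 5, (1, 5)); (Rel 5 5, (2, 8)); (Rel 6 5,
    (2, 14)); (Rel 1 6, (1, 12)); (Rel 4 6, (1, 6)); (Rel 6 6, (0, 16)); (Rel 7 6,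
    (1, 16)); (Rel 1 7, (1, 13)); (Rel 4 7, (1, 7)); (Rel 6 7, (0, 17)); (Rel 7 7,
    (1, 17)); (Rel 1 8, (1, 14)); (Rel 4 8, (1, 8)); (Rel 6 8, (0, 15)); (Rel 7 8,
    (1, 15)); (Rel 6 9, (0, 21)); (Rel 7 9, (1, 21)); (Rel 9 9, (3, 16)); (Rel 6 10,
    (0, 22)); (Rel 7 10, (1, 22)); (Rel 9 10, (3, 17)); (Rel 6 11, (0, 23)); (Rel 7
    11, (1, 23)); (Rel 9 11, (3, 15)); (Rel 1 12, (1, 18)); (Rel 4 12, (0, 18));
    (Rel 5 12, (3, 12)); (Rel 11 12, (3, 21)); (Rel 1 13, (1, 19)); (Rel 4 13,
    (0, 19)); (Rel 5 13, (3, 13)); (Rel 11 13, (3, 22)); (Rel 1 14, (1, 20)); (Rel 4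
    14, (0, 20)); (Rel 6 15, (2, 22)); (Rel 10 15, (3, 23)); (Rel 6 16, (2, 23));
    (Rel 8 0, (2, 18)); (Rel 5 15, (2, 21)); (Rel 8 1, (2, 19)); (Rel 11 1,
    (3, 19)); (Rel 9 5, (3, 14)); (Rel 11 0, (3, 18)); (Rel 11 2, (3, 20)); (Rel 8
    2, (2, 20))];
  row_cmds := [::];
  basis :=
    [:: (0%Z, [::]); (0%Z, [:: 0]); (0%Z, [:: 0; 0]); (0%Z, [:: 0; 2; 0; 2; 0; 2]);
    (0%Z, [:: 0; 2; 0; 2; 0; 2; 0]); (0%Z, [:: 0; 2; 0; 2; 0; 2; 0; 0]);
    (0%Z, [:: 2]); (0%Z, [:: 2; 0]); (0%Z, [:: 2; 0; 0]); (0%Z, [:: 2; 2]);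
    (0%Z, [:: 2; 2; 0]); (0%Z, [:: 2; 2; 0; 0]); (0%Z, [:: 0; 2]);
    (0%Z, [:: 0; 2; 0]); (0%Z, [:: 0; 2; 0; 0]); (0%Z, [:: 0; 2; 2]);
    (0%Z, [:: 0; 2; 2; 0]); (0%Z, [:: 0; 2; 2; 0; 0]); (0%Z, [:: 0; 0; 2]);
    (0%Z, [:: 0; 0; 2; 0]); (0%Z, [:: 0; 0; 2; 0; 0]); (0%Z, [:: 0; 0; 2; 2]);
    (0%Z, [:: 0; 0; 2; 2; 0]); (0%Z, [:: 0; 0; 2; 2; 0; 0])];
  tau_cmds :=
    [seq basis_trace c4_one j | j <- [:: 23; 22; 21; 20; 19; 18; 17; 16; 15; 14; 13;
    12; 11; 10; 9; 8; 7; 6; 3; 2; 1; 0]] ++ [:: TauBasis [:: (c4_one, 1%Z, 5);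
    (([:: 1; 0], [:: 0]%Z), (-1)%Z, 4)]] ++ [seq basis_trace c4_one j | j <- [:: 4]];
  gens := [:: 0; 2];
  window := 1;
  pi_exp := 0%Z;
  pi_word := [:: 0; 2; 0; 2; 0; 2; 0; 2; 0; 2; 0; 2];
  dual :=
    [:: [::]; [:: 0]; [:: 1]; [:: 2]; [:: 2; 0]; [:: 2; 1]; [:: 0; 2]; [:: 0; 2; 0];
    [:: 0; 2; 1]; [:: 1; 2]; [:: 1; 2; 0]; [:: 1; 2; 1]; [:: 0; 2; 0; 0; 2; 0];
    [:: 0; 2; 0; 0; 2; 0; 0]; [:: 0; 2; 0; 0; 2; 0; 1]; [:: 0; 2; 0; 0; 2; 0; 2];
    [:: 0; 2; 0; 0; 2; 0; 2; 0]; [:: 0; 2; 0; 0; 2; 0; 2; 1];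
    [:: 0; 2; 0; 0; 2; 0; 0; 2]; [:: 0; 2; 0; 0; 2; 0; 0; 2; 0];
    [:: 0; 2; 0; 0; 2; 0; 0; 2; 1]; [:: 0; 2; 0; 0; 2; 0; 1; 2];
    [:: 0; 2; 0; 0; 2; 0; 1; 2; 0]; [:: 0; 2; 0; 0; 2; 0; 1; 2; 1]];
  dual_rank :=
    [:: 1; 2; 0; 5; 6; 4; 6; 7; 5; 4; 5; 3; 9; 10; 8; 13; 14; 12; 14; 15; 13; 12;
    13; 11] |}.

Lemma c4_check : check c4_one c4_cert.
Proof. by vm_compute. Qed.

Definition c5_one : mono := ([:: 0; 0; 0; 0], [:: 0; 0]%Z).

(** The last two relators say z = stst and z = tsts, which together give the braid relation; they
    are cut in the middle so that both sides are short words. G_6 is treated alike. *)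
Definition c5_rels : seq relator :=
  inverse_rels c5_one 0 ++ inverse_rels c5_one 2 ++
  [:: cubic_rel c5_one ([:: 1; 0; 0; 0], [:: 0; 0]%Z) ([:: 0; 1; 0; 0], [:: 0; 0]%Z)
        ([:: 0; 0; 0; 0], [:: 1; 0]%Z) 0;
      cubic_rel c5_one ([:: 0; 0; 1; 0], [:: 0; 0]%Z) ([:: 0; 0; 0; 1], [:: 0; 0]%Z)
        ([:: 0; 0; 0; 0], [:: 0; 1]%Z) 2;
      word_rel c5_one [:: 0; 2] 1%Z [:: 3; 1];
      word_rel c5_one [:: 2; 0] 1%Z [:: 1; 3]].

Definition c5_cert := {|
  spanning :=
    [:: [::]; [:: 0]; [:: 1]; [:: 2]; [:: 3]; [:: 0; 2]; [:: 0; 3]; [:: 1; 2];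
    [:: 1; 3]; [:: 3; 0]; [:: 3; 0; 2]; [:: 3; 0; 3]];
  relators := c5_rels;
  deductions :=
    [:: (Def 1, (0, 0)); (Def 2, (1, 0)); (Def 3, (2, 0)); (Def 4, (3, 0)); (Def 5,
    (0, 3)); (Def 6, (0, 4)); (Def 7, (1, 3)); (Def 8, (1, 4)); (Def 9, (3, 1));
    (Def 10, (3, 5)); (Def 11, (3, 6)); (Rel 0 0, (0, 2)); (Rel 1 0, (1, 1)); (Rel 2
    0, (2, 4)); (Rel 3 0, (3, 3)); (Rel 4 0, (0, 1)); (Rel 5 0, (2, 3)); (Rel 6 0,
    (3, 2)); (Rel 7 0, (2, 1)); (Rel 1 1, (1, 2)); (Rel 2 1, (2, 9)); (Rel 3 1,
    (3, 8)); (Rel 5 1, (2, 8)); (Rel 6 1, (0, 8)); (Rel 2 2, (2, 5)); (Rel 7 2,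
    (1, 5)); (Rel 0 3, (0, 7)); (Rel 3 3, (3, 4)); (Rel 4 3, (0, 5)); (Rel 6 3,
    (3, 7)); (Rel 1 4, (1, 6)); (Rel 4 4, (0, 6)); (Rel 7 4, (2, 6)); (Rel 1 5,
    (1, 7)); (Rel 2 5, (2, 10)); (Rel 5 5, (2, 2)); (Rel 1 6, (1, 8)); (Rel 2 6,
    (2, 11)); (Rel 3 8, (3, 9)); (Rel 5 10, (3, 10)); (Rel 7 1, (1, 9)); (Rel 5 11,
    (3, 11)); (Rel 6 2, (0, 10)); (Rel 5 6, (2, 7)); (Rel 7 6, (1, 11)); (Rel 6 8,
    (0, 9)); (Rel 7 5, (1, 10)); (Rel 6 7, (0, 11))];
  row_cmds :=
    [:: RowCmd [::] 4 10 [::] ((-2)%Z, 11); RowCmd [::] 4 10 [::] (4%Z, 11); RowCmd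
    [::] 4 9 [::] ((-2)%Z, 10); RowCmd [:: 3] 4 10 [::] (5%Z, 7); RowCmd [:: 3] 4 10
    [::] ((-1)%Z, 7); RowCmd [:: 0; 2] 4 10 [::] (4%Z, 8); RowCmd [:: 2] 4 10 [::
    (0, 0%Z)] ((-2)%Z, 6); RowCmd [:: 1] 4 10 [::] (2%Z, 9); RowCmd [:: 3] 4 9 [::]
    ((-1)%Z, 2); RowCmd [:: 0; 2; 1] 4 10 [::] (2%Z, 2); RowCmd [:: 1] 4 10 [:: (0,
    (-2)%Z); (2, (-2)%Z)] ((-4)%Z, 9); RowCmd [:: 2] 4 9 [:: (3, (-1)%Z)] (4%Z, 5);
    RowCmd [:: 2] 4 9 [:: (2, 0%Z)] ((-2)%Z, 5); RowCmd [:: 2] 4 10 [:: (5, 0%Z)]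
    (4%Z, 6); RowCmd [:: 2] 4 11 [:: (10, 2%Z)] ((-2)%Z, 1); RowCmd [::] 4 9 [::
    (1, 0%Z); (7, 2%Z)] (4%Z, 10); RowCmd [:: 1; 2] 4 10 [:: (0, (-2)%Z); (2,
    (-2)%Z); (10, 0%Z); (0, (-1)%Z); (2, 0%Z); (10, 2%Z)] ((-2)%Z, 4); RowCmd
    [:: 0; 3] 4 10 [:: (1, 2%Z); (7, 4%Z); (15, 2%Z); (1, 1%Z)] (5%Z, 3); RowCmd
    [:: 1; 2] 4 9 [:: (0, (-2)%Z); (2, (-1)%Z); (0, 0%Z); (2, 0%Z)] ((-2)%Z, 3);
    RowCmd [:: 0; 0; 2] 4 10 [:: (1, 1%Z); (7, 2%Z)] (4%Z, 4); RowCmd [:: 0; 2; 2] 4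
    9 [:: (4, (-1)%Z); (8, 0%Z); (14, 1%Z)] ((-1)%Z, 0); RowCmd [:: 3; 0; 2] 4 10
    [:: (5, 0%Z); (7, 1%Z); (9, 1%Z)] (3%Z, 1); RowCmd [:: 0; 2] 4 10 [:: (4,
    (-1)%Z); (6, 0%Z); (8, (-1)%Z); (12, 0%Z); (14, 0%Z); (16, 0%Z); (18, 0%Z); (20,
    (-1)%Z)] ((-2)%Z, 8); RowCmd [:: 0; 3] 4 9 [:: (1, 2%Z); (7, 4%Z); (15, 2%Z);
    (1, 1%Z); (7, 3%Z); (15, 1%Z); (17, 0%Z); (19, 1%Z)] (5%Z, 0)];
  basis :=
    [:: (0%Z, [::]); (0%Z, [:: 0]); (0%Z, [:: 0; 0]); (0%Z, [:: 2]);
    (0%Z, [:: 2; 2]); (0%Z, [:: 0; 2]); (0%Z, [:: 0; 0; 2]); (0%Z, [:: 0; 2; 2]);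
    (0%Z, [:: 0; 0; 2; 2]); (0%Z, [:: 3; 0]); (0%Z, [:: 3; 0; 2]);
    (0%Z, [:: 3; 0; 2; 2]); (1%Z, [::]); (1%Z, [:: 0]); (1%Z, [:: 0; 0]);
    (1%Z, [:: 2]); (1%Z, [:: 2; 2]); (1%Z, [:: 0; 2]); (1%Z, [:: 0; 0; 2]);
    (1%Z, [:: 0; 2; 2]); (1%Z, [:: 0; 0; 2; 2]); (1%Z, [:: 3; 0]);
    (1%Z, [:: 3; 0; 2]); (1%Z, [:: 3; 0; 2; 2]); (2%Z, [::]); (2%Z, [:: 0]);
    (2%Z, [:: 0; 0]); (2%Z, [:: 2]); (2%Z, [:: 2; 2]); (2%Z, [:: 0; 2]);
    (2%Z, [:: 0; 0; 2]); (2%Z, [:: 0; 2; 2]); (2%Z, [:: 0; 0; 2; 2]);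
    (2%Z, [:: 3; 0]); (2%Z, [:: 3; 0; 2]); (2%Z, [:: 3; 0; 2; 2]); (3%Z, [::]);
    (3%Z, [:: 0]); (3%Z, [:: 0; 0]); (3%Z, [:: 2]); (3%Z, [:: 2; 2]);
    (3%Z, [:: 0; 2]); (3%Z, [:: 0; 0; 2]); (3%Z, [:: 0; 2; 2]);
    (3%Z, [:: 0; 0; 2; 2]); (3%Z, [:: 3; 0]); (3%Z, [:: 3; 0; 2]);
    (3%Z, [:: 3; 0; 2; 2]); (4%Z, [::]); (4%Z, [:: 0]); (4%Z, [:: 0; 0]);
    (4%Z, [:: 2]); (4%Z, [:: 2; 2]); (4%Z, [:: 0; 2]); (4%Z, [:: 0; 0; 2]);
    (4%Z, [:: 0; 2; 2]); (4%Z, [:: 0; 0; 2; 2]); (4%Z, [:: 3; 0]);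
    (4%Z, [:: 3; 0; 2]); (4%Z, [:: 3; 0; 2; 2]); (5%Z, [::]); (5%Z, [:: 0]);
    (5%Z, [:: 0; 0]); (5%Z, [:: 2]); (5%Z, [:: 2; 2]); (5%Z, [:: 0; 2]);
    (5%Z, [:: 0; 0; 2]); (5%Z, [:: 0; 2; 2]); (5%Z, [:: 0; 0; 2; 2]);
    (5%Z, [:: 3; 0]); (5%Z, [:: 3; 0; 2]); (5%Z, [:: 3; 0; 2; 2])];
  tau_cmds :=
    [seq basis_trace c5_one j | j <- [:: 70; 69; 65; 63; 61; 60; 58; 57; 53; 51; 49;
    48; 46; 45; 41; 39; 37; 36; 34; 33; 29; 27; 25; 24; 22; 21; 17; 15; 13; 12; 10;
    9; 5; 3; 1; 0; 71; 67; 66; 64; 62; 59; 55; 54; 52; 50; 47; 43; 42; 40; 38; 35;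
    31; 30; 28; 26; 23; 19; 18; 16; 14; 11; 7; 6; 4; 2; 68; 56; 44; 32; 20; 8]] ++
    [seq TauRow p.1 p.2 | p <- [:: (23, 1%Z); (21, 3%Z); (19, 2%Z); (17, 1%Z);
    (15, 2%Z); (13, 2%Z); (11, 2%Z); (9, 4%Z); (7, 4%Z); (5, 2%Z); (3, 1%Z);
    (1, 2%Z); (23, 2%Z); (21, 4%Z); (19, 3%Z); (17, 2%Z); (15, 3%Z); (13, 3%Z);
    (11, 3%Z); (9, 5%Z); (7, 5%Z); (5, 3%Z); (3, 2%Z); (1, 3%Z); (9, 6%Z); (5, 4%Z);
    (3, 3%Z); (22, 1%Z); (20, 0%Z); (18, 1%Z); (16, 1%Z); (14, 1%Z); (12, 1%Z);
    (10, 3%Z); (8, 0%Z); (6, 1%Z); (4, 0%Z); (2, 1%Z); (0, 1%Z); (22, 0%Z); (20,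
    (-1)%Z); (18, 0%Z); (16, 0%Z); (14, 0%Z); (12, 0%Z); (10, 2%Z); (8, (-1)%Z);
    (6, 0%Z); (4, (-1)%Z); (2, 0%Z); (0, 0%Z); (14, (-1)%Z); (12, (-1)%Z);
    (10, 1%Z); (6, (-1)%Z); (2, (-1)%Z); (0, (-1)%Z)]];
  gens := [:: 0; 2];
  window := 6;
  pi_exp := 6%Z;
  pi_word := [::];
  dual :=
    [:: [::]; [:: 0]; [:: 1]; [:: 2]; [:: 3]; [:: 0; 2]; [:: 0; 3]; [:: 1; 2];
    [:: 1; 3]; [:: 3; 0]; [:: 3; 0; 2]; [:: 3; 0; 3]];
  dual_rank := [:: 2; 6; 1; 3; 1; 7; 5; 2; 0; 5; 6; 4] |}.

Lemma c5_check : check c5_one c5_cert.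
Proof. by vm_compute. Qed.

Definition c6_one : mono := ([:: 0; 0; 0], [:: 0; 0]%Z).

Definition c6_rels : seq relator :=
  inverse_rels c6_one 0 ++ inverse_rels c6_one 2 ++
  [:: quadratic_rel c6_one ([:: 1; 0; 0], [:: 0; 0]%Z) ([:: 0; 0; 0], [:: 1; 0]%Z)
        0%Z [:: 0];
      cubic_rel c6_one ([:: 0; 1; 0], [:: 0; 0]%Z) ([:: 0; 0; 1], [:: 0; 0]%Z) ([::
        0; 0; 0], [:: 0; 1]%Z) 2;
      word_rel c6_one [:: 0; 2; 0] 1%Z [:: 3; 1; 3];
      word_rel c6_one [:: 2; 0; 2] 1%Z [:: 1; 3; 1]].

Definition c6_cert := {|
  spanning :=
    [:: [::]; [:: 2]; [:: 3]; [:: 0]; [:: 0; 2]; [:: 0; 3]; [:: 2; 0]; [:: 2; 0; 2];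
    [:: 2; 0; 3]; [:: 3; 0]; [:: 3; 0; 2]; [:: 3; 0; 3]];
  relators := c6_rels;
  deductions :=
    [:: (Def 1, (2, 0)); (Def 2, (3, 0)); (Def 3, (0, 0)); (Def 4, (0, 1)); (Def 5,
    (0, 2)); (Def 6, (2, 3)); (Def 7, (2, 4)); (Def 8, (2, 5)); (Def 9, (3, 3));
    (Def 10, (3, 4)); (Def 11, (3, 5)); (Rel 1 0, (1, 3)); (Rel 2 0, (2, 2)); (Rel 3
    0, (3, 1)); (Rel 4 0, (1, 0)); (Rel 5 0, (2, 1)); (Rel 1 1, (1, 4)); (Rel 3 1,
    (3, 2)); (Rel 4 1, (1, 1)); (Rel 6 1, (0, 7)); (Rel 1 2, (1, 5)); (Rel 4 2,
    (1, 2)); (Rel 2 3, (2, 9)); (Rel 3 3, (3, 6)); (Rel 4 3, (0, 3)); (Rel 5 3,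
    (2, 6)); (Rel 2 4, (2, 10)); (Rel 3 4, (3, 7)); (Rel 4 4, (0, 4)); (Rel 5 4,
    (2, 7)); (Rel 2 5, (2, 11)); (Rel 3 5, (3, 8)); (Rel 4 5, (0, 5)); (Rel 5 5,
    (2, 8)); (Rel 3 6, (3, 9)); (Rel 1 7, (1, 9)); (Rel 3 7, (3, 10)); (Rel 4 7,
    (1, 7)); (Rel 3 8, (3, 11)); (Rel 6 0, (0, 6)); (Rel 0 7, (0, 9)); (Rel 7 1,
    (1, 10)); (Rel 4 6, (1, 6)); (Rel 4 10, (0, 10)); (Rel 7 2, (1, 11)); (Rel 6 2,
    (0, 8)); (Rel 0 6, (0, 11)); (Rel 4 8, (1, 8))];
  row_cmds :=
    [:: RowCmd [::] 7 6 [::] ((-1)%Z, 10); RowCmd [::] 7 6 [::] (3%Z, 10); RowCmd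
    [::] 6 9 [::] ((-2)%Z, 8); RowCmd [::] 6 9 [::] (2%Z, 8); RowCmd [::] 6 11 [::]
    ((-2)%Z, 7); RowCmd [::] 7 7 [::] (3%Z, 11); RowCmd [::] 7 8 [::] ((-1)%Z, 9);
    RowCmd [::] 6 10 [::] (2%Z, 6); RowCmd [:: 3] 6 9 [::] ((-2)%Z, 5); RowCmd
    [:: 2] 7 6 [::] (3%Z, 4); RowCmd [::] 7 8 [:: (1, 0%Z); (5, 0%Z)] (3%Z, 9);
    RowCmd [::] 6 10 [:: (2, 0%Z); (4, 0%Z)] ((-2)%Z, 6); RowCmd [:: 3] 6 9 [::
    (3, 0%Z); (5, (-1)%Z)] (2%Z, 5); RowCmd [:: 2] 7 6 [:: (0, 0%Z); (4, 1%Z)]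
    ((-1)%Z, 4); RowCmd [:: 0; 3] 6 9 [:: (1, 0%Z); (3, 0%Z); (10, (-1)%Z)]
    (2%Z, 2); RowCmd [:: 2] 7 8 [:: (9, 0%Z); (12, 1%Z)] (3%Z, 3); RowCmd [:: 2] 7 8
    [:: (6, 0%Z); (11, 1%Z)] ((-1)%Z, 3); RowCmd [:: 1; 3] 6 11 [:: (1, 0%Z);
    (5, 0%Z); (10, 0%Z); (1, (-1)%Z); (5, (-1)%Z); (9, (-1)%Z); (14, 0%Z)] (2%Z, 1);
    RowCmd [:: 1; 3] 6 10 [:: (5, 0%Z); (1, (-1)%Z); (5, (-1)%Z); (15, (-1)%Z)]
    (2%Z, 0); RowCmd [::] 7 7 [:: (0, 0%Z); (2, 1%Z); (4, 1%Z); (6, 0%Z); (8, 1%Z);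
    (11, 1%Z); (13, 0%Z); (16, 0%Z)] ((-1)%Z, 11); RowCmd [::] 6 11 [:: (1, (-1)%Z);
    (3, 0%Z); (5, (-1)%Z); (7, 0%Z); (9, (-1)%Z); (10, (-1)%Z); (12, 0%Z);
    (14, 0%Z); (15, (-1)%Z); (17, 0%Z); (18, 0%Z)] (2%Z, 7)];
  basis :=
    [:: (0%Z, [::]); (0%Z, [:: 2]); (0%Z, [:: 2; 2]); (0%Z, [:: 0]);
    (0%Z, [:: 0; 2]); (0%Z, [:: 0; 2; 2]); (0%Z, [:: 2; 0]); (0%Z, [:: 2; 2; 0]);
    (0%Z, [:: 2; 0; 2]); (0%Z, [:: 2; 0; 2; 2]); (0%Z, [:: 2; 2; 0; 2]);
    (0%Z, [:: 2; 2; 0; 2; 2]); (1%Z, [::]); (1%Z, [:: 2]); (1%Z, [:: 2; 2]);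
    (1%Z, [:: 0]); (1%Z, [:: 0; 2]); (1%Z, [:: 0; 2; 2]); (1%Z, [:: 2; 0]);
    (1%Z, [:: 2; 2; 0]); (1%Z, [:: 2; 0; 2]); (1%Z, [:: 2; 0; 2; 2]);
    (1%Z, [:: 2; 2; 0; 2]); (1%Z, [:: 2; 2; 0; 2; 2]); (2%Z, [::]); (2%Z, [:: 2]);
    (2%Z, [:: 2; 2]); (2%Z, [:: 0]); (2%Z, [:: 0; 2]); (2%Z, [:: 0; 2; 2]);
    (2%Z, [:: 2; 0]); (2%Z, [:: 2; 2; 0]); (2%Z, [:: 2; 0; 2]);
    (2%Z, [:: 2; 0; 2; 2]); (2%Z, [:: 2; 2; 0; 2]); (2%Z, [:: 2; 2; 0; 2; 2]);
    (3%Z, [::]); (3%Z, [:: 2]); (3%Z, [:: 2; 2]); (3%Z, [:: 0]); (3%Z, [:: 0; 2]);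
    (3%Z, [:: 0; 2; 2]); (3%Z, [:: 2; 0]); (3%Z, [:: 2; 2; 0]); (3%Z, [:: 2; 0; 2]);
    (3%Z, [:: 2; 0; 2; 2]); (3%Z, [:: 2; 2; 0; 2]); (3%Z, [:: 2; 2; 0; 2; 2])];
  tau_cmds :=
    [seq basis_trace c6_one j | j <- [:: 44; 42; 40; 39; 37; 36; 32; 30; 28; 27; 25;
    24; 20; 18; 16; 15; 13; 12; 8; 6; 4; 3; 1; 0; 46; 43; 45; 41; 38; 34; 31; 33;
    29; 26; 22; 19; 21; 17; 14; 10; 7; 9; 5; 2; 47; 35; 23; 11]] ++ [seq TauRow p.1
    p.2 | p <- [:: (20, 2%Z); (18, 2%Z); (17, 2%Z); (15, 1%Z); (14, 2%Z); (12, 2%Z);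
    (10, 1%Z); (9, 1%Z); (7, 2%Z); (5, 1%Z); (3, 2%Z); (1, 1%Z); (19, 0%Z);
    (16, 0%Z); (13, 0%Z); (11, 1%Z); (8, 1%Z); (6, 0%Z); (4, 1%Z); (2, 1%Z);
    (0, 0%Z)]];
  gens := [:: 0; 2];
  window := 4;
  pi_exp := 4%Z;
  pi_word := [::];
  dual :=
    [:: [::]; [:: 2]; [:: 3]; [:: 0]; [:: 0; 2]; [:: 0; 3]; [:: 2; 0]; [:: 2; 0; 2];
    [:: 2; 0; 3]; [:: 3; 0]; [:: 3; 0; 2]; [:: 3; 0; 3]];
  dual_rank := [:: 1; 2; 0; 5; 6; 4; 6; 7; 5; 4; 5; 3] |}.

Lemma c6_check : check c6_one c6_cert.
Proof. by vm_compute. Qed.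

Definition c7_one : mono := ([:: 0; 0; 0; 0; 0], [:: 0; 0; 0]%Z).

(** The braid relations amount to the centrality of z = stu, which vectors have built in. Hence s is
    eliminated as z u^-1 t^-1, and its quadratic relation is stated for this element and for the
    conjugate u s u^-1 = z t^-1 u^-1. *)
Definition c7_rels : seq relator :=
  inverse_rels c7_one 2 ++ inverse_rels c7_one 4 ++
  [:: cubic_rel c7_one ([:: 0; 1; 0; 0; 0], [:: 0; 0; 0]%Z) ([:: 0; 0; 1; 0; 0], [::
        0; 0; 0]%Z) ([:: 0; 0; 0; 0; 0], [:: 0; 1; 0]%Z) 2;
      cubic_rel c7_one ([:: 0; 0; 0; 1; 0], [:: 0; 0; 0]%Z) ([:: 0; 0; 0; 0; 1], [::
        0; 0; 0]%Z) ([:: 0; 0; 0; 0; 0], [:: 0; 0; 1]%Z) 4;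
      quadratic_rel c7_one ([:: 1; 0; 0; 0; 0], [:: 0; 0; 0]%Z) ([:: 0; 0; 0; 0; 0],
        [:: 1; 0; 0]%Z) 1%Z [:: 5; 3];
      quadratic_rel c7_one ([:: 1; 0; 0; 0; 0], [:: 0; 0; 0]%Z) ([:: 0; 0; 0; 0; 0],
        [:: 1; 0; 0]%Z) 1%Z [:: 3; 5]].

Definition c7_cert := {|
  spanning :=
    [:: [::]; [:: 4]; [:: 5]; [:: 2]; [:: 3]; [:: 4; 2]; [:: 4; 3]; [:: 5; 2];
    [:: 5; 3]; [:: 2; 5]; [:: 2; 5; 2]; [:: 2; 5; 3]];
  relators := c7_rels;
  deductions :=
    [:: (Def 1, (4, 0)); (Def 2, (5, 0)); (Def 3, (2, 0)); (Def 4, (3, 0)); (Def 5,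
    (4, 3)); (Def 6, (4, 4)); (Def 7, (5, 3)); (Def 8, (5, 4)); (Def 9, (2, 2));
    (Def 10, (2, 7)); (Def 11, (2, 8)); (Rel 0 0, (2, 4)); (Rel 1 0, (3, 3)); (Rel 2
    0, (4, 2)); (Rel 3 0, (5, 1)); (Rel 4 0, (2, 3)); (Rel 5 0, (4, 1)); (Rel 6 0,
    (2, 1)); (Rel 7 0, (3, 2)); (Rel 1 1, (3, 8)); (Rel 3 1, (5, 2)); (Rel 7 1,
    (4, 8)); (Rel 0 2, (2, 5)); (Rel 1 2, (3, 9)); (Rel 6 2, (5, 5)); (Rel 1 3,
    (3, 4)); (Rel 2 3, (4, 7)); (Rel 5 3, (4, 5)); (Rel 3 4, (5, 6)); (Rel 5 4,
    (4, 6)); (Rel 3 5, (5, 7)); (Rel 3 6, (5, 8)); (Rel 1 7, (3, 10)); (Rel 1 8,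
    (3, 11)); (Rel 4 2, (2, 9)); (Rel 7 3, (3, 7)); (Rel 6 4, (2, 6)); (Rel 4 8,
    (2, 11)); (Rel 4 1, (3, 1)); (Rel 4 5, (3, 5)); (Rel 4 7, (2, 10)); (Rel 7 2,
    (4, 9)); (Rel 4 6, (3, 6)); (Rel 6 1, (5, 11)); (Rel 7 7, (4, 10)); (Rel 6 5,
    (5, 9)); (Rel 7 8, (4, 11)); (Rel 6 6, (5, 10))];
  row_cmds :=
    [:: RowCmd [::] 5 9 [::] ((-4)%Z, 10); RowCmd [::] 5 9 [::] (8%Z, 10); RowCmd
    [:: 2] 5 9 [::] ((-6)%Z, 6); RowCmd [::] 5 10 [::] (8%Z, 11); RowCmd [:: 2] 5 11
    [::] ((-6)%Z, 5); RowCmd [:: 2] 5 9 [::] (6%Z, 6); RowCmd [::] 5 11 [::]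
    ((-4)%Z, 9); RowCmd [:: 3] 5 9 [:: (1, 0%Z)] (8%Z, 7); RowCmd [:: 2] 5 10 [::
    (2, 0%Z); (4, 0%Z)] ((-6)%Z, 1); RowCmd [:: 2] 5 10 [::] (6%Z, 1); RowCmd [:: 3]
    5 10 [:: (2, 2%Z)] ((-4)%Z, 8); RowCmd [::] 5 11 [:: (1, 0%Z); (3, 0%Z)]
    (8%Z, 9); RowCmd [::] 5 10 [:: (0, 0%Z); (6, 0%Z)] ((-4)%Z, 11); RowCmd [:: 3] 5
    10 [:: (3, 0%Z)] (8%Z, 8); RowCmd [:: 3] 5 9 [:: (4, 2%Z)] ((-4)%Z, 7); RowCmd
    [:: 3; 5] 5 10 [:: (11, (-4)%Z)] (4%Z, 2); RowCmd [:: 5; 2] 5 9 [:: (0, (-4)%Z);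
    (6, (-4)%Z); (12, (-4)%Z); (0, (-2)%Z)] ((-6)%Z, 4); RowCmd [:: 4; 3] 5 9 [::
    (1, 4%Z); (3, 4%Z); (11, 4%Z); (1, 2%Z); (1, 1%Z); (3, 1%Z); (3, 0%Z);
    (11, 0%Z)] (8%Z, 3); RowCmd [:: 5; 2] 5 11 [:: (0, (-4)%Z); (6, (-2)%Z)]
    ((-6)%Z, 3); RowCmd [:: 4; 3] 5 10 [:: (1, 4%Z); (3, 2%Z); (3, 1%Z); (11, 1%Z);
    (1, 0%Z); (3, 0%Z)] (8%Z, 4); RowCmd [:: 2; 2] 5 11 [:: (4, 0%Z); (6, 0%Z);
    (8, 2%Z)] ((-4)%Z, 2); RowCmd [:: 5; 3; 3] 5 10 [:: (5, 2%Z); (3, (-1)%Z);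
    (9, 0%Z); (15, 2%Z)] (6%Z, 0); RowCmd [:: 5; 2; 4] 5 11 [:: (6, 0%Z); (12, 2%Z)]
    ((-2)%Z, 0); RowCmd [:: 2] 5 11 [:: (5, 0%Z); (7, (-2)%Z); (9, 0%Z); (13,
    (-2)%Z); (15, 2%Z); (17, (-2)%Z); (19, (-2)%Z); (21, 0%Z)] (6%Z, 5)];
  basis :=
    [:: (0%Z, [::]); (0%Z, [:: 4]); (0%Z, [:: 4; 4]); (0%Z, [:: 2]);
    (0%Z, [:: 2; 2]); (0%Z, [:: 4; 2]); (0%Z, [:: 4; 4; 2]); (0%Z, [:: 4; 2; 2]);
    (0%Z, [:: 4; 4; 2; 2]); (1%Z, [::]); (1%Z, [:: 4]); (1%Z, [:: 4; 4]);
    (1%Z, [:: 2]); (1%Z, [:: 2; 2]); (1%Z, [:: 4; 2]); (1%Z, [:: 4; 4; 2]);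
    (1%Z, [:: 4; 2; 2]); (1%Z, [:: 4; 4; 2; 2]); (1%Z, [:: 2; 5]);
    (1%Z, [:: 2; 5; 2]); (1%Z, [:: 2; 5; 2; 2]); (2%Z, [::]); (2%Z, [:: 4]);
    (2%Z, [:: 4; 4]); (2%Z, [:: 2]); (2%Z, [:: 2; 2]); (2%Z, [:: 4; 2]);
    (2%Z, [:: 4; 4; 2]); (2%Z, [:: 4; 2; 2]); (2%Z, [:: 4; 4; 2; 2]);
    (2%Z, [:: 2; 5]); (2%Z, [:: 2; 5; 2]); (2%Z, [:: 2; 5; 2; 2]); (3%Z, [::]);
    (3%Z, [:: 4]); (3%Z, [:: 4; 4]); (3%Z, [:: 2]); (3%Z, [:: 2; 2]);
    (3%Z, [:: 4; 2]); (3%Z, [:: 4; 4; 2]); (3%Z, [:: 4; 2; 2]);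
    (3%Z, [:: 4; 4; 2; 2]); (3%Z, [:: 2; 5]); (3%Z, [:: 2; 5; 2]);
    (3%Z, [:: 2; 5; 2; 2]); (4%Z, [::]); (4%Z, [:: 4]); (4%Z, [:: 4; 4]);
    (4%Z, [:: 2]); (4%Z, [:: 2; 2]); (4%Z, [:: 4; 2]); (4%Z, [:: 4; 4; 2]);
    (4%Z, [:: 4; 2; 2]); (4%Z, [:: 4; 4; 2; 2]); (4%Z, [:: 2; 5]);
    (4%Z, [:: 2; 5; 2]); (4%Z, [:: 2; 5; 2; 2]); (5%Z, [::]); (5%Z, [:: 4]);
    (5%Z, [:: 4; 4]); (5%Z, [:: 2]); (5%Z, [:: 2; 2]); (5%Z, [:: 4; 2]);
    (5%Z, [:: 4; 4; 2]); (5%Z, [:: 4; 2; 2]); (5%Z, [:: 4; 4; 2; 2]);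
    (5%Z, [:: 2; 5]); (5%Z, [:: 2; 5; 2]); (5%Z, [:: 2; 5; 2; 2]); (6%Z, [::]);
    (6%Z, [:: 4]); (6%Z, [:: 4; 4]); (6%Z, [:: 2]); (6%Z, [:: 2; 2]);
    (6%Z, [:: 4; 2]); (6%Z, [:: 4; 4; 2]); (6%Z, [:: 4; 2; 2]);
    (6%Z, [:: 4; 4; 2; 2]); (6%Z, [:: 2; 5]); (6%Z, [:: 2; 5; 2]);
    (6%Z, [:: 2; 5; 2; 2]); (7%Z, [::]); (7%Z, [:: 4]); (7%Z, [:: 4; 4]);
    (7%Z, [:: 2]); (7%Z, [:: 2; 2]); (7%Z, [:: 4; 2]); (7%Z, [:: 4; 4; 2]);
    (7%Z, [:: 4; 2; 2]); (7%Z, [:: 4; 4; 2; 2]); (7%Z, [:: 2; 5]);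
    (7%Z, [:: 2; 5; 2]); (7%Z, [:: 2; 5; 2; 2]); (8%Z, [::]); (8%Z, [:: 4]);
    (8%Z, [:: 4; 4]); (8%Z, [:: 2]); (8%Z, [:: 2; 2]); (8%Z, [:: 4; 2]);
    (8%Z, [:: 4; 4; 2]); (8%Z, [:: 4; 2; 2]); (8%Z, [:: 4; 4; 2; 2]);
    (8%Z, [:: 2; 5]); (8%Z, [:: 2; 5; 2]); (8%Z, [:: 2; 5; 2; 2]); (9%Z, [::]);
    (9%Z, [:: 4]); (9%Z, [:: 4; 4]); (9%Z, [:: 2]); (9%Z, [:: 2; 2]);
    (9%Z, [:: 4; 2]); (9%Z, [:: 4; 4; 2]); (9%Z, [:: 4; 2; 2]);
    (9%Z, [:: 4; 4; 2; 2]); (9%Z, [:: 2; 5]); (9%Z, [:: 2; 5; 2]);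
    (9%Z, [:: 2; 5; 2; 2]); (10%Z, [::]); (10%Z, [:: 4]); (10%Z, [:: 4; 4]);
    (10%Z, [:: 2]); (10%Z, [:: 2; 2]); (10%Z, [:: 4; 2]); (10%Z, [:: 4; 4; 2]);
    (10%Z, [:: 4; 2; 2]); (10%Z, [:: 4; 4; 2; 2]); (10%Z, [:: 2; 5]);
    (10%Z, [:: 2; 5; 2]); (10%Z, [:: 2; 5; 2; 2]); (11%Z, [::]); (11%Z, [:: 4]);
    (11%Z, [:: 4; 4]); (11%Z, [:: 2]); (11%Z, [:: 2; 2]); (11%Z, [:: 4; 2]);
    (11%Z, [:: 4; 4; 2]); (11%Z, [:: 4; 2; 2]); (11%Z, [:: 4; 4; 2; 2]);
    (11%Z, [:: 2; 5]); (11%Z, [:: 2; 5; 2]); (11%Z, [:: 2; 5; 2; 2]);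
    (0%Z, [:: 2; 4; 4]); (0%Z, [:: 2; 4; 4; 2]); (0%Z, [:: 2; 4; 4; 2; 2])];
  tau_cmds :=
    [seq basis_trace c7_one j | j <- [:: 139; 138; 134; 132; 130; 129; 127; 126;
    122; 120; 118; 117; 115; 114; 110; 108; 106; 105; 103; 102; 98; 96; 94; 93; 91;
    90; 86; 84; 82; 81; 79; 78; 74; 72; 70; 69; 67; 66; 62; 60; 58; 57; 55; 54; 50;
    48; 46; 45; 43; 42; 38; 36; 34; 33; 31; 30; 26; 24; 22; 21; 19; 18; 14; 12; 10;
    9; 5; 3; 1; 0; 140; 136; 135; 133; 131; 128; 124; 123; 121; 119; 116; 112; 111;
    109; 107; 104; 100; 99; 97; 95; 92; 88; 87; 85; 83; 80; 76; 75; 73; 71; 68; 64;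
    63; 61; 59; 56; 52; 51; 49; 47; 44; 40; 39; 37; 35; 32; 28; 27; 25; 23; 20; 16;
    15; 13; 11; 7; 6; 4; 2; 137; 125; 113; 101; 89; 77; 65; 53; 41; 29; 17; 142;
    141; 8; 143]] ++ [seq TauRow p.1 p.2 | p <- [:: (23, 6%Z); (21, 6%Z); (19, 4%Z);
    (17, 4%Z); (15, 8%Z); (13, 4%Z); (11, 4%Z); (9, 6%Z); (7, 4%Z); (5, 6%Z);
    (3, 4%Z); (1, 4%Z); (23, 7%Z); (21, 7%Z); (19, 5%Z); (17, 5%Z); (15, 9%Z);
    (13, 5%Z); (11, 5%Z); (9, 7%Z); (7, 5%Z); (5, 7%Z); (3, 5%Z); (1, 5%Z);
    (23, 8%Z); (21, 8%Z); (19, 6%Z); (17, 6%Z); (15, 10%Z); (13, 6%Z); (11, 6%Z);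
    (9, 8%Z); (7, 6%Z); (5, 8%Z); (3, 6%Z); (1, 6%Z); (23, 9%Z); (21, 9%Z);
    (19, 7%Z); (17, 7%Z); (15, 11%Z); (13, 7%Z); (11, 7%Z); (9, 9%Z); (7, 7%Z);
    (5, 9%Z); (3, 7%Z); (1, 7%Z); (21, 10%Z); (19, 8%Z); (17, 8%Z); (15, 12%Z);
    (13, 8%Z); (11, 8%Z); (7, 8%Z); (3, 8%Z); (1, 8%Z); (15, 13%Z); (13, 9%Z);
    (11, 9%Z); (7, 9%Z); (3, 9%Z); (1, 9%Z); (22, 1%Z); (20, 3%Z); (18, 5%Z);
    (16, 5%Z); (14, 3%Z); (12, 3%Z); (10, 3%Z); (8, 5%Z); (6, 3%Z); (4, 5%Z);
    (2, 5%Z); (0, 3%Z); (22, 0%Z); (20, 2%Z); (18, 4%Z); (16, 4%Z); (14, 2%Z);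
    (12, 2%Z); (10, 2%Z); (8, 4%Z); (6, 2%Z); (4, 4%Z); (2, 4%Z); (0, 2%Z); (22,
    (-1)%Z); (20, 1%Z); (18, 3%Z); (16, 3%Z); (14, 1%Z); (12, 1%Z); (10, 1%Z);
    (8, 3%Z); (6, 1%Z); (4, 3%Z); (2, 3%Z); (0, 1%Z); (22, (-2)%Z); (20, 0%Z);
    (18, 2%Z); (16, 2%Z); (14, 0%Z); (12, 0%Z); (10, 0%Z); (8, 2%Z); (6, 0%Z);
    (4, 2%Z); (2, 2%Z); (0, 0%Z); (22, (-3)%Z); (18, 1%Z); (16, 1%Z); (8, 1%Z);
    (4, 1%Z); (2, 1%Z); (8, 0%Z); (4, 0%Z); (2, 0%Z)]];
  gens := [:: 2; 4];
  window := 12;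
  pi_exp := 12%Z;
  pi_word := [::];
  dual :=
    [:: [::]; [:: 4]; [:: 5]; [:: 2]; [:: 3]; [:: 4; 2]; [:: 4; 3]; [:: 5; 2];
    [:: 5; 3]; [:: 2; 5]; [:: 2; 5; 2]; [:: 2; 5; 3]];
  dual_rank := [:: 5; 6; 1; 6; 4; 7; 5; 2; 0; 2; 3; 1] |}.

Lemma c7_check : check c7_one c7_cert.
Proof. by vm_compute. Qed.

Definition c8_one : mono := ([:: 0; 0; 0], [:: 0]%Z).

(** The element z enters through tsst = z s^-2 and stts = z t^-2, obtained from z = (sts)(sts) =
    (tst)(tst) by moving the outer letters across. *)
Definition c8_rels : seq relator :=
  inverse_rels c8_one 0 ++ inverse_rels c8_one 2 ++
  [:: quartic_rel c8_one ([:: 1; 0; 0], [:: 0]%Z) ([:: 0; 1; 0], [:: 0]%Z) ([:: 0;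
        0; 1], [:: 0]%Z) ([:: 0; 0; 0], [:: 1]%Z) 0;
      quartic_rel c8_one ([:: 1; 0; 0], [:: 0]%Z) ([:: 0; 1; 0], [:: 0]%Z) ([:: 0;
        0; 1], [:: 0]%Z) ([:: 0; 0; 0], [:: 1]%Z) 2;
      word_rel c8_one [:: 0; 2; 0] 0%Z [:: 2; 0; 2];
      word_rel c8_one [:: 2; 0; 0; 2] 1%Z [:: 1; 1];
      word_rel c8_one [:: 0; 2; 2; 0] 1%Z [:: 3; 3];
      word_rel c8_one [:: 2; 0; 3] 0%Z [:: 1; 2; 0];
      word_rel c8_one [:: 2; 1; 3] 0%Z [:: 1; 3; 0];
      word_rel c8_one [:: 3; 0; 2] 0%Z [:: 0; 2; 1];
      word_rel c8_one [:: 3; 1; 2] 0%Z [:: 0; 3; 1];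
      word_rel c8_one [:: 1; 3; 1] 0%Z [:: 3; 1; 3]].

Definition c8_cert := {|
  spanning :=
    [:: [::]; [:: 0]; [:: 1]; [:: 0; 0]; [:: 2]; [:: 2; 0]; [:: 2; 1]; [:: 2; 0; 0];
    [:: 0; 2]; [:: 0; 2; 0]; [:: 0; 2; 1]; [:: 0; 2; 0; 0]; [:: 1; 2]; [:: 1; 2; 0];
    [:: 1; 2; 1]; [:: 1; 2; 0; 0]; [:: 0; 0; 2]; [:: 0; 0; 2; 0]; [:: 0; 0; 2; 1];
    [:: 0; 0; 2; 0; 0]; [:: 2; 2]; [:: 0; 2; 2]; [:: 1; 2; 2]; [:: 0; 0; 2; 2]];
  relators := c8_rels;
  deductions :=
    [:: (Def 1, (0, 0)); (Def 2, (1, 0)); (Def 3, (0, 1)); (Def 4, (2, 0)); (Def 5,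
    (2, 1)); (Def 6, (2, 2)); (Def 7, (2, 3)); (Def 8, (0, 4)); (Def 9, (0, 5));
    (Def 10, (0, 6)); (Def 11, (0, 7)); (Def 12, (1, 4)); (Def 13, (1, 5)); (Def 14,
    (1, 6)); (Def 15, (1, 7)); (Def 16, (0, 8)); (Def 17, (0, 9)); (Def 18,
    (0, 10)); (Def 19, (0, 11)); (Def 20, (2, 4)); (Def 21, (0, 20)); (Def 22,
    (1, 20)); (Def 23, (0, 21)); (Rel 0 0, (0, 2)); (Rel 1 0, (1, 1)); (Rel 3 0,
    (3, 4)); (Rel 6 0, (2, 8)); (Rel 11 0, (3, 8)); (Rel 1 1, (1, 3)); (Rel 3 1,
    (3, 5)); (Rel 6 1, (2, 9)); (Rel 7 1, (2, 17)); (Rel 11 1, (3, 9)); (Rel 3 2,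
    (3, 6)); (Rel 6 2, (2, 10)); (Rel 3 3, (3, 7)); (Rel 7 3, (2, 19)); (Rel 11 3,
    (3, 11)); (Rel 0 4, (0, 12)); (Rel 1 4, (1, 8)); (Rel 3 4, (3, 20)); (Rel 6 4,
    (2, 21)); (Rel 8 4, (3, 0)); (Rel 9 4, (1, 9)); (Rel 10 4, (1, 10)); (Rel 0 5,
    (0, 13)); (Rel 9 5, (1, 11)); (Rel 0 6, (0, 14)); (Rel 8 6, (3, 2)); (Rel 0 7,
    (0, 15)); (Rel 1 8, (1, 16)); (Rel 11 8, (3, 17)); (Rel 1 9, (1, 17)); (Rel 10
    9, (1, 21)); (Rel 1 10, (1, 18)); (Rel 1 11, (1, 19)); (Rel 0 20, (0, 22)); (Rel
    1 21, (1, 23)); (Rel 4 0, (1, 2)); (Rel 5 0, (3, 19)); (Rel 7 0, (2, 16)); (Rel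
    4 1, (0, 3)); (Rel 5 2, (2, 6)); (Rel 11 2, (3, 10)); (Rel 6 3, (2, 11)); (Rel 4
    4, (1, 12)); (Rel 5 4, (2, 20)); (Rel 7 4, (2, 23)); (Rel 4 5, (1, 13)); (Rel 8
    5, (3, 1)); (Rel 3 6, (3, 21)); (Rel 4 6, (1, 14)); (Rel 4 7, (1, 15)); (Rel 4
    8, (0, 16)); (Rel 4 9, (0, 17)); (Rel 12 0, (3, 12)); (Rel 4 10, (0, 18)); (Rel
    4 11, (0, 19)); (Rel 12 1, (3, 13)); (Rel 10 11, (2, 5)); (Rel 4 20, (1, 22));
    (Rel 4 21, (0, 23)); (Rel 2 1, (2, 18)); (Rel 9 2, (2, 13)); (Rel 12 4,
    (3, 22)); (Rel 8 7, (3, 3)); (Rel 12 2, (3, 14)); (Rel 7 10, (2, 12)); (Rel 11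
    10, (3, 16)); (Rel 12 3, (3, 15)); (Rel 5 1, (3, 18)); (Rel 10 10, (2, 7)); (Rel
    5 5, (2, 22)); (Rel 12 5, (3, 23)); (Rel 9 0, (2, 15)); (Rel 9 1, (2, 14))];
  row_cmds :=
    [:: RowCmd [::] 5 3 [::] ((-2)%Z, 23); RowCmd [::] 5 3 [::] (2%Z, 23); RowCmd
    [::] 7 6 [::] ((-3)%Z, 18); RowCmd [::] 7 6 [::] (1%Z, 18); RowCmd [::] 5 12
    [::] ((-2)%Z, 15); RowCmd [::] 5 12 [::] (2%Z, 15); RowCmd [::] 9 15 [::]
    ((-2)%Z, 21); RowCmd [::] 12 12 [::] (3%Z, 22); RowCmd [:: 1] 5 12 [::] ((-2)%Z,
    19); RowCmd [::] 5 13 [::] (2%Z, 14); RowCmd [:: 1] 7 6 [::] ((-3)%Z, 10);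
    RowCmd [::] 11 6 [::] (1%Z, 7); RowCmd [:: 1; 1] 5 12 [::] ((-2)%Z, 11); RowCmd
    [::] 5 7 [:: (1, 1%Z)] (3%Z, 16); RowCmd [:: 2; 0] 8 15 [:: (6, 0%Z); (6, 1%Z)]
    ((-1)%Z, 20); RowCmd [::] 12 7 [::] (3%Z, 6); RowCmd [:: 1; 1] 7 6 [::] ((-3)%Z,
    6); RowCmd [:: 0] 12 12 [::] (3%Z, 20); RowCmd [::] 5 7 [:: (2, 2%Z); (8, 1%Z)]
    ((-1)%Z, 16); RowCmd [:: 0] 11 6 [::] (1%Z, 11); RowCmd [:: 1; 3] 8 15 [::
    (2, 1%Z); (6, 0%Z); (8, 0%Z); (18, (-1)%Z)] ((-2)%Z, 17); RowCmd [::] 8 15 [::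
    (7, 0%Z)] (3%Z, 12); RowCmd [::] 11 6 [:: (4, (-1)%Z); (8, (-1)%Z); (12,
    (-1)%Z)] ((-3)%Z, 7); RowCmd [:: 1; 3] 8 15 [:: (1, 0%Z)] (2%Z, 17); RowCmd [::]
    12 12 [:: (0, 1%Z); (6, 1%Z); (14, 0%Z)] ((-1)%Z, 22); RowCmd [:: 1] 7 6 [::
    (3, 0%Z); (9, (-1)%Z); (15, (-2)%Z)] (1%Z, 10); RowCmd [:: 1] 5 23 [:: (2, 0%Z);
    (4, (-1)%Z); (4, 0%Z); (6, 0%Z); (8, 0%Z)] ((-2)%Z, 1); RowCmd [::] 9 15 [::
    (1, 0%Z); (7, (-1)%Z); (17, (-1)%Z)] (2%Z, 21); RowCmd [:: 1] 5 7 [:: (10, 2%Z);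
    (12, 1%Z)] ((-1)%Z, 8); RowCmd [:: 0; 2] 5 7 [:: (7, 1%Z); (15, 1%Z); (21, 1%Z)]
    (4%Z, 2); RowCmd [:: 1; 3] 12 7 [:: (2, 1%Z); (8, 0%Z); (18, (-1)%Z); (8, 1%Z);
    (12, 1%Z); (18, 0%Z); (22, 2%Z)] ((-1)%Z, 3); RowCmd [:: 0] 5 14 [:: (7, 0%Z);
    (11, 1%Z); (15, (-1)%Z)] (2%Z, 5); RowCmd [:: 2; 0; 0] 8 15 [:: (6, 0%Z);
    (6, 1%Z); (10, 2%Z); (12, 1%Z); (14, 0%Z); (28, 0%Z)] ((-1)%Z, 9); RowCmd [:: 0]
    8 15 [:: (17, 0%Z)] (3%Z, 4); RowCmd [:: 1; 1] 5 23 [:: (8, (-1)%Z); (10, 0%Z);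
    (8, 0%Z); (12, 0%Z); (14, (-1)%Z)] ((-2)%Z, 0); RowCmd [::] 5 14 [:: (1, 1%Z);
    (5, 0%Z); (9, 0%Z); (21, (-1)%Z)] (2%Z, 13); RowCmd [:: 1; 1] 5 7 [:: (16, 2%Z);
    (22, 2%Z)] ((-1)%Z, 4); RowCmd [:: 2] 5 7 [:: (1, 2%Z); (9, 2%Z); (13, 1%Z);
    (29, 0%Z)] (4%Z, 3); RowCmd [::] 5 13 [:: (2, 1%Z); (4, 0%Z); (8, 0%Z);
    (10, 1%Z); (12, 0%Z); (16, 1%Z); (22, 1%Z)] ((-2)%Z, 14); RowCmd [:: 3; 1; 1] 5
    7 [:: (15, 1%Z); (15, 0%Z); (17, 0%Z); (25, 2%Z); (33, 0%Z)] (3%Z, 0); RowCmd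
    [::] 8 15 [:: (2, 2%Z); (4, 1%Z); (8, 1%Z); (10, 2%Z); (12, 1%Z); (16, 2%Z);
    (18, 0%Z); (22, 2%Z); (28, 0%Z); (36, 0%Z); (38, 1%Z)] ((-1)%Z, 12); RowCmd
    [:: 1] 5 7 [:: (1, 1%Z); (7, 0%Z); (13, 0%Z); (17, 0%Z); (21, 0%Z); (27, 1%Z);
    (33, 0%Z)] (3%Z, 8); RowCmd [:: 3] 8 15 [:: (0, 0%Z); (2, 1%Z); (4, 0%Z);
    (8, 0%Z); (10, 1%Z); (12, 0%Z); (16, 1%Z); (18, (-1)%Z); (20, 0%Z); (22, 1%Z);
    (28, (-1)%Z); (32, (-1)%Z); (36, (-1)%Z); (38, 0%Z); (40, (-1)%Z)] ((-2)%Z, 13);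
    RowCmd [:: 1; 2] 5 7 [:: (1, 2%Z); (3, 3%Z); (7, 1%Z); (13, 1%Z); (17, 1%Z);
    (21, 1%Z); (27, 2%Z); (29, 0%Z); (33, 1%Z); (37, 0%Z); (39, 1%Z); (41, 1%Z)]
    (4%Z, 1); RowCmd [:: 1; 3; 0] 11 6 [:: (2, (-1)%Z); (4, (-2)%Z); (2, 0%Z); (4,
    (-1)%Z); (6, (-1)%Z); (8, (-1)%Z); (20, (-1)%Z); (26, (-1)%Z); (32, (-2)%Z);
    (42, (-1)%Z)] ((-3)%Z, 5); RowCmd [:: 0; 0] 5 14 [:: (17, 0%Z); (19, 1%Z);
    (25, 1%Z); (37, (-2)%Z); (39, (-1)%Z); (41, (-1)%Z); (43, (-2)%Z)] (2%Z, 9);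
    RowCmd [:: 0; 2] 5 7 [:: (2, 3%Z); (4, 2%Z); (8, 2%Z); (10, 3%Z); (12, 2%Z);
    (16, 3%Z); (20, 2%Z); (22, 3%Z); (26, 2%Z); (28, 1%Z); (30, 1%Z); (32, 1%Z);
    (34, 2%Z); (36, 1%Z); (38, 2%Z); (42, 2%Z); (44, 3%Z)] (0%Z, 2); RowCmd [:: 1] 5
    12 [:: (3, 1%Z); (5, 0%Z); (9, 0%Z); (11, 1%Z); (13, (-1)%Z); (15, (-1)%Z);
    (19, 1%Z); (21, (-1)%Z); (23, 0%Z); (25, 1%Z); (29, (-2)%Z); (31, 0%Z); (33,
    (-1)%Z); (35, 0%Z); (37, (-2)%Z); (39, (-1)%Z); (41, (-1)%Z); (43, (-2)%Z);
    (45, 0%Z)] (2%Z, 19)];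
  basis :=
    [:: (0%Z, [::]); (0%Z, [:: 0]); (0%Z, [:: 0; 0]); (0%Z, [:: 0; 0; 0]);
    (0%Z, [:: 2]); (0%Z, [:: 2; 0]); (0%Z, [:: 2; 0; 0]); (0%Z, [:: 2; 0; 0; 0]);
    (0%Z, [:: 0; 2]); (0%Z, [:: 0; 2; 0]); (0%Z, [:: 0; 2; 0; 0]);
    (0%Z, [:: 0; 2; 0; 0; 0]); (0%Z, [:: 0; 0; 2]); (0%Z, [:: 0; 0; 2; 0]);
    (0%Z, [:: 0; 0; 2; 0; 0]); (0%Z, [:: 0; 0; 2; 0; 0; 0]); (0%Z, [:: 0; 0; 0; 2]);
    (0%Z, [:: 0; 0; 0; 2; 0]); (0%Z, [:: 0; 0; 0; 2; 0; 0]);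
    (0%Z, [:: 0; 0; 0; 2; 0; 0; 0]); (0%Z, [:: 2; 2]); (0%Z, [:: 0; 2; 2]);
    (0%Z, [:: 0; 0; 2; 2]); (0%Z, [:: 0; 0; 0; 2; 2]); (1%Z, [::]); (1%Z, [:: 0]);
    (1%Z, [:: 0; 0]); (1%Z, [:: 0; 0; 0]); (1%Z, [:: 2]); (1%Z, [:: 2; 0]);
    (1%Z, [:: 2; 0; 0]); (1%Z, [:: 2; 0; 0; 0]); (1%Z, [:: 0; 2]);
    (1%Z, [:: 0; 2; 0]); (1%Z, [:: 0; 2; 0; 0]); (1%Z, [:: 0; 2; 0; 0; 0]);
    (1%Z, [:: 0; 0; 2]); (1%Z, [:: 0; 0; 2; 0]); (1%Z, [:: 0; 0; 2; 0; 0]);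
    (1%Z, [:: 0; 0; 2; 0; 0; 0]); (1%Z, [:: 0; 0; 0; 2]); (1%Z, [:: 0; 0; 0; 2; 0]);
    (1%Z, [:: 0; 0; 0; 2; 0; 0]); (1%Z, [:: 0; 0; 0; 2; 0; 0; 0]); (1%Z, [:: 2; 2]);
    (1%Z, [:: 0; 2; 2]); (1%Z, [:: 0; 0; 2; 2]); (1%Z, [:: 0; 0; 0; 2; 2]);
    (2%Z, [::]); (2%Z, [:: 0]); (2%Z, [:: 0; 0]); (2%Z, [:: 0; 0; 0]);
    (2%Z, [:: 2]); (2%Z, [:: 2; 0]); (2%Z, [:: 2; 0; 0]); (2%Z, [:: 2; 0; 0; 0]);
    (2%Z, [:: 0; 2]); (2%Z, [:: 0; 2; 0]); (2%Z, [:: 0; 2; 0; 0]);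
    (2%Z, [:: 0; 2; 0; 0; 0]); (2%Z, [:: 0; 0; 2]); (2%Z, [:: 0; 0; 2; 0]);
    (2%Z, [:: 0; 0; 2; 0; 0]); (2%Z, [:: 0; 0; 2; 0; 0; 0]); (2%Z, [:: 0; 0; 0; 2]);
    (2%Z, [:: 0; 0; 0; 2; 0]); (2%Z, [:: 0; 0; 0; 2; 0; 0]);
    (2%Z, [:: 0; 0; 0; 2; 0; 0; 0]); (2%Z, [:: 2; 2]); (2%Z, [:: 0; 2; 2]);
    (2%Z, [:: 0; 0; 2; 2]); (2%Z, [:: 0; 0; 0; 2; 2]); (3%Z, [::]); (3%Z, [:: 0]);
    (3%Z, [:: 0; 0]); (3%Z, [:: 0; 0; 0]); (3%Z, [:: 2]); (3%Z, [:: 2; 0]);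
    (3%Z, [:: 2; 0; 0]); (3%Z, [:: 2; 0; 0; 0]); (3%Z, [:: 0; 2]);
    (3%Z, [:: 0; 2; 0]); (3%Z, [:: 0; 2; 0; 0]); (3%Z, [:: 0; 2; 0; 0; 0]);
    (3%Z, [:: 0; 0; 2]); (3%Z, [:: 0; 0; 2; 0]); (3%Z, [:: 0; 0; 2; 0; 0]);
    (3%Z, [:: 0; 0; 2; 0; 0; 0]); (3%Z, [:: 0; 0; 0; 2]); (3%Z, [:: 0; 0; 0; 2; 0]);
    (3%Z, [:: 0; 0; 0; 2; 0; 0]); (3%Z, [:: 0; 0; 0; 2; 0; 0; 0]); (3%Z, [:: 2; 2]);
    (3%Z, [:: 0; 2; 2]); (3%Z, [:: 0; 0; 2; 2]); (3%Z, [:: 0; 0; 0; 2; 2])];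
  tau_cmds :=
    [seq basis_trace c8_one j | j <- [:: 94; 93; 92; 86; 85; 84; 82; 81; 80; 78; 77;
    76; 74; 73; 72; 70; 69; 68; 62; 61; 60; 58; 57; 56; 54; 53; 52; 50; 49; 48; 46;
    45; 44; 38; 37; 36; 34; 33; 32; 30; 29; 28; 26; 25; 24; 22; 21; 20; 14; 13; 12;
    10; 9; 8; 6; 5; 4; 2; 1; 0; 95; 90; 89; 88; 87; 83; 79; 75; 71; 66; 65; 64; 63;
    59; 55; 51; 47; 42; 41; 40; 39; 35; 31; 27; 23; 18; 17; 16; 15; 11; 7; 3; 91;
    67; 43; 19]] ++ [seq TauRow p.1 p.2 | p <- [:: (47, 2%Z); (45, 2%Z); (43, 0%Z);
    (41, 1%Z); (39, 1%Z); (37, 0%Z); (35, 2%Z); (33, 1%Z); (31, 2%Z); (29, 0%Z);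
    (27, 2%Z); (25, 3%Z); (23, 2%Z); (21, 1%Z); (19, 3%Z); (17, 1%Z); (15, 1%Z);
    (13, 1%Z); (11, 3%Z); (9, 2%Z); (7, 1%Z); (5, 2%Z); (3, 3%Z); (1, 2%Z);
    (43, 1%Z); (41, 2%Z); (39, 2%Z); (37, 1%Z); (33, 2%Z); (29, 1%Z); (27, 3%Z);
    (21, 2%Z); (17, 2%Z); (13, 2%Z); (7, 2%Z); (1, 3%Z); (46, (-1)%Z); (44, 2%Z);
    (42, 1%Z); (40, 0%Z); (38, 1%Z); (36, 0%Z); (34, 1%Z); (32, 0%Z); (30, 0%Z);
    (28, 0%Z); (26, 1%Z); (24, 0%Z); (22, 2%Z); (20, 1%Z); (18, 0%Z); (16, 2%Z);
    (14, 0%Z); (12, 1%Z); (10, 2%Z); (8, 1%Z); (6, 1%Z); (4, 1%Z); (2, 2%Z);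
    (0, 1%Z); (46, (-2)%Z); (44, 1%Z); (42, 0%Z); (40, (-1)%Z); (38, 0%Z); (36,
    (-1)%Z); (34, 0%Z); (32, (-1)%Z); (30, (-1)%Z); (28, (-1)%Z); (26, 0%Z); (24,
    (-1)%Z); (22, 1%Z); (20, 0%Z); (18, (-1)%Z); (16, 1%Z); (14, (-1)%Z); (12, 0%Z);
    (10, 1%Z); (8, 0%Z); (6, 0%Z); (4, 0%Z); (2, 1%Z); (0, 0%Z); (44, 0%Z); (42,
    (-1)%Z); (40, (-2)%Z); (38, (-1)%Z); (36, (-2)%Z); (32, (-2)%Z); (28, (-2)%Z);
    (22, 0%Z); (20, (-1)%Z); (18, (-2)%Z); (16, 0%Z); (12, (-1)%Z); (10, 0%Z); (8,
    (-1)%Z); (4, (-1)%Z); (2, 0%Z)]];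
  gens := [:: 0; 2];
  window := 4;
  pi_exp := 4%Z;
  pi_word := [::];
  dual :=
    [:: [::]; [:: 0]; [:: 1]; [:: 0; 0]; [:: 2]; [:: 2; 0]; [:: 2; 1]; [:: 2; 0; 0];
    [:: 0; 2]; [:: 0; 2; 0]; [:: 0; 2; 1]; [:: 0; 2; 0; 0]; [:: 1; 2]; [:: 1; 2; 0];
    [:: 1; 2; 1]; [:: 1; 2; 0; 0]; [:: 0; 0; 2]; [:: 0; 0; 2; 0]; [:: 0; 0; 2; 1];
    [:: 0; 0; 2; 0; 0]; [:: 2; 2]; [:: 0; 2; 2]; [:: 1; 2; 2]; [:: 0; 0; 2; 2]];
  dual_rank :=
    [:: 1; 2; 0; 3; 6; 11; 5; 12; 7; 12; 6; 13; 5; 10; 4; 11; 8; 13; 7; 14; 7; 8; 6;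
    9] |}.

Lemma c8_check : check c8_one c8_cert.
Proof. by vm_compute. Qed.

(** * Relators of the five groups *)

Local Open Scope ring_scope.

Section ElementarySymmetric.
Variables (R : comUnitRingType) (H : unitAlgType R).

(** By Vieta's formulas, the elementary symmetric function e_k of [r] when k is at most the size of
    [r]. *)
Definition elsym (r : seq R) k :=
  (-1) ^+ k * (\prod_(a <- r) ('X - a%:P))`_(size r - k).

Lemma elsym0 r : elsym r 0 = 1.
Proof.
rewrite /elsym subn0 mul1r; have := size_prod_XsubC r id => sz_p.
have /monicP := monic_prod_XsubC r xpredT id.
by rewrite lead_coefE sz_p.
Qed.

Lemma root_elsym (r : seq R) (x : H) : \prod_(a <- r) (x - a%:A) = 0 ->
  \sum_(i < (size r).+1) ((-1) ^+ i * elsym r i) *: x ^+ (size r - i) = 0.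
Proof.
move=> x0; set p := \prod_(a <- r) ('X - a%:P).
have sz_p : size p = (size r).+1 by rewrite size_prod_XsubC.
have p0 : horner_alg x p = 0.
  rewrite rmorph_prod -x0; apply: eq_bigr => a _ /=.
  by rewrite rmorphB /= horner_algX horner_algC.
rewrite -[RHS]p0 -[p in RHS]coefK poly_def sz_p linear_sum [RHS](reindex_inj rev_ord_inj).
apply: eq_bigr => i _; rewrite linearZ rmorphXn /= horner_algX subSS.
by rewrite /elsym mulrA -exprMn mulrNN mulr1 expr1n mul1r mulr_algl.
Qed.

Lemma elsym_unit (r : seq R) : {in r, forall a, a \is a GRing.unit} ->
  elsym r (size r) \is a GRing.unit.
Proof.
move=> rU; rewrite /elsym subnn unitrM unitrX ?unitrN1 // coef0_prod.
elim: r rU => [|a r IHr] rU; first by rewrite big_nil unitr1.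
rewrite big_cons unitrM coefB coefX coefC sub0r unitrN rU ?mem_head //.
by apply: IHr => c cr; rewrite rU // inE cr orbT.
Qed.

Variables (x : H) (e : nat -> R).
Hypotheses (xU : x \is a GRing.unit) (e0 : e 0%N = 1).

Lemma alt_sum2 : \sum_(i < 3) ((-1) ^+ i * e i) *: x ^+ (2 - i) = 0 ->
  x - (e 1%N)%:A + e 2%N *: x^-1 = 0.
Proof.
rewrite !big_ord_recl big_ord0 /= /bump /= !addn0 !add1n.
rewrite e0 expr0 !mulr1 scale1r sqrrN expr1n mul1r mulN1r scaleNr addr0 !addrA.
move/(congr1 ( *%R^~ x^-1)); rewrite !mulrDl mul0r mulrK // mulNr.
by rewrite -!scalerAl mulrV // mul1r.
Qed.

Lemma alt_sum3 : \sum_(i < 4) ((-1) ^+ i * e i) *: x ^+ (3 - i) = 0 ->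
  x ^+ 2 - e 1%N *: x + (e 2%N)%:A - e 3%N *: x^-1 = 0.
Proof.
rewrite !big_ord_recl big_ord0 /= /bump /= !addn0 !add1n.
rewrite subnn e0 !exprS expr0 !mulr1 scale1r !mulrNN !mulN1r ?opprK !mul1r.
rewrite !scaleNr addr0 !addrA.
move/(congr1 ( *%R^~ x^-1)); rewrite !mulrDl mul0r !mulNr -!scalerAl.
by rewrite !mulrA !mulrK // mulrV // !mul1r ?scaleNr.
Qed.

Lemma alt_sum4 : \sum_(i < 5) ((-1) ^+ i * e i) *: x ^+ (4 - i) = 0 ->
  x ^+ 2 - e 1%N *: x + (e 2%N)%:A - e 3%N *: x^-1 + e 4%N *: x ^- 2 = 0.
Proof.
rewrite !big_ord_recl big_ord0 /= /bump /= !addn0 !add1n.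
rewrite subnn e0 !exprS expr0 !mulr1 scale1r !mulrNN !mulN1r ?opprK !mul1r.
rewrite !scaleNr addr0 !addrA.
move/(congr1 ( *%R^~ (x * x)^-1)); rewrite !mulrDl mul0r !mulNr -!scalerAl invrM //.
by rewrite !mulrA !mulrK // mulrV // !mul1r ?scaleNr.
Qed.

End ElementarySymmetric.

(** * Consequences of the braid relations and central elements *)

Section BraidWords.
Variables (H : unitRingType) (s t : H).
Hypotheses (sU : s \is a GRing.unit) (tU : t \is a GRing.unit).

Lemma braid_conj : s * t * s = t * s * t -> t * s * t^-1 = s^-1 * t * s.
Proof.
move=> st; apply: (mulrI sU); rewrite !mulrA mulrV // mul1r st.
by rewrite mulrK.
Qed.

Lemma braid_conjV : s * t * s = t * s * t -> t * s^-1 * t^-1 = s^-1 * t^-1 * s.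
Proof.
move=> st; apply: (mulrI sU); rewrite !mulrA mulrV // mul1r.
apply: (mulrI tU); rewrite !mulrA mulrV // mul1r.
by rewrite -st !mulrK.
Qed.

Lemma braid_inv : s * t * s = t * s * t ->
  s^-1 * t^-1 * s^-1 = t^-1 * s^-1 * t^-1.
Proof.
by move/(congr1 GRing.inv); rewrite !invrM ?unitrMr ?sU ?tU // !mulrA.
Qed.

(** The Garside element a = sts = tst exchanges s and t by conjugation, so its square z is
    central. *)
Lemma braid3_central (z := s * t * s * t * s * t) : s * t * s = t * s * t ->
  [/\ z * s = s * z, z * t = t * z, z = s * t * s * s * t * s
    & z = t * s * t * t * s * t].
Proof.
move=> st; pose a := s * t * s.
have zE : z = a * a by rewrite {2}/a st /z /a !mulrA.
have sa : s * a = a * t by rewrite {1}/a st /a !mulrA.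
have ta : t * a = a * s by rewrite {2}/a st /a !mulrA.
split; last 2 first.
- by rewrite zE /a !mulrA.
- by rewrite zE /a st !mulrA.
- by rewrite zE -mulrA -ta mulrA -sa mulrA.
- by rewrite zE -mulrA -sa mulrA -ta mulrA.
Qed.

Lemma braid4_central (z := s * t * s * t) : s * t * s * t = t * s * t * s ->
  z * s = s * z /\ z * t = t * z.
Proof.
move=> st; split; first by rewrite {2}/z st /z !mulrA.
by rewrite {1}/z st /z !mulrA.
Qed.

Lemma braid6_central (z := s * t * s * t * s * t) :
  s * t * s * t * s * t = t * s * t * s * t * s -> z * s = s * z /\ z * t = t * z.
Proof.
move=> st; split; first by rewrite {2}/z st /z !mulrA.
by rewrite {1}/z st /z !mulrA.
Qed.

End BraidWords.

Lemma cyclic_central (H : unitRingType) (s t u : H) (z := s * t * u) :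
    s * t * u = t * u * s -> t * u * s = u * s * t ->
  [/\ z * s = s * z, z * t = t * z & z * u = u * z].
Proof.
move=> st tu; split.
- by rewrite {2}/z st /z !mulrA.
- by rewrite {2}/z st tu /z st !mulrA.
- by rewrite {1}/z st tu /z !mulrA.
Qed.

Lemma in_cons_rel (P : relator -> Prop) r rs :
  P r -> {in rs, forall r, P r} -> {in r :: rs, forall r, P r}.
Proof. by move=> Pr Prs q; rewrite inE => /predU1P[->|/Prs]. Qed.

Lemma in_cat_rel (P : relator -> Prop) rs qs :
  {in rs, forall r, P r} -> {in qs, forall r, P r} -> {in rs ++ qs, forall r, P r}.
Proof. by move=> Prs Pqs q; rewrite mem_cat => /orP[/Prs|/Pqs]. Qed.

Lemma in_nil_rel (P : relator -> Prop) : {in [::], forall r, P r}.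
Proof. by []. Qed.

Ltac mono_simpl := rewrite /mono_val /nexp_val /uexp_val /= !big_cons !big_nil /=
  ?expr0z ?expr1z ?expr0 ?expr1 ?mulr1 ?mul1r.
Ltac word_simpl := apply: word_rel_val; [by mono_simpl|];
  rewrite /word_val !big_cons !big_nil /letter /= ?expr1z ?mul1r !mulr1 !mulrA.
Ltac split_rels := do 2!(apply: in_cat_rel;
    [by apply: inverse_rels_val => //; mono_simpl|]);
  do ![apply: in_cons_rel]; last exact: in_nil_rel.

Section Relators.
Variables (R : comUnitRingType) (H : unitAlgType R).

Variables s t : H.
Hypotheses (sU : s \is a GRing.unit) (tU : t \is a GRing.unit).
Let stU : {in [:: s; t], forall x, x \is a GRing.unit}.
Proof. by move=> x; rewrite !inE => /orP[] /eqP ->. Qed.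

Definition cubic_at (a1 a2 a3 : R) (x : H) :=
  x ^+ 2 - a1 *: x + a2%:A - a3 *: x^-1 = 0.

Definition quartic_at (a1 a2 a3 a4 : R) (x : H) :=
  x ^+ 2 - a1 *: x + a2%:A - a3 *: x^-1 + a4 *: x ^- 2 = 0.

Definition quadratic_at (a1 a2 : R) (x : H) := x - a1%:A + a2 *: x^-1 = 0.

Lemma c4_relsP a1 a2 a3 : cubic_at a1 a2 a3 s -> cubic_at a1 a2 a3 t ->
    s * t * s = t * s * t ->
  {in c4_rels, forall r, rel_val [:: a1; a2] [:: a3] 1 (letter [:: s; t]) r = 0}.
Proof.
move=> s3 t3 st; split_rels.
- by apply: cubic_rel_val => //; mono_simpl.
- by apply: cubic_rel_val => //; mono_simpl.
- by word_simpl.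
- by word_simpl; apply: braid_conj.
- by word_simpl; apply: braid_conjV.
- by word_simpl; apply: esym; apply: braid_conj => //; exact: esym.
- by word_simpl; apply: esym; apply: braid_conjV => //; exact: esym.
- by word_simpl; apply: braid_inv.
Qed.

Lemma c5_relsP a1 a2 a3 b1 b2 b3 (z := s * t * s * t) :
    cubic_at a1 a2 a3 s -> cubic_at b1 b2 b3 t -> s * t * s * t = t * s * t * s ->
  {in c5_rels, forall r,
    rel_val [:: a1; a2; b1; b2] [:: a3; b3] z (letter [:: s; t]) r = 0}.
Proof.
move=> s3 t3 st; split_rels.
- by apply: cubic_rel_val => //; mono_simpl.
- by apply: cubic_rel_val => //; mono_simpl.
- by word_simpl; rewrite /z !mulrK.
- by word_simpl; rewrite /z st !mulrK.
Qed.

Lemma c6_relsP a1 a2 b1 b2 b3 (z := s * t * s * t * s * t) :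
    z \is a GRing.unit -> (forall h, z * h = h * z) ->
    quadratic_at a1 a2 s -> cubic_at b1 b2 b3 t ->
    s * t * s * t * s * t = t * s * t * s * t * s ->
  {in c6_rels, forall r,
    rel_val [:: a1; b1; b2] [:: a2; b3] z (letter [:: s; t]) r = 0}.
Proof.
move=> zU zC s2 t3 st; split_rels.
- apply: (@quadratic_rel_val _ _ _ _ _ _ _ _ _ _ _ _ _ s) => //; try mono_simpl => //.
  by rewrite /word_val big_seq1 expr0z mul1r.
- by apply: cubic_rel_val => //; mono_simpl.
- by word_simpl; rewrite /z !mulrK.
- by word_simpl; rewrite /z st !mulrK.
Qed.

Lemma c8_relsP a1 a2 a3 a4 z : (forall h, z * h = h * z) ->
    quartic_at a1 a2 a3 a4 s -> quartic_at a1 a2 a3 a4 t ->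
    s * t * s = t * s * t -> z = s * t * s * s * t * s -> z = t * s * t * t * s * t ->
  {in c8_rels, forall r,
    rel_val [:: a1; a2; a3] [:: a4] z (letter [:: s; t]) r = 0}.
Proof.
move=> zC s4 t4 st zs zt; split_rels.
- by apply: quartic_rel_val => //; mono_simpl.
- by apply: quartic_rel_val => //; mono_simpl.
- by word_simpl.
- by word_simpl; rewrite zC zs !mulrA mulVr // mul1r mulrK.
- by word_simpl; rewrite zC zt !mulrA mulVr // mul1r mulrK.
- by word_simpl; apply: braid_conj.
- by word_simpl; apply: braid_conjV.
- by word_simpl; apply: esym; apply: braid_conj => //; exact: esym.
- by word_simpl; apply: esym; apply: braid_conjV => //; exact: esym.
- by word_simpl; apply: braid_inv.
Qed.

End Relators.

Section ThreeGenerators.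
Variables (R : comUnitRingType) (H : unitAlgType R) (s t u : H).
Hypotheses (sU : s \is a GRing.unit) (tU : t \is a GRing.unit).
Hypothesis (uU : u \is a GRing.unit).
Let stuU : {in [:: s; t; u], forall x, x \is a GRing.unit}.
Proof. by move=> x; rewrite !inE => /or3P[] /eqP ->. Qed.

(** Needed for the last relator of G_7, whose element z t^-1 u^-1 is u s u^-1. *)
Lemma quadratic_conj a1 a2 : quadratic_at a1 a2 s ->
  quadratic_at a1 a2 (u * s * u^-1).
Proof.
rewrite /quadratic_at => s2.
have -> : (u * s * u^-1)^-1 = u * s^-1 * u^-1.
  by rewrite !invrM ?unitrMr ?unitrV // invrK mulrA.
have -> : a1%:A = u * a1%:A * u^-1 by rewrite mulr_algr -scalerAl mulrV.
by rewrite scalerAl scalerAr -mulrBl -mulrBr -mulrDl -mulrDr s2 mulr0 mul0r.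
Qed.

Lemma c7_relsP a1 a2 b1 b2 b3 c1 c2 c3 (z := s * t * u) :
    z \is a GRing.unit -> (forall h, z * h = h * z) ->
    quadratic_at a1 a2 s -> cubic_at b1 b2 b3 t -> cubic_at c1 c2 c3 u ->
  {in c7_rels, forall r, rel_val [:: a1; b1; b2; c1; c2] [:: a2; b3; c3] z
                           (letter [:: s; t; u]) r = 0}.
Proof.
move=> zU zC s2 t3 u3.
have sE : s = z * u^-1 * t^-1 by rewrite /z !mulrK.
do 2!(apply: in_cat_rel; [by apply: inverse_rels_val => //; mono_simpl|]).
do ![apply: in_cons_rel]; last exact: in_nil_rel.
- by apply: cubic_rel_val => //; mono_simpl.
- by apply: cubic_rel_val => //; mono_simpl.
- apply: (@quadratic_rel_val _ _ _ _ _ _ _ _ _ _ _ _ _ s) => //; try mono_simpl => //.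
  by rewrite /word_val !big_cons big_nil /letter /= expr1z mulr1 mulrA.
- apply: (@quadratic_rel_val _ _ _ _ _ _ _ _ _ _ _ _ _ (u * s * u^-1)) => //;
    try mono_simpl => //; last exact: quadratic_conj.
  rewrite /word_val !big_cons big_nil /letter /= expr1z mulr1 sE.
  by clearbody z; rewrite !mulrA -zC mulrK.
Qed.

End ThreeGenerators.

(** * Permutation representations *)

Local Open Scope nat_scope.

Section Code.
Variables (X : eqType) (gs : seq X).
Definition letter_code (a : X * bool) : nat := (index a.1 gs).*2 + a.2.
End Code.

Section PermutationRepresentation.
Variables (D : hecke_datum) (gs : seq (gen D)) (n : nat) (tabs : seq (seq nat)).
Local Notation word := (seq (gen D * bool)).

Definition perm_letter a i := nth 0 (nth [::] tabs (letter_code gs a)) i.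
Definition perm_word (w : word) i := foldr perm_letter i w.
Definition same_perm v w := all (fun i => perm_word v i == perm_word w i) (iota 0 n).

(** The tables define functions on all naturals through the default of [nth], and relations are
    tested only on points below [n]. The last clause makes these points stable, so that the tests
    can be composed. *)
Definition perm_check :=
  [&& all (fun lr => same_perm (positive lr.1) (positive lr.2)) (braid D),
      all (fun x => same_perm (positive (nseq (gdeg x) x)) [::]) gs,
      all (fun x => same_perm [:: (x, false); (x, true)] [::] &&
                    same_perm [:: (x, true); (x, false)] [::]) gs
    & all (fun x => all (fun i => (perm_letter (x, false) i < n) &&
                                  (perm_letter (x, true) i < n)) (iota 0 n)) gs].

Hypothesis gs_full : forall x, x \in gs.
Hypothesis check : perm_check.

Lemma same_permP v w :
  reflect (forall i, i < n -> perm_word v i = perm_word w i) (same_perm v w).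
Proof.
apply: (iffP allP) => vw i.
  by move=> i_n; apply/eqP/vw; rewrite mem_iota.
by rewrite mem_iota => i_n; apply/eqP/vw.
Qed.

Lemma perm_word_cat v w i : perm_word (v ++ w) i = perm_word v (perm_word w i).
Proof. exact: foldr_cat. Qed.

Lemma perm_word_lt w i : i < n -> perm_word w i < n.
Proof.
move=> i_n; elim: w => //= -[x b] w IHw.
have /and4P[_ _ _ /allP/(_ x (gs_full x))/allP/(_ (perm_word w i))] := check.
by rewrite mem_iota IHw => /(_ isT)/andP[]; case: b.
Qed.

Lemma perm_word_eq (v w : word) : word_eq (braid_rels D ++
    [seq (positive (nseq (gdeg x) x), [::]) | x <- enum (gen D)]) v w ->
  forall i, i < n -> perm_word v i = perm_word w i.
Proof.
have /and4P[/allP braidC /allP powC /allP invC _] := check.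
elim=> [lr|[x b]|//|v1 v2 _ IH i i_n|v1 v2 v3 _ IH1 _ IH2 i i_n|v1 v2 v3 v4 _ IH1 _ IH2 i i_n].
- rewrite mem_cat => /orP[/mapP[uv uv_in ->]|/mapP[x _ ->]]; apply/same_permP.
    exact: braidC.
  exact: powC.
- by have /andP[? ?] := invC x (gs_full x); apply/same_permP; case: b.
- by rewrite IH.
- by rewrite IH1 ?IH2.
- by rewrite !perm_word_cat IH2 // IH1 // perm_word_lt.
Qed.

Lemma refl_group_neq1 (w : word) :
  ~~ same_perm w [::] -> pgroup_of _ w != 1%g :> refl_group D.
Proof.
apply: contra => /eqP/pgroup_eqP w1; apply/same_permP; exact: perm_word_eq.
Qed.

End PermutationRepresentation.

(** * Hecke algebras with a certificate *)

Local Open Scope ring_scope.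

Section ShortProducts.
Variables (H : unitRingType) (X : Type) (F : X -> H).
Lemma prod3E a b c : \prod_(x <- [:: a; b; c]) F x = F a * F b * F c.
Proof. by rewrite !big_cons big_nil mulr1 !mulrA. Qed.

Lemma prod4E a b c d :
  \prod_(x <- [:: a; b; c; d]) F x = F a * F b * F c * F d.
Proof. by rewrite !big_cons big_nil mulr1 !mulrA. Qed.

Lemma prod6E a b c d e f :
  \prod_(x <- [:: a; b; c; d; e; f]) F x = F a * F b * F c * F d * F e * F f.
Proof. by rewrite !big_cons big_nil mulr1 !mulrA. Qed.

End ShortProducts.

Lemma prod3K (H : unitRingType) (s t u : H) : t \is a GRing.unit -> u \is a GRing.unit ->
  s = s * t * u / u / t.
Proof. by move=> tU uU; rewrite !mulrK. Qed.

Section Central.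
Variables (R : comUnitRingType) (H : algType R) (z : H).
Lemma centralD g h : z * g = g * z -> z * h = h * z -> z * (g + h) = (g + h) * z.
Proof. by move=> zg zh; rewrite mulrDr mulrDl zg zh. Qed.

Lemma central_word (I : Type) (F : I -> H) c (w : seq I) :
  (forall i, z * F i = F i * z) ->
  z * (c *: \prod_(i <- w) F i) = (c *: \prod_(i <- w) F i) * z.
Proof.
move=> zF; rewrite -scalerAr -scalerAl; congr (_ *: _).
by apply: commr_prod => i _; apply: zF.
Qed.

End Central.

Section Instance.
Variable D : hecke_datum.
Local Notation H := (hecke D).
Local Notation R := (hring D).

Lemma hecke_ind (P : H -> Prop) : P 0 -> (forall g h, P g -> P h -> P (g + h)) ->
  (forall c w, P (c *: \prod_(x <- w) hgen x)) -> forall h, P h.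
Proof.
move=> P0 PD Pw; elim/palgW => f; elim/free_alg_ind: f => [|f g Pf Pg|c w].
- by rewrite palg_of0.
- by rewrite palg_ofD; apply: PD.
- by rewrite palg_ofZ palg_of_prod; apply: Pw.
Qed.

Lemma central_gen (z : H) : (forall x, z * hgen x = hgen x * z) ->
  forall h, z * h = h * z.
Proof.
move=> zx; elim/hecke_ind => [|g h|c w]; first by rewrite mulr0 mul0r.
  exact: centralD.
exact: central_word.
Qed.

Variable gs : seq (gen D).
Hypothesis gs_full : forall x, x \in gs.
Local Notation L := (letter (map (@hgen D) gs)).
Local Notation wval := (word_val L).
Local Notation code := (letter_code gs).

Lemma hgens_unit : {in map (@hgen D) gs, forall x, x \is a GRing.unit}.
Proof. by move=> _ /mapP[x _ ->]; apply: hgen_unit. Qed.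

Lemma letter_codeE a : L (code a) = T_letter a.
Proof.
case: a => x b; rewrite /letter_code /letter /T_letter oddD odd_double addbC addbF.
have -> : (((index x gs).*2 + b)./2 = index x gs)%N by rewrite addnC half_bit_double.
by rewrite (nth_map x) ?index_mem // nth_index //; case: b.
Qed.

Lemma T_code w : T (pgroup_of (braid_rels D) w) = wval (map code w).
Proof.
by rewrite T_of /word_val big_map; apply: eq_bigr => a _; rewrite letter_codeE.
Qed.

Lemma word_val_wpow w k : wval (wpow w k) = wval w ^+ k.
Proof.
by elim: k => [|k IHk]; rewrite ?exprS /word_val ?big_nil // big_cat; congr (_ * _).
Qed.

Lemma braid_pi_word :
  T (braid_pi D) = wval (wpow (map code (positive (zword D))) (zord D)).
Proof.
rewrite word_val_wpow -T_code /braid_pi; elim: (zord D) => [|k IHk].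
  by rewrite expr0 expg0 T_one.
by rewrite exprS expgS T_mul IHk.
Qed.

Variables (zcode : seq nat) (C : certificate).
(** With exponents >= 0 an element z^k w is literally a concatenation of letters, so agreement of
    the certificate with the basis and with pi is an equality of lists. *)
Definition code_check :=
  [&& map (map code) (basis_words D)
      == [seq wpow zcode (absz p.1) ++ p.2 | p <- basis C],
      all (fun p => 0 <= p.1) (basis C), 0 <= pi_exp C,
      wpow (map code (positive (zword D))) (zord D)
      == wpow zcode (absz (pi_exp C)) ++ pi_word C,
      nth [::] (basis_words D) 0 == [::]
    & size (basis C) == (window C * size (dual C))%N].
Hypothesis codeC : code_check.

Lemma pow_word_val (k : int) w : 0 <= k ->
  wval (wpow zcode (absz k) ++ w) = wval zcode ^ k * wval w.
Proof. by case: k => // k _; rewrite word_valM word_val_wpow. Qed.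

Lemma code_basis_size : size (basis C) = size (basis_words D).
Proof.
have /and5P[/eqP/(congr1 size) + _ _ _ _] := codeC.
by rewrite !size_map => ->.
Qed.

Lemma code_basis j : (j < size (basis_words D))%N ->
  T (pgroup_of (braid_rels D) (nth [::] (basis_words D) j))
  = basis_val (wval zcode) L C j.
Proof.
move=> jB; have /and5P[/eqP codeE /allP pos _ _ _] := codeC.
have jC : (j < size (basis C))%N by rewrite code_basis_size.
rewrite T_code -(nth_map _ [::]) // codeE (nth_map (Posz 0, [::])) //.
rewrite pow_word_val //; apply: pos; exact: mem_nth.
Qed.

Lemma code_pi : T (braid_pi D) = wval zcode ^ pi_exp C * wval (pi_word C).
Proof.
have /and5P[_ _ pos /eqP piE _] := codeC.
by rewrite braid_pi_word piE pow_word_val.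
Qed.

Lemma code_head : nth [::] (basis_words D) 0 = [::].
Proof. by have /and5P[_ _ _ _ /andP[/eqP]] := codeC. Qed.

Lemma code_dual : size (basis C) = (window C * size (dual C))%N.
Proof. by have /and5P[_ _ _ _ /andP[_ /eqP]] := codeC. Qed.

Hypothesis hB : is_basis (hecke_basis D).
Hypothesis degP : forall c : par D, deg c \in [:: 2; 3; 4]%N.
Variables (ns us : seq R) (one : mono).
Hypothesis usU : {in us, forall u, u \is a GRing.unit}.
Hypothesis one1 : mono_val ns us one = 1.
Local Notation z := (wval zcode).
Hypothesis zx : forall x, z * hgen x = hgen x * z.
Hypothesis rels0 : {in relators C, forall r, rel_val ns us z L r = 0}.
Hypothesis gen_closed : forall P : H -> Prop,
  (forall x y, P x -> P y -> P (x * y)) ->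
  (forall x, x \is a GRing.unit -> P x -> P x^-1) -> P z ->
  {in gens C, forall g, P (L g)} -> forall x, P (hgen x).
Variables (n : nat) (tabs : seq (seq nat)).
Hypothesis permC : perm_check gs n tabs.
Hypothesis perm_basis :
  all (fun w => ~~ same_perm gs n tabs w [::]) (behead (basis_words D)).
Hypothesis checkC : check one C.

Lemma canonical_of_checks (tau : {scalar H}) :
  (forall x, x \in hecke_basis D -> tau x = (x == 1)%:R) -> canonical_trace tau.
Proof.
move=> tauP; apply: (canonical_of_certificate hB degP usU _ _ one1 rels0 gen_closed
  code_basis_size code_head code_basis code_pi _ code_dual checkC tauP).
- exact: word_val_unit hgens_unit _.
- exact: central_gen.
- move=> w /(allP perm_basis); exact: refl_group_neq1.
Qed.

Lemma canonical_exists : exists tau : {scalar H}, canonical_trace tau.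
Proof.
have [tau tauE] := basis_scalar (\row_i ((i : nat) == 0%N)%:R) hB.
exists tau; apply: canonical_of_checks => _ /(nthP 0)[i i_lt <-].
rewrite (tauE (Ordinal i_lt)) mxE /=.
have b0 : (hecke_basis D)`_0 = 1.
  rewrite /hecke_basis (nth_map [::]); last first.
    by have := i_lt; rewrite size_map; apply: leq_ltn_trans.
  by rewrite code_head T_of big_nil.
have [->|i0] := eqVneq i 0%N; first by rewrite b0 eqxx.
rewrite -b0 (negPf (basis_neq hB _ _ i0)) //; exact: leq_ltn_trans i_lt.
Qed.

Lemma canonical_and_exists :
  (forall tau : {scalar H}, (forall x, x \in hecke_basis D -> tau x = (x == 1)%:R) ->
     canonical_trace tau) /\ exists tau : {scalar H}, canonical_trace tau.
Proof. by split; [exact: canonical_of_checks | exact: canonical_exists]. Qed.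

End Instance.

(** * Elementary symmetric functions of the indeterminates of a class *)

Section ElementarySymmetricIndeterminates.
Variable D : hecke_datum.

Definition uvars (c : par D) : seq (hring D) :=
  [seq lX (Tagged (fun c => 'I_(deg c)) j) | j <- index_enum 'I_(deg c)].
Definition usym c k := elsym (uvars c) k.

Lemma size_uvars c : size (uvars c) = deg c.
Proof. by rewrite size_map -[RHS]card_ord cardE enumT. Qed.

Lemma usym_unit c : usym c (deg c) \is a GRing.unit.
Proof.
rewrite -(size_uvars c); apply: elsym_unit => _ /mapP[j _ ->]; exact: lX_unit.
Qed.

Lemma hgen_uvars x : \prod_(a <- uvars (cls x)) (hgen x - a%:A) = 0.
Proof. by rewrite big_map; apply: hgen_poly. Qed.

Lemma hgen_usym x : \sum_(i < (deg (cls x)).+1)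
  ((-1) ^+ i * usym (cls x) i) *: hgen x ^+ (deg (cls x) - i) = 0.
Proof.
by have := root_elsym (hgen_uvars x); rewrite size_uvars.
Qed.

Lemma hgen_quadratic x c : cls x = c -> deg c = 2 ->
  quadratic_at (usym c 1) (usym c 2) (hgen x).
Proof.
move=> <- d; have := hgen_usym x; rewrite d.
exact: alt_sum2 (hgen_unit x) (elsym0 _).
Qed.

Lemma hgen_cubic x c : cls x = c -> deg c = 3 ->
  cubic_at (usym c 1) (usym c 2) (usym c 3) (hgen x).
Proof.
move=> <- d; have := hgen_usym x; rewrite d.
exact: alt_sum3 (hgen_unit x) (elsym0 _).
Qed.

Lemma hgen_quartic x c : cls x = c -> deg c = 4 ->
  quartic_at (usym c 1) (usym c 2) (usym c 3) (usym c 4) (hgen x).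
Proof.
move=> <- d; have := hgen_usym x; rewrite d.
exact: alt_sum4 (hgen_unit x) (elsym0 _).
Qed.

End ElementarySymmetricIndeterminates.

(** * The five groups *)

Local Open Scope nat_scope.

(* For each letter, an action of the reflection group on points followed by one
   cycle per class of generators, on which the group acts through its
   abelianisation. *)
Definition perms4 : seq (seq nat) :=
  [:: [:: 0; 2; 4; 6; 1; 3; 5; 7; 9; 10; 8];
      [:: 0; 4; 1; 5; 2; 6; 3; 7; 10; 8; 9];
      [:: 3; 5; 2; 4; 0; 7; 6; 1; 9; 10; 8];
      [:: 4; 7; 2; 0; 3; 1; 6; 5; 10; 8; 9]].

Definition perms5 : seq (seq nat) :=
  [:: [:: 0; 7; 5; 1; 4; 6; 2; 3; 9; 10; 8; 11; 12; 13];
      [:: 0; 3; 6; 7; 4; 2; 5; 1; 10; 8; 9; 11; 12; 13];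
      [:: 5; 6; 2; 3; 1; 7; 4; 0; 8; 9; 10; 12; 13; 11];
      [:: 7; 4; 2; 3; 6; 0; 1; 5; 8; 9; 10; 13; 11; 12]].

Definition perms6 : seq (seq nat) :=
  [:: [:: 10; 9; 15; 13; 14; 12; 11; 8; 7; 1; 0; 6; 5; 3; 4; 2; 17; 16; 18; 19; 20];
      [:: 10; 9; 15; 13; 14; 12; 11; 8; 7; 1; 0; 6; 5; 3; 4; 2; 17; 16; 18; 19; 20];
      [:: 0; 14; 2; 9; 11; 5; 13; 7; 1; 12; 6; 15; 3; 10; 8; 4; 16; 17; 19; 20; 18];
      [:: 0; 8; 2; 12; 15; 5; 10; 7; 14; 3; 13; 4; 9; 6; 1; 11; 16; 17; 20; 18; 19]].

Definition perms7 : seq (seq nat) :=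
  [:: [:: 13; 10; 14; 9; 11; 12; 15; 8; 7; 3; 1; 4; 5; 0; 2; 6; 17; 16; 18; 19; 20;
          21; 22; 23];
      [:: 13; 10; 14; 9; 11; 12; 15; 8; 7; 3; 1; 4; 5; 0; 2; 6; 17; 16; 18; 19; 20;
          21; 22; 23];
      [:: 9; 1; 2; 11; 15; 5; 13; 7; 3; 12; 4; 8; 0; 14; 6; 10; 16; 17; 19; 20; 18;
          21; 22; 23];
      [:: 12; 1; 2; 8; 10; 5; 14; 7; 11; 0; 15; 3; 9; 6; 13; 4; 16; 17; 20; 18; 19;
          21; 22; 23];
      [:: 0; 13; 9; 3; 4; 11; 6; 15; 1; 10; 2; 14; 7; 8; 5; 12; 16; 17; 18; 19; 20;
          22; 23; 21];
      [:: 0; 8; 10; 3; 4; 14; 6; 12; 13; 2; 9; 5; 15; 1; 11; 7; 16; 17; 18; 19; 20;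
          23; 21; 22]].

Definition perms8 : seq (seq nat) :=
  [:: [:: 15; 23; 20; 9; 21; 10; 3; 17; 16; 12; 5; 18; 6; 19; 22; 0; 2; 13; 14; 7; 8;
          1; 11; 4; 25; 26; 27; 24];
      [:: 15; 21; 16; 6; 23; 10; 12; 19; 20; 3; 5; 22; 9; 17; 18; 0; 8; 7; 11; 13; 2;
          4; 14; 1; 27; 24; 25; 26];
      [:: 22; 8; 13; 21; 11; 16; 19; 1; 14; 20; 17; 4; 18; 2; 7; 23; 12; 3; 5; 0; 15;
          10; 6; 9; 25; 26; 27; 24];
      [:: 19; 7; 13; 17; 11; 18; 22; 14; 1; 23; 21; 4; 16; 2; 8; 20; 5; 10; 12; 6; 9;
          3; 0; 15; 27; 24; 25; 26]].

Local Notation gens2 := [:: gs2; gt2].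
Local Notation gens3 := [:: gs3; gt3; gu3].

Lemma G4_perm : @perm_check G4 gens2 11 perms4. Proof. by vm_compute. Qed.

Lemma G4_basis_perm : all (fun w => ~~ @same_perm G4 gens2 11 perms4 w [::])
  (behead (basis_words G4)). Proof. by vm_compute. Qed.

Lemma G4_code : @code_check G4 gens2 [::] c4_cert. Proof. by vm_compute. Qed.

Lemma G5_perm : @perm_check G5 gens2 14 perms5. Proof. by vm_compute. Qed.

Lemma G5_basis_perm : all (fun w => ~~ @same_perm G5 gens2 14 perms5 w [::])
  (behead (basis_words G5)). Proof. by vm_compute. Qed.

Lemma G5_code : @code_check G5 gens2 [:: 0; 2; 0; 2] c5_cert. Proof. by vm_compute. Qed.

Lemma G6_perm : @perm_check G6 gens2 21 perms6. Proof. by vm_compute. Qed.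

Lemma G6_basis_perm : all (fun w => ~~ @same_perm G6 gens2 21 perms6 w [::])
  (behead (basis_words G6)). Proof. by vm_compute. Qed.

Lemma G6_code : @code_check G6 gens2 [:: 0; 2; 0; 2; 0; 2] c6_cert. Proof. by vm_compute. Qed.

Lemma G7_perm : @perm_check G7 gens3 24 perms7. Proof. by vm_compute. Qed.

Lemma G7_basis_perm : all (fun w => ~~ @same_perm G7 gens3 24 perms7 w [::])
  (behead (basis_words G7)). Proof. by vm_compute. Qed.

Lemma G7_code : @code_check G7 gens3 [:: 0; 2; 4] c7_cert. Proof. by vm_compute. Qed.

Lemma G8_perm : @perm_check G8 gens2 28 perms8. Proof. by vm_compute. Qed.

Lemma G8_basis_perm : all (fun w => ~~ @same_perm G8 gens2 28 perms8 w [::])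
  (behead (basis_words G8)). Proof. by vm_compute. Qed.

Lemma G8_code : @code_check G8 gens2 [:: 0; 2; 0; 2; 0; 2] c8_cert. Proof. by vm_compute. Qed.

Local Open Scope ring_scope.

Lemma gens2_full (x : 'I_2) : x \in gens2.
Proof. by case: x => [[|[|]]]. Qed.

Lemma gens3_full (x : 'I_3) : x \in gens3.
Proof. by case: x => [[|[|[|]]]]. Qed.

Definition bmm_statement D :=
  (forall tau : {scalar hecke D},
     (forall x, x \in hecke_basis D -> tau x = (x == 1)%:R) -> canonical_trace tau)
  /\ exists tau : {scalar hecke D}, canonical_trace tau.

Lemma in_gens2 (P : 'I_2 -> Prop) : P gs2 -> P gt2 -> forall x, P x.
Proof. by move=> Ps Pt x; have := gens2_full x; rewrite !inE => /orP[] /eqP ->. Qed.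

Lemma in_gens3 (P : 'I_3 -> Prop) : P gs3 -> P gt3 -> P gu3 -> forall x, P x.
Proof.
by move=> Ps Pt Pu x; have := gens3_full x; rewrite !inE => /or3P[] /eqP ->.
Qed.

Local Notation alternating6 s t := (s * t * s * t * s * t).

Lemma G5_bmm : is_basis (hecke_basis G5) -> bmm_statement G5.
Proof.
move=> hB.
have := @hgen_braid G5 _ (mem_head _ _); rewrite [LHS]prod4E [RHS]prod4E => st.
have zE : word_val (letter (map (@hgen G5) gens2)) [:: 0; 2; 0; 2]%N
    = @hgen G5 gs2 * @hgen G5 gt2 * @hgen G5 gs2 * @hgen G5 gt2 by exact: prod4E.
have [zs zt] := braid4_central st.
pose a := @usym G5 gs2; pose b := @usym G5 gt2.
apply: (@canonical_and_exists G5 gens2 gens2_full _ _ G5_code hB _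
  [:: a 1%N; a 2; b 1%N; b 2] [:: a 3; b 3] c5_one _ _ _ _ _ _ _ G5_perm G5_basis_perm
  c5_check).
- by [].
- by move=> x; rewrite !inE => /orP[] /eqP ->; apply: usym_unit.
- exact: mono_val_one.
- by rewrite zE; exact: in_gens2 zs zt.
- rewrite zE; apply: (c5_relsP (hgen_unit _) (hgen_unit _) _ _ st).
    exact: hgen_cubic.
  exact: hgen_cubic.
- move=> P _ _ _ PL; apply: in_gens2; [exact: (PL 0%N isT) | exact: (PL 2%N isT)].
Qed.

(* The certificate of G4 does not use z, whence z = 1 here. *)
Lemma G4_bmm : is_basis (hecke_basis G4) -> bmm_statement G4.
Proof.
move=> hB.
have := @hgen_braid G4 _ (mem_head _ _); rewrite [LHS]prod3E [RHS]prod3E => st.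
have zE : word_val (letter (map (@hgen G4) gens2)) [::] = 1 by exact: big_nil.
pose a := @usym G4 ord0.
apply: (@canonical_and_exists G4 gens2 gens2_full _ _ G4_code hB _
  [:: a 1%N; a 2] [:: a 3] c4_one _ _ _ _ _ _ _ G4_perm G4_basis_perm c4_check).
- by [].
- by move=> x; rewrite inE => /eqP ->; apply: usym_unit.
- exact: mono_val_one.
- by rewrite zE => x; rewrite mulr1 mul1r.
- rewrite zE; apply: (c4_relsP (hgen_unit _) (hgen_unit _) _ _ st).
    exact: hgen_cubic.
  exact: hgen_cubic.
- move=> P _ _ _ PL; apply: in_gens2; [exact: (PL 0%N isT) | exact: (PL 2%N isT)].
Qed.

Lemma G6_bmm : is_basis (hecke_basis G6) -> bmm_statement G6.
Proof.
move=> hB.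
have := @hgen_braid G6 _ (mem_head _ _); rewrite [LHS]prod6E [RHS]prod6E => st.
have zE : word_val (letter (map (@hgen G6) gens2)) [:: 0; 2; 0; 2; 0; 2]%N
    = alternating6 (@hgen G6 gs2) (@hgen G6 gt2) by exact: prod6E.
have [zs zt] := braid6_central st.
have zx x : alternating6 (@hgen G6 gs2) (@hgen G6 gt2) * hgen x
    = hgen x * alternating6 (@hgen G6 gs2) (@hgen G6 gt2).
  by move: x; exact: in_gens2 zs zt.
pose a := @usym G6 gs2; pose b := @usym G6 gt2.
apply: (@canonical_and_exists G6 gens2 gens2_full _ _ G6_code hB _
  [:: a 1%N; b 1%N; b 2] [:: a 2; b 3] c6_one _ _ _ _ _ _ _ G6_perm G6_basis_perm
  c6_check).
- by apply: in_gens2.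
- by move=> x; rewrite !inE => /orP[] /eqP ->; apply: usym_unit.
- exact: mono_val_one.
- by rewrite zE.
- have zU := word_val_unit (@hgens_unit G6 gens2) [:: 0; 2; 0; 2; 0; 2]%N.
  rewrite zE in zU *.
  apply: (c6_relsP (hgen_unit _) (hgen_unit _) zU (central_gen zx) _ _ st).
    exact: hgen_quadratic.
  exact: hgen_cubic.
- move=> P _ _ _ PL; apply: in_gens2; [exact: (PL 0%N isT) | exact: (PL 2%N isT)].
Qed.

Lemma G8_bmm : is_basis (hecke_basis G8) -> bmm_statement G8.
Proof.
move=> hB.
have := @hgen_braid G8 _ (mem_head _ _); rewrite [LHS]prod3E [RHS]prod3E => st.
have zE : word_val (letter (map (@hgen G8) gens2)) [:: 0; 2; 0; 2; 0; 2]%N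
    = alternating6 (@hgen G8 gs2) (@hgen G8 gt2) by exact: prod6E.
have [zs zt zs' zt'] := braid3_central st.
have zx x : alternating6 (@hgen G8 gs2) (@hgen G8 gt2) * hgen x
    = hgen x * alternating6 (@hgen G8 gs2) (@hgen G8 gt2).
  by move: x; exact: in_gens2 zs zt.
pose a := @usym G8 ord0.
apply: (@canonical_and_exists G8 gens2 gens2_full _ _ G8_code hB _
  [:: a 1%N; a 2; a 3] [:: a 4] c8_one _ _ _ _ _ _ _ G8_perm G8_basis_perm c8_check).
- by [].
- by move=> x; rewrite inE => /eqP ->; apply: usym_unit.
- exact: mono_val_one.
- by rewrite zE.
- rewrite zE.
  apply: (c8_relsP (hgen_unit _) (hgen_unit _) (central_gen zx) _ _ st zs' zt').
    exact: hgen_quartic.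
  exact: hgen_quartic.
- move=> P _ _ _ PL; apply: in_gens2; [exact: (PL 0%N isT) | exact: (PL 2%N isT)].
Qed.

Lemma G7_bmm : is_basis (hecke_basis G7) -> bmm_statement G7.
Proof.
move=> hB.
have := @hgen_braid G7 _ (mem_head _ _); rewrite [LHS]prod3E [RHS]prod3E => st.
have := @hgen_braid G7 _ (mem_last _ _); rewrite [LHS]prod3E [RHS]prod3E => tu.
have zE : word_val (letter (map (@hgen G7) gens3)) [:: 0; 2; 4]%N
    = @hgen G7 gs3 * @hgen G7 gt3 * @hgen G7 gu3 by exact: prod3E.
have [zs zt zu] := cyclic_central st tu.
have zx x : @hgen G7 gs3 * @hgen G7 gt3 * @hgen G7 gu3 * hgen x
    = hgen x * (@hgen G7 gs3 * @hgen G7 gt3 * @hgen G7 gu3).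
  by move: x; exact: in_gens3 zs zt zu.
have zU := word_val_unit (@hgens_unit G7 gens3) [:: 0; 2; 4]%N.
rewrite zE in zU.
pose a := @usym G7 gs3; pose b := @usym G7 gt3; pose c := @usym G7 gu3.
apply: (@canonical_and_exists G7 gens3 gens3_full _ _ G7_code hB _
  [:: a 1%N; b 1%N; b 2; c 1%N; c 2] [:: a 2; b 3; c 3] c7_one _ _ _ _ _ _ _
  G7_perm G7_basis_perm c7_check).
- by apply: in_gens3.
- by move=> x; rewrite !inE => /or3P[] /eqP ->; apply: usym_unit.
- exact: mono_val_one.
- by rewrite zE.
- rewrite zE; apply: (c7_relsP (hgen_unit _) (hgen_unit _) (hgen_unit _) zU
    (central_gen zx)).
  + exact: hgen_quadratic.
  + exact: hgen_cubic.
  + exact: hgen_cubic.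
- move=> P PM PV Pz PL.
  have Pt := PL 2%N isT; have Pu := PL 4%N isT.
  (* The certificate tests t and u only; s is recovered as z u^-1 t^-1 from the closure properties
     of P. *)
  apply: (in_gens3 _ Pt Pu).
  rewrite zE in Pz.
  have -> : @hgen G7 gs3 = @hgen G7 gs3 * @hgen G7 gt3 * @hgen G7 gu3
     / @hgen G7 gu3 / @hgen G7 gt3.
    exact: prod3K (hgen_unit _) (hgen_unit _).
  exact: PM (PM _ _ Pz (PV _ (hgen_unit _) Pu)) (PV _ (hgen_unit _) Pt).
Qed.

Theorem theorem5p2 (n : nat) (hn : (4 <= n <= 8)%N)
    (hB : is_basis (hecke_basis (hecke_data n))) :
  (forall tau : {scalar hecke (hecke_data n)},
     (forall b, b \in hecke_basis (hecke_data n) -> tau b = (b == 1)%:R) ->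
     canonical_trace tau)
  /\ (exists tau : {scalar hecke (hecke_data n)}, canonical_trace tau).
Proof.
case: n hn hB => [|[|[|[|[|[|[|[|[|n]]]]]]]]] // _ hB.
- exact: G4_bmm.
- exact: G5_bmm.
- exact: G6_bmm.
- exact: G7_bmm.
- exact: G8_bmm.
Qed.
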